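(* Let $V$ be a unitary vertex operator algebra of CFT type which is $C_2$-cofinite and such that every $\mathbb N$-gradable weak $V$-module is completely reducible. Let $W_i,W_j,W_k$ be unitary $V$-modules and $\mathcal Y_\alpha\in\mathcal V{k\choose i~j}$. Suppose that $w^{(i)}\in W_i$ is homogeneous and that $\mathcal Y_\alpha(w^{(i)},x)$ is energy-bounded, with $M,r,t\ge0$ such that $\|\mathcal Y_\alpha(w^{(i)},s)w^{(j)}\|\le M(1+|s|)^t\|w^{(j)}\|_r$ for all $s\in\mathbb R$, $w^{(j)}\in W_j$. Then for any $f\in C_c^\infty(S^1\setminus\{-1\})$: (a) $\mathcal Y_\alpha(w^{(i)},f)\mathcal H^\infty_j\subset \mathcal H^\infty_k$. Moreover, for any $p\in\mathbb R$ there exists $M_p\ge0$, independent of $f$, such that for any $\xi^{(j)}\in\mathcal H^\infty_j$, $$\big\| \mathcal Y_\alpha(w^{(i)},f)\xi^{(j)} \big\|_p\le M_p\,|f|_{V,|p|+t}\,\big\| \xi^{(j)} \big\|_{p+r}.$$ (b) $\mathcal Y_\alpha(w^{(i)},f):\mathcal H^\infty_j\to\mathcal H^\infty_k$ has a formal adjoint $\mathcal Y_\alpha(w^{(i)},f)^\dagger:\mathcal H^\infty_k\to \mathcal H^\infty_j$, which satisfies $$\mathcal Y_\alpha(w^{(i)},f)^\dagger=\sum_{m\ge0}\frac {e^{-i\pi\Delta_{w^{(i)}}}} {m!}\mathcal Y_{\alpha^*}\big(\overline{L_1^mw^{(i)}},\overline {e_{(m+2-2\Delta_{w^{(i)}})}f}\big).$$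 In particular, if $w^{(i)}$ is quasi-primary, then $$\mathcal Y_\alpha(w^{(i)},f)^\dagger= e^{-i\pi\Delta_{w^{(i)}}}\, \mathcal Y_{\alpha^*}\big(\overline{w^{(i)}},\overline {e_{(2-2\Delta_{w^{(i)}})}f}\big).$$
   Context: VOAs and modules. A VOA $V=\bigoplus_{n\in\mathbb Z}V(n)$ ($\dim V(n)<\infty$, $V(n)=0$ for $n\ll0$) has vertex operators $Y(u,x)=\sum_{n\in\mathbb Z}Y(u,n)x^{-n-1}$, vacuum $\Omega\in V(0)$, conformal vector $\nu\in V(2)$, with the usual axioms. CFT type: $V(0)=\mathbb C\Omega$, $V(n)=0$ for $n<0$. A $V$-module $W_i=\bigoplus_{s\in\mathbb R}W_i(s)$ ($\dim W_i(s)<\infty$, $W_i(s)=0$ for $s\ll0$) has a vertex operator $Y_i(v,x)=\sum_{n\in\mathbb Z}Y_i(v,n)x^{-n-1}$ with the usual axioms, $L_n=Y_i(\nu,n+1)$, $L_0=s$ on $W_i(s)$. A vector in $W_i(s)$ is homogeneous of weight $s$; $\Delta_w$ is the weight of $w$; a homogeneous $w$ is quasi-primary if $L_1w=0$. $W_{\overline i}=\bigoplus_sW_i(s)^*$ is the contragredient module, $Y_{\overline i}(v,x)=Y_i(e^{xL_1}(-x^{-2})^{L_0}v,x^{-1})^{\mathrm t}$. $C_2$-cofinite: $\dim V/\mathrm{span}\{Y(u,-2)v\}<\infty$. An $\mathbb N$-gradable weak module is a space with vertex operator satisfying the module axioms except those on the $L_0$-grading, admitting a grading $\bigoplus_{n\in\mathbb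 N}W(n)$ with $Y(v,m)W(n)\subset W(n+\Delta_v-m-1)$. Under the hypotheses there are finitely many irreducible $V$-modules up to isomorphism. Unitarity. Inner products are antilinear in the second variable. $V$ is unitary if it has an inner product with $\langle\Omega|\Omega\rangle=1$ and an antilinear automorphism $\theta$ (fixing $\Omega,\nu$) such that $\langle Y(v,x)v_1|v_2\rangle=\langle v_1|Y(e^{xL_1}(-x^{-2})^{L_0}\theta v,x^{-1})v_2\rangle$. A $V$-module $W_i$ with an inner product is unitary if the same holds with $Y_i$. For unitary $W_i$, $C_i:W_i\to W_{\overline i}$, $C_iw=\overline w$, is the antilinear bijection with $\langle C_iw_1,w_2\rangle=\langle w_2|w_1\rangle$; $W_{\overline i}$ is given the inner product making $C_i$ antiunitary. $\mathcal H_i$ is the Hilbert space completion of $W_i$; $L_0$ on $W_i$ is essentially self-adjoint with positive closure $\overline{L_0}$; $\mathcal H_i^r=\mathscr D((1+\overline{L_0})^r)$, $\|\xi\|_r=\|(1+\overline{L_0})^r\xi\|$, $\mathcal H_i^\infty=\bigcap_{r\ge0}\mathcal H_i^r$. Intertwining operators. $\mathcal V{k\choose i~j}$ is the space of type $k\choose i~j$ intertwining operators: linear maps $w^{(i)}\in W_i\mapsto\mathcal Y_\alpha(w^{(i)},x)=\sum_{s\in\mathbb R}\mathcal Y_\alpha(w^{(i)},s)x^{-s-1}$, $\mathcal Y_\alpha(w^{(i)},s)\in\mathrm{Hom}(W_j,W_k)$, with lower truncation, $\frac d{dx}\mathcal Y_\alpha(w,x)=\mathcal Y_\alpha(L_{-1}w,x)$,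 and Jacobi identity $\sum_{l\ge0}{m\choose l}\mathcal Y_\alpha(Y_i(u,n+l)w,m+s-l)=\sum_{l\ge0}(-1)^l{n\choose l}Y_k(u,m+n-l)\mathcal Y_\alpha(w,s+l)-\sum_{l\ge0}(-1)^{l+n}{n\choose l}\mathcal Y_\alpha(w,n+s-l)Y_j(u,m+l)$. The adjoint intertwining operator $\mathcal Y_{\alpha^*}\in\mathcal V{j\choose\overline i~k}$ is $\mathcal Y_{\alpha^*}(\overline{w^{(i)}},x)=\mathcal Y_\alpha(e^{xL_1}(e^{-i\pi}x^{-2})^{L_0}w^{(i)},x^{-1})^\dagger$ (formal adjoint). $\mathcal Y_\alpha(w^{(i)},x)$ is energy-bounded if an inequality as in the claim holds for some $M,r,t\ge0$; in that case $\mathcal Y_{\alpha^*}(\overline{L_1^mw^{(i)}},x)$ is energy-bounded for every $m\ge 0$. Smearing. For $z=e^{i\theta}$ we take $\arg z=\theta$, $z^s=e^{is\theta}$. For $f\in C_c^\infty(S^1\setminus\{-1\})$ (smooth functions on $S^1$ supported in $S^1\setminus\{-1\}$), $\mathcal Y_\alpha(w^{(i)},f)$ is first defined as a sesquilinear form by $\langle\mathcal Y_\alpha(w^{(i)},f)w^{(j)}|w^{(k)}\rangle=\int_{-\pi}^\pi\langle\mathcal Y_\alpha(w^{(i)},e^{i\theta})w^{(j)}|w^{(k)}\rangle f(e^{i\theta})\frac{e^{i\theta}}{2\pi}d\theta$ on $W_j\times W_k$. When $\mathcal Y_\alpha(w^{(i)},x)$ is energy-bounded this is a preclosed operator from $\mathcal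 H_j$ (domain $W_j$) to $\mathcal H_k$, whose closure has $\mathcal H_j^\infty$ in its domain; $\mathcal Y_\alpha(w^{(i)},f)$ then denotes the restriction of this closure to $\mathcal H_j^\infty$. Its formal adjoint is the restriction of its Hilbert space adjoint to a map $\mathcal H_k^\infty\to\mathcal H_j^\infty$. Norms. $\widehat f(s)=\int_{-\pi}^\pi f(e^{i\theta})e^{-is\theta}\frac{d\theta}{2\pi}$ ($s\in\mathbb R$). For irreducible $W_i$, $\Delta_i$ is its lowest weight. $\mathcal D_V=\{\Delta_i+\Delta_j-\Delta_k:W_i,W_j,W_k\text{ irreducible }V\text{-modules}\}$ (finite), $\mathbb Z_V=\mathbb Z+\mathcal D_V$, and $|f|_{V,t}=\sum_{s\in\mathbb Z_V}(1+|s|)^t|\widehat f(s)|<\infty$. $e_r(e^{i\theta})=e^{ir\theta}$ for $-\pi<\theta<\pi$. *)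

(* Defs.v *)
From HB Require Import structures.
From mathcomp Require Import all_boot all_order all_algebra.
From mathcomp Require Import complex.
From mathcomp Require Import all_classical all_reals all_analysis.

Set Implicit Arguments.
Unset Strict Implicit.
Unset Printing Implicit Defensive.

Import Order.TTheory GRing.Theory Num.Theory.
Import numFieldNormedType.Exports.

Local Open Scope classical_set_scope.
Local Open Scope ring_scope.

(* The complex field is R[i] with R : realType.  All sums [\sum_(i \in A)]
   below are sums of families with finite support (fsbigop): the lower
   truncation axioms make the families that occur finitely supported. *)

Section LinearAlgebra.
Context (K : fieldType) (W : lmodType K).

Definition subspace (A : set W) : Prop :=
  A 0 /\ forall (a : K) u v, A u -> A v -> A (a *: u + v).

Definition finite_dim (A : set W) : Prop :=
  exists (n : nat) (e : 'I_n -> W), forall w, A w ->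
    exists c : 'I_n -> K, w = \sum_(i < n) c i *: e i.

Definition lspan (A : set W) : set W :=
  [set w | exists (n : nat) (c : 'I_n -> K) (e : 'I_n -> W),
     (forall i, A (e i)) /\ w = \sum_(i < n) c i *: e i].

Definition finite_codim (A : set W) : Prop :=
  exists (n : nat) (e : 'I_n -> W), forall w,
    exists c : 'I_n -> K, A (w - \sum_(i < n) c i *: e i).

Context (I : choiceType).

Definition decomposition (gr : I -> set W) (w : W) (c : I -> W) : Prop :=
  [/\ forall i, gr i (c i),
      finite_set [set i | c i != 0] &
      w = \sum_(i \in [set: I]) c i].

Definition direct_sum (gr : I -> set W) : Prop :=
  (forall i, subspace (gr i)) /\
  forall w, exists! c : I -> W, decomposition gr w c.

Definition component (gr : I -> set W) (w : W) : I -> W :=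
  xget (fun=> 0) [set c | decomposition gr w c].

End LinearAlgebra.

(* A family of modes [Y a s : B -> D] stands for the formal series
   [Y(a, x) = \sum_s Y a s x^(- s - 1)]; the exponents s range over int for
   vertex operators and over R for intertwining operators. *)
Section Modes.
Context (R : realType) (S : realDomainType).
Local Notation C := R[i].

Definition bilinear_modes (A B D : lmodType C) (Y : A -> S -> B -> D) : Prop :=
  (forall s b, linear (fun a => Y a s b)) /\
  (forall a s, linear (Y a s)).

Definition lower_truncated (A B D : lmodType C) (Y : A -> S -> B -> D) : Prop :=
  forall a b, exists N : S, forall s, N <= s -> Y a s b = 0.

Definition gbinom (m : int) (l : nat) : C :=
  (\prod_(i < l) (m - i%:Z)%:~R) / l`!%:R.

Definition jacobi (V A B D : lmodType C)
    (YA : V -> int -> A -> A) (YB : V -> int -> B -> B) (YD : V -> int -> D -> D)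
    (Y : A -> S -> B -> D) : Prop :=
  forall (u : V) (a : A) (b : B) (m n : int) (s : S),
    \sum_(l \in [set: nat])
       gbinom m l *: Y (YA u (n + l%:Z) a) (m%:~R + s - l%:R) b
    = \sum_(l \in [set: nat])
       ((-1) ^+ l * gbinom n l) *: YD u (m + n - l%:Z) (Y a (s + l%:R) b)
    - \sum_(l \in [set: nat])
       ((-1) ^ (l%:Z + n) * gbinom n l) *:
          Y a (n%:~R + s - l%:R) (YB u (m + l%:Z) b).

End Modes.

Section VertexAlgebra.
Context (R : realType).
Local Notation C := R[i].

(* Axioms common to the adjoint module and to weak modules; the Virasoro
   relations on W follow from those of V and the Jacobi identity. *)
Definition module_axioms (V : lmodType C) (YV : V -> int -> V -> V)
    (vac conf : V) (W : lmodType C) (Y : V -> int -> W -> W) : Prop :=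
  [/\ bilinear_modes Y,
      lower_truncated Y,
      (forall n w, Y vac n w = if n == -1 then w else 0),
      jacobi YV Y Y Y &
      (forall v n w, Y (YV conf 0 v) n w = - (n%:~R *: Y v (n - 1) w))].

Record voa := Voa {
  voa_sort :> lmodType C;
  voa_gr : int -> set voa_sort;
  voa_Y : voa_sort -> int -> voa_sort -> voa_sort;
  vacuum : voa_sort;
  conformal : voa_sort;
  voa_module_axioms : module_axioms voa_Y vacuum conformal voa_Y;
  voa_direct_sum : direct_sum voa_gr;
  voa_finite_dim : forall n, finite_dim (voa_gr n);
  voa_truncated : exists N : int, forall n, n < N -> voa_gr n `<=` [set 0];
  voa_vacuum : voa_gr 0 vacuum;
  voa_conformal : voa_gr 2 conformal;
  voa_creation : forall v, voa_Y v (-1) vacuum = v /\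
    forall n : int, 0 <= n -> voa_Y v n vacuum = 0;
  voa_L0 : forall n v, voa_gr n v -> voa_Y conformal 1 v = n%:~R *: v;
  voa_virasoro : exists c : C, forall (m n : int) v,
    voa_Y conformal (m + 1) (voa_Y conformal (n + 1) v)
    - voa_Y conformal (n + 1) (voa_Y conformal (m + 1) v)
    = (m - n)%:~R *: voa_Y conformal (m + n + 1) v
      + (if m + n == 0 then c / 12%:R * (m ^+ 3 - m)%:~R else 0) *: v
}.

Definition CFT_type (V : voa) : Prop :=
  (forall v : V, voa_gr 0 v <-> exists c : C, v = c *: vacuum V) /\
  (forall n : int, n < 0 -> @voa_gr V n `<=` [set 0]).

Definition C2_cofinite (V : voa) : Prop :=
  finite_codim (lspan [set w : V | exists u v, w = voa_Y u (- 2) v]).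

Section Modules.
Context (V : voa).

Definition weak_module (W : lmodType C) (Y : V -> int -> W -> W) : Prop :=
  module_axioms (@voa_Y V) (vacuum V) (conformal V) Y.

Section Submodules.
Context (W : lmodType C) (Y : V -> int -> W -> W).

Definition N_gradable : Prop :=
  exists gr : nat -> set W, direct_sum gr /\
    forall (d m : int) (n : nat) v w, voa_gr d v -> gr n w ->
      match n%:Z + d - m - 1 with
      | Posz k => gr k (Y v m w)
      | Negz _ => Y v m w = 0
      end.

Definition submodule (U : set W) : Prop :=
  subspace U /\ forall v n w, U w -> U (Y v n w).

Definition irreducible_submodule (U : set W) : Prop :=
  [/\ submodule U, ~ (U `<=` [set 0]) &
      forall U' : set W, submodule U' -> U' `<=` U ->
        U' `<=` [set 0] \/ U' = U].

Definition completely_reducible : Prop :=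
  exists (I : choiceType) (U : I -> set W),
    direct_sum U /\ forall i, irreducible_submodule (U i).

End Submodules.

Record vmod_data := VmodData {
  vmod_sort :> lmodType C;
  mgr : R -> set vmod_sort;
  mY : V -> int -> vmod_sort -> vmod_sort
}.

Definition Ln (W : vmod_data) (n : int) (w : W) : W :=
  mY (conformal V) (n + 1) w.

Definition is_vmodule (W : vmod_data) : Prop :=
  [/\ weak_module (@mY W),
      direct_sum (@mgr W),
      (forall s, finite_dim (@mgr W s)),
      (exists N : R, forall s, s < N -> @mgr W s `<=` [set 0]) &
      (forall s (w : W), mgr s w -> Ln 0 w = s%:C%C *: w)].

Record vmodule := Vmodule {
  vmodule_data :> vmod_data;
  vmoduleP : is_vmodule vmodule_data
}.

Definition irreducible_module (W : vmod_data) : Prop :=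
  irreducible_submodule (@mY W) [set: W].

Definition lowest_weight (W : vmod_data) (d : R) : Prop :=
  ~ (@mgr W d `<=` [set 0]) /\ forall s, s < d -> @mgr W s `<=` [set 0].

(* Coefficient of x^(-n-1) in Y(e^(x L_1) (- x^(-2))^(L_0) v, x^(-1)). *)
Definition opp_mode (W : lmodType C) (Y : V -> int -> W -> W)
    (v : V) (n : int) (w : W) : W :=
  \sum_(d \in [set: int]) \sum_(m \in [set: nat])
     ((-1) ^ d / m`!%:R) *:
       Y (iter m (voa_Y (conformal V) 2) (component (@voa_gr V) v d))
         (d *+ 2 - m%:Z - n - 2) w.

(* The graded dual of W, i.e. the direct sum of the W(s)^*, realised as the
   space of linear functionals that vanish on all but finitely many W(s). *)
Section Contragredient.
Context (W : vmod_data).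

Definition in_gdual : pred (W -> C) := fun phi =>
  `[< scalar phi /\
      finite_set [set s | exists2 w : W, mgr s w & phi w != 0] >].

Lemma in_gdual_submod : submod_closed in_gdual.
Proof.
split.
  rewrite unfold_in; apply/asboolP; split.
    by move=> a u v; rewrite /= mulr0 addr0.
  rewrite (_ : [set s | _] = set0); first exact: finite_set0.
  by apply/seteqP; split => // s [w _ /eqP].
move=> a phi psi /asboolP[lphi fphi] /asboolP[lpsi fpsi].
rewrite unfold_in; apply/asboolP; split.
  move=> b u v; rewrite !fctE lphi lpsi /GRing.scale /=.
  by rewrite !mulrDr !mulrA (mulrC a b) addrACA.
apply: (sub_finite_set _ (_ : finite_set (_ `|` _))); last first.
  by rewrite finite_setU; split; [exact: fphi|exact: fpsi].
move=> s [w sw nz] /=.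
have [p0|/eqP p0] := pselect (phi w = 0); last by left; exists w.
right; exists w => //; apply: contra nz => /eqP q0.
by rewrite !fctE p0 q0 scaler0 addr0.
Qed.

HB.instance Definition _ :=
  GRing.isSubmodClosed.Build C (W -> C) in_gdual in_gdual_submod.

Record gdual := Gdual { gdual_fun :> W -> C; _ : in_gdual gdual_fun }.

HB.instance Definition _ := [isSub for gdual_fun].
HB.instance Definition _ := [Choice of gdual by <:].
HB.instance Definition _ := [SubChoice_isSubLmodule of gdual by <:].

Definition contragredient : vmod_data := {|
  vmod_sort := gdual : lmodType C;
  mgr := fun s => [set phi : gdual |
           forall (s' : R) (w : W), s' != s -> mgr s' w -> phi w = 0];
  mY := fun v n phi => insubd (0 : gdual)
           (fun w => (phi : gdual) (opp_mode (@mY W) v n w))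
|}.

End Contragredient.

Definition intertwining (Wi Wj Wk : vmod_data) (Y : Wi -> R -> Wj -> Wk) : Prop :=
  [/\ bilinear_modes Y,
      lower_truncated Y,
      (forall w s w', Y (Ln (- 1) w) s w' = - (s%:C%C *: Y w (s - 1) w')) &
      jacobi (@mY Wi) (@mY Wj) (@mY Wk) Y].

End Modules.

Definition hnorm (U : lmodType C) (ip : {dot U for @Num.conj C}) (u : U) : R :=
  Num.sqrt (complex.Re (ip u u)).

(* Invariance of the inner product; the formal variable is self-conjugate. *)
Definition invariant (V : voa) (theta : V -> V) (W : lmodType C)
    (Y : V -> int -> W -> W) (ip : {dot W for @Num.conj C}) : Prop :=
  forall v n w1 w2, ip (Y v n w1) w2 = ip w1 (opp_mode Y (theta v) n w2).

Record unitary_voa := UnitaryVoa {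
  uvoa_voa :> voa;
  uvoa_ip : {dot uvoa_voa for @Num.conj C};
  uvoa_theta : uvoa_voa -> uvoa_voa;
  uvoa_vacuum : uvoa_ip (vacuum uvoa_voa) (vacuum uvoa_voa) = 1;
  uvoa_theta_antilinear : forall (a : C) u v,
    uvoa_theta (a *: u + v) = a^* *: uvoa_theta u + uvoa_theta v;
  uvoa_theta_bij : bijective uvoa_theta;
  uvoa_theta_Y : forall u n v,
    uvoa_theta (voa_Y u n v) = voa_Y (uvoa_theta u) n (uvoa_theta v);
  uvoa_theta_vacuum : uvoa_theta (vacuum uvoa_voa) = vacuum uvoa_voa;
  uvoa_theta_conformal : uvoa_theta (conformal uvoa_voa) = conformal uvoa_voa;
  uvoa_invariant : invariant uvoa_theta (@voa_Y uvoa_voa) uvoa_ip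
}.

Record unitary_module (V : unitary_voa) := UnitaryModule {
  umod_module :> vmodule V;
  umod_ip : {dot umod_module for @Num.conj C};
  umod_invariant : invariant (@uvoa_theta V) (@mY V umod_module) umod_ip
}.

Arguments umod_ip {V} u.

Section Adjoint.
Context (V : unitary_voa) (Wi Wj Wk : unitary_module V).

Definition conj_vec (W : unitary_module V) (w : W) : contragredient W :=
  insubd (0 : gdual W) (fun w' : W => umod_ip W w' w).

Definition conj_vec_inv (W : unitary_module V) (phi : contragredient W) : W :=
  xget 0 [set w | conj_vec w = phi].

Definition formal_adjoint (T : Wj -> Wk) (wk : Wk) : Wj :=
  xget 0 [set w | forall wj, umod_ip Wk (T wj) wk = umod_ip Wj wj w].

End Adjoint.

Definition expi (t : R) : C := (cos t +i* sin t)%C.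

(* For w = C_i^(-1) phi, this is the coefficient of x^(-s-1) in
   Y(e^(x L_1) (e^(- i pi) x^(-2))^(L_0) w, x^(-1))^dagger, the formal variable
   being self-conjugate. *)
Definition adjoint_intertwining (V : unitary_voa) (Wi Wj Wk : unitary_module V)
    (Y : Wi -> R -> Wj -> Wk) (phi : contragredient Wi) (s : R) : Wk -> Wj :=
  formal_adjoint (fun wj =>
    \sum_(d \in [set: R]) \sum_(m \in [set: nat])
      (expi (- (pi * d)) / m`!%:R) *:
        Y (iter m (Ln 1) (component (@mgr V Wi) (conj_vec_inv phi) d))
          (d *+ 2 - m%:R - s - 2%:R) wj).

(* H is a completion of W: a Hilbert space with a dense isometric image of W. *)
Record completion (U : lmodType C) (ip : {dot U for @Num.conj C}) := Completion {
  hilbert :> completeNormedModType C;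
  hip : {dot hilbert for @Num.conj C};
  hipE : forall x, hip x x = `|x| ^+ 2;
  hemb : U -> hilbert;
  hemb_linear : linear hemb;
  hemb_isometry : forall u v, hip (hemb u) (hemb v) = ip u v;
  hemb_dense : closure (range hemb) = [set: hilbert]
}.

Arguments hip {U ip} c.

Section Energy.
Context (V : unitary_voa) (W : unitary_module V) (H : completion (umod_ip W)).

Definition L0_closure : set (H * H) :=
  closure [set x : H * H | exists w : W, x = (hemb H w, hemb H (Ln 0 w))].

(* Functional calculus g(A) for a self-adjoint operator A, given by its graph,
   whose eigenvectors are total: g(A) x = y when, for each eigenvalue s, the
   projection of y on the s-eigenspace is g(s) times that of x. *)
Definition fun_calculus (A : set (H * H)) (g : R -> R) : set (H * H) :=
  [set x : H * H | forall (s : R) (e : H), A (e, s%:C%C *: e) ->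
     hip H x.2 e = (g s)%:C%C * hip H x.1 e].

Definition energy_pow (r : R) : set (H * H) :=
  fun_calculus L0_closure (fun s => (1 + s) `^ r).

Definition Hr (r : R) : set H := [set x | exists y, energy_pow r (x, y)].

Definition Hinf : set H := [set x | forall r, 0 <= r -> Hr r x].

(* Meaningful for x in Hr r. *)
Definition energy_norm (r : R) (x : H) : R :=
  hnorm (hip H) (xget 0 [set y | energy_pow r (x, y)]).

End Energy.

(* Functions on the circle are represented by maps R[i] -> R[i], of which only
   the values at the points expi t are used. *)
Section Circle.

Definition cintegral (a b : R) (g : R -> C) : C :=
  ((\int[lebesgue_measure]_(t in `[a, b]) complex.Re (g t))%R +i*
   (\int[lebesgue_measure]_(t in `[a, b]) complex.Im (g t))%R)%C.

Definition smooth (g : R -> R) : Prop :=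
  forall n x, derivable (derive1n n g) x 1.

Definition Cc_circle (f : C -> C) : Prop :=
  [/\ smooth (fun t => complex.Re (f (expi t))),
      smooth (fun t => complex.Im (f (expi t))) &
      exists2 e : R, 0 < e &
        forall t, pi - e <= `|t| -> `|t| <= pi -> f (expi t) = 0].

Definition fourier (f : C -> C) (s : R) : C :=
  ((2 * pi)^-1)%:C%C *
  cintegral (- pi) pi (fun t => f (expi t) * expi (- (s * t))).

Definition circle_arg (z : C) : R :=
  xget 0 [set t | (- pi < t) /\ (t <= pi) /\ expi t = z].

Definition e_ (r : R) (z : C) : C := expi (r * circle_arg z).

Definition D_ (V : voa) : set R :=
  [set d | exists (Wi Wj Wk : vmodule V) (di dj dk : R),
     [/\ irreducible_module Wi, irreducible_module Wj & irreducible_module Wk] /\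
     [/\ lowest_weight Wi di, lowest_weight Wj dj, lowest_weight Wk dk &
         d = di + dj - dk]].

Definition Z_ (V : voa) : set R :=
  [set s | exists (n : int) (d : R), D_ V d /\ s = n%:~R + d].

Definition circle_norm (V : voa) (t : R) (f : C -> C) : \bar R :=
  \esum_(s in Z_ V) ((1 + `|s|) `^ t * complex.Re `|fourier f s|)%:E.

End Circle.

(* [T s] are the modes Y(w, s) for a fixed w. *)
Section Smearing.
Context (V : unitary_voa) (Wj Wk : unitary_module V)
  (Hj : completion (umod_ip Wj)) (Hk : completion (umod_ip Wk)).

Definition energy_bound (T : R -> Wj -> Wk) (M r t : R) : Prop :=
  forall (s : R) (w : Wj),
    hnorm (umod_ip Wk) (T s w)
    <= M * (1 + `|s|) `^ t * energy_norm r (hemb Hj w).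

Definition smeared_form (T : R -> Wj -> Wk) (f : C -> C) (wj : Wj) (wk : Wk) : C :=
  cintegral (- pi) pi (fun t =>
    (\sum_(s \in [set: R]) umod_ip Wk (T s wj) wk * expi (- ((s + 1) * t)))
    * f (expi t) * (expi t * ((2 * pi)^-1)%:C%C)).

Definition smeared_graph (T : R -> Wj -> Wk) (f : C -> C) : set (Hj * Hk) :=
  [set x : Hj * Hk | exists2 wj : Wj, x.1 = hemb Hj wj &
     forall wk : Wk, hip Hk x.2 (hemb Hk wk) = smeared_form T f wj wk].

(* The closure of the smeared operator; used on Hinf only. *)
Definition smeared (T : R -> Wj -> Wk) (f : C -> C) (x : Hj) : Hk :=
  xget 0 [set y | closure (smeared_graph T f) (x, y)].

(* B : Hinf Hk -> Hinf Hj is the restriction of the Hilbert space adjoint of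
   A : Hinf Hj -> Hinf Hk. *)
Definition is_formal_adjoint (A : Hj -> Hk) (B : Hk -> Hj) : Prop :=
  (forall y, Hinf y -> Hinf (B y)) /\
  (forall x y, Hinf x -> Hinf y -> hip Hk (A x) y = hip Hj x (B y)).

End Smearing.

End VertexAlgebra.

Arguments umod_ip {R V} u.
Arguments hip {R U ip} c.
Arguments smeared {R V Wj Wk} Hj Hk.

(* Main.v *)
Require Import Defs.
From HB Require Import structures.
From mathcomp Require Import all_boot all_order all_algebra.
From mathcomp Require Import complex ring lra zify.
From mathcomp Require Import all_classical all_reals all_analysis.

Import Defs.

Set Implicit Arguments.
Unset Strict Implicit.
Unset Printing Implicit Defensive.

Import Order.TTheory GRing.Theory Num.Theory.
Import numFieldNormedType.Exports.

Local Open Scope classical_set_scope.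
Local Open Scope ring_scope.

(* For homogeneous w, w' only one mode contributes to the smeared form:
   <Y(wi, f) w | w'> = f^(s) <Y(wi, s) w | w'> with s determined by the two
   weights.  So Y(wi, f) is a matrix indexed by pairs of weights, whose entries are
   bounded by |f^(s)| (1 + |s|)^(|p| + t) once the energy weights are put in, and
   the Schur test gives (a), provided the exponents s that occur lie in Z_V.

   That the weights lie in finitely many classes modulo Z, each containing the
   lowest weight of an irreducible module, comes from the complete reducibility of
   the N-gradable weak module of families of vectors, one for each class, of
   uniformly bounded degree: a family which is nonzero in every class is a finite
   sum of vectors of irreducible submodules, and an irreducible submodule lives in
   a single class.

   For (b), the corrections to the quasi-primary case cancel: the adjoint of
   Y*(L_1^m wi) expands into the terms Y(L_1^(m+l) wi) with coefficients
   (-1)^m / (m! l!), which sum to zero for fixed m + l > 0. *)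

(** * Finite sums, complex moduli and inner products *)

(** Everything is carried by sesquilinear forms on W_j x W_k. A form passing the Schur test at every
    level p with a fixed loss r ([tame]) determines an operator on H^oo: its adjoint is built on the
    algebraic vectors ([form_vec]), the operator is then the weak relation [form_act], and on H^oo
    this relation is shown to lie in the closure of the graph, which is how [smeared] is defined.
    Tame forms are stable under linear combinations and under exchange of the arguments, and this
    decides the shape of (b): the form of a smeared adjoint mode is the conjugate of a finite
    combination of the forms of Y(L_1^n wi, f), and so inherits their tameness. What has to be
    supplied is a polynomial bound for Y(L_1^n wi, s). The commutator with L_1 expresses Y(L_1 w, s)
    through the modes of w, and unitarity gives |L_1 v| <= a |v| for v of weight a. Positivity also
    makes all weights nonnegative, so that 1 + L_0 >= 1 and every vector is killed by a power of
    L_1. *)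

Definition cabs (R : realType) (z : R[i]) : R := complex.Re `|z|.

Section FiniteSums.

Lemma fsumE (I : choiceType) (U : nmodType) (s : seq I) (F : I -> U) :
  uniq s -> (forall i, i \notin s -> F i = 0) ->
  \sum_(i \in [set: I]) F i = \sum_(i <- s) F i.
Proof.
move=> us F0; rewrite [RHS]fsbig_seq //; apply/esym.
by apply: (fsbig_widen [set` s] setT) => // i [_ /negP]; exact: F0.
Qed.

Lemma fsum_single (I : choiceType) (U : nmodType) (i0 : I) (F : I -> U) :
  (forall i, i != i0 -> F i = 0) -> \sum_(i \in [set: I]) F i = F i0.
Proof.
move=> F0; rewrite (@fsumE _ _ [:: i0]) ?big_seq1 // => i; rewrite inE; exact: F0.
Qed.

Lemma fsum_nat (U : nmodType) (n : nat) (F : nat -> U) :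
  (forall i, (n <= i)%N -> F i = 0) ->
  \sum_(i \in [set: nat]) F i = \sum_(i < n) F i.
Proof.
move=> F0; rewrite (@fsumE _ _ (iota 0 n)) ?iota_uniq //.
  by rewrite -(big_mkord xpredT) /index_iota subn0.
by move=> i; rewrite mem_iota add0n -leqNgt => /F0.
Qed.

Lemma finite_set_seqP (I : choiceType) (A : set I) :
  finite_set A <-> exists2 s : seq I, uniq s & forall i, A i -> i \in s.
Proof.
split=> [/finite_seqP[s ->]|[s us As]].
  exists (undup s); first exact: undup_uniq.
  by move=> i /=; rewrite mem_undup.
by apply: (@sub_finite_set _ _ [set` s]) => //; exact: finite_seq.
Qed.

Lemma supp_seq (I : choiceType) (U : nmodType) (F : I -> U) :
  finite_set [set i | F i != 0] ->
  exists s : seq I, uniq s /\ forall i, i \notin s -> F i = 0.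
Proof.
move=> /finite_set_seqP[s us Fs]; exists s; split=> // i.
by apply: contraNeq => /Fs.
Qed.

Lemma seq_supp (I : choiceType) (U : nmodType) (F : I -> U) (s : seq I) :
  (forall i, i \notin s -> F i = 0) -> finite_set [set i | F i != 0].
Proof.
move=> F0; apply: (@sub_finite_set _ _ [set` s]); last exact: finite_seq.
by move=> i /=; apply: contraNT => /F0 ->.
Qed.

End FiniteSums.

Section ComplexModulus.
Context (R : realType).
Implicit Types x y : R[i].

Lemma cabsE x : `|x| = (cabs x)%:C%C.
Proof. by rewrite /cabs normc_def. Qed.

Lemma cabs_ge0 x : 0 <= cabs x.
Proof. by rewrite /cabs normc_def /= sqrtr_ge0. Qed.

Lemma cabsM x y : cabs (x * y) = cabs x * cabs y.
Proof. by apply: complexI; rewrite rmorphM -!cabsE normrM. Qed.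

Lemma cabs0 : cabs (0 : R[i]) = 0.
Proof. by rewrite /cabs normr0. Qed.

Lemma cabs_eq0 x : cabs x = 0 -> x = 0.
Proof. by move=> x0; apply/eqP; rewrite -normr_eq0 cabsE x0. Qed.

Lemma cabsD x y : cabs (x + y) <= cabs x + cabs y.
Proof. by rewrite -lecR rmorphD -!cabsE ler_normD. Qed.

Lemma cabsN x : cabs (- x) = cabs x.
Proof. by rewrite /cabs normrN. Qed.

Lemma cabs_sum (I : Type) (s : seq I) (F : I -> R[i]) :
  cabs (\sum_(i <- s) F i) <= \sum_(i <- s) cabs (F i).
Proof.
elim: s => [|i s IH]; first by rewrite !big_nil cabs0.
by rewrite !big_cons (le_trans (cabsD _ _)) // lerD2l.
Qed.

Lemma cabsR (a : R) : 0 <= a -> cabs a%:C%C = a.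
Proof. by move=> a0; rewrite /cabs ger0_norm ?ler0c. Qed.

Lemma cabs_real (a : R) : cabs a%:C%C = `|a|.
Proof. by rewrite /cabs normc_def /= expr0n addr0 sqrtr_sqr. Qed.

Lemma cabsRe x : `|complex.Re x| <= cabs x.
Proof. by rewrite -lecR -cabsE normc_ge_Re. Qed.

Lemma cabs_Re_Im x : cabs x <= `|complex.Re x| + `|complex.Im x|.
Proof.
rewrite /cabs normc_def /= -(ger0_norm (addr_ge0 (normr_ge0 _) (normr_ge0 _))).
rewrite -sqrtr_sqr ler_wsqrtr // sqrrD !real_normK ?num_real //.
by rewrite lerD2r lerDl mulrn_wge0 // mulr_ge0.
Qed.

Lemma conjE x : x^* = (x^*)%C :> R[i].
Proof. by []. Qed.

Lemma cabsJ x : cabs (x^*) = cabs x.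
Proof. by rewrite /cabs norm_conjC. Qed.

Lemma conjR (a : R) : (a%:C%C)^* = a%:C%C :> R[i].
Proof. by apply/eqP; rewrite eq_complex /= oppr0 !eqxx. Qed.

End ComplexModulus.

Section LinearSpans.
Context (K : fieldType) (W : lmodType K).

Definition in_span n (e : 'I_n -> W) : set W :=
  [set w | exists c : 'I_n -> K, w = \sum_(i < n) c i *: e i].

Lemma in_span_subspace n (e : 'I_n -> W) : subspace (in_span e).
Proof.
split; first by exists (fun=> 0); rewrite big1 // => i _; rewrite scale0r.
move=> a u v [c ->] [d ->]; exists (fun i => a * c i + d i).
rewrite scaler_sumr -big_split /=.
by apply: eq_bigr => i _; rewrite scalerA scalerDl.
Qed.

Lemma subspaceB (A : set W) u v : subspace A -> A u -> A v -> A (u - v).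
Proof. by move=> [_ h] Au Av; rewrite addrC -scaleN1r; exact: h. Qed.

Lemma subspaceZ (A : set W) a u : subspace A -> A u -> A (a *: u).
Proof. by move=> [A0 h] Au; rewrite -[_ *: _]addr0; exact: h. Qed.

Lemma subspaceD (A : set W) u v : subspace A -> A u -> A v -> A (u + v).
Proof. by move=> [_ h] Au Av; rewrite -[u]scale1r; exact: h. Qed.

Lemma subspace_sum (A : set W) (I : eqType) (s : seq I) (F : I -> W) : subspace A ->
  (forall i, i \in s -> A (F i)) -> A (\sum_(i <- s) F i).
Proof.
move=> sA; elim: s => [|i s IH] h; first by rewrite big_nil; case: sA.
rewrite big_cons; apply: subspaceD => //; first by apply: h; rewrite mem_head.
by apply: IH => j js; apply: h; rewrite inE js orbT.
Qed.

(** One step of Gaussian elimination: if some b in A involves the last spanning vector, a multiple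
    of b clears that coordinate. The two inductions on the number of spanning vectors below rest on
    it. *)
Lemma subspace_span_step n (e : 'I_n.+1 -> W) (A : set W) : subspace A ->
  A `<=` in_span e -> let e' i := e (widen_ord (leqnSn n) i) in
  A `<=` in_span e' \/
  exists2 b, A b & forall w, A w -> exists a, (A `&` in_span e') (w - a *: b).
Proof.
move=> sA Ae /=.
have [AA'|/existsNP[b /not_implyP[Ab bA']]] := pselect (forall w, A w ->
    in_span (fun i => e (widen_ord (leqnSn n) i)) w); first by left.
right; exists b => // w Aw.
have [cb bE] := Ae _ Ab; have [cw wE] := Ae _ Aw.
have cb0 : cb ord_max != 0.
  apply/eqP => c0; apply: bA'; exists (fun i => cb (widen_ord (leqnSn n) i)).
  by rewrite bE big_ord_recr /= c0 scale0r addr0.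
pose a := cw ord_max / cb ord_max.
exists a; split; first by apply: subspaceB => //; exact: subspaceZ.
exists (fun i => cw (widen_ord (leqnSn n) i) - a * cb (widen_ord (leqnSn n) i)).
rewrite wE bE scaler_sumr -sumrB big_ord_recr /= scalerA divfK // subrr addr0.
by apply: eq_bigr => i _; rewrite scalerA -scalerBl.
Qed.

(** [finite_dim] takes its spanning vectors anywhere in W; here they are found in A itself, as is
    needed for the weight spaces of a submodule seen as a module of its own. *)
Lemma finite_dim_basis (A : set W) : subspace A -> finite_dim A ->
  exists n (e : 'I_n -> W), (forall i, A (e i)) /\ A `<=` in_span e.
Proof.
move=> + [n [e]]; elim: n e A => [|n IH] e A sA Ae.
  by exists 0%N, e; split=> // -[].
have [AA'|[b Ab hb]] := subspace_span_step sA Ae; first exact: IH AA'.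
pose e' i := e (widen_ord (leqnSn n) i).
have [[A0 AL] [s0 sL]] := (sA, in_span_subspace e').
have [|w [_ //]|m [f [Af hf]]] := IH e' (A `&` in_span e').
  by split=> // a u v [Au su] [Av sv]; split; [exact: AL|exact: sL].
exists m.+1, (fun i => if unlift ord_max i is Some j then f j else b); split.
  by move=> i; case: unlift => // j; case: (Af j).
move=> w /hb[a] /hf[c wE].
exists (fun i => if unlift ord_max i is Some j then c j else a).
rewrite big_ord_recr /= unlift_none -[w in LHS](subrK (a *: b)) wE; congr (_ + _).
apply: eq_bigr => i _; have -> : widen_ord (leqnSn m) i = lift ord_max i.
  by apply: val_inj; rewrite /= /bump leqNgt ltn_ord.
by rewrite liftK.
Qed.

End LinearSpans.

Section PreHilbert.
Context (R : realType) (U : lmodType R[i]) (ip : {dot U for @Num.conj R[i]}).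
Implicit Types u v w : U.
Local Notation norm := (hnorm ip).

Lemma ipC u v : ip v u = (ip u v)^*.
Proof. by rewrite hermC /= expr0 mul1r. Qed.

Lemma ipDl u v w : ip (u + v) w = ip u w + ip v w.
Proof. exact: linearDl. Qed.
Lemma ipDr u v w : ip w (u + v) = ip w u + ip w v.
Proof. exact: linearDr. Qed.
Lemma ipNl u v : ip (- u) v = - ip u v. Proof. exact: linearNl. Qed.
Lemma ipNr u v : ip v (- u) = - ip v u. Proof. exact: linearNr. Qed.
Lemma ipBl u v w : ip (u - v) w = ip u w - ip v w.
Proof. by rewrite ipDl ipNl. Qed.
Lemma ipBr u v w : ip w (u - v) = ip w u - ip w v.
Proof. by rewrite ipDr ipNr. Qed.
Lemma ip0l v : ip 0 v = 0. Proof. exact: linear0l. Qed.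
Lemma ip0r v : ip v 0 = 0. Proof. exact: linear0r. Qed.
Lemma ipZl a u v : ip (a *: u) v = a * ip u v.
Proof. by rewrite linearZl_LR. Qed.
Lemma ipZr a u v : ip u (a *: v) = a^* * ip u v.
Proof. by rewrite ipC ipZl rmorphM /= -ipC. Qed.

Lemma ip_suml (I : Type) (s : seq I) (F : I -> U) v :
  ip (\sum_(i <- s) F i) v = \sum_(i <- s) ip (F i) v.
Proof. exact: linear_sumlz. Qed.
Lemma ip_sumr (I : Type) (s : seq I) (F : I -> U) v :
  ip v (\sum_(i <- s) F i) = \sum_(i <- s) ip v (F i).
Proof. exact: linear_sumr. Qed.

Lemma ip_ge0 u : 0 <= ip u u.
Proof. exact: dnorm_ge0. Qed.

Lemma hnorm_ge0 u : 0 <= norm u.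
Proof. exact: sqrtr_ge0. Qed.

Lemma ip_norm u : ip u u = (norm u ^+ 2)%:C%C.
Proof.
have := ip_ge0 u; rewrite lecE => /andP[/eqP Im0 Re0].
by rewrite sqr_sqrtr //; apply/eqP; rewrite eq_complex /= eqxx Im0 eqxx.
Qed.

Lemma hnorm_sqr u : norm u ^+ 2 = complex.Re (ip u u).
Proof. by rewrite ip_norm. Qed.

Lemma hnorm0 : norm 0 = 0.
Proof. by rewrite /hnorm ip0l sqrtr0. Qed.

Lemma hnorm_eq0 u : norm u = 0 -> u = 0.
Proof.
move=> u0; apply/eqP; rewrite -(dnorm_eq0 ip); apply/eqP.
by rewrite ip_norm u0 expr0n.
Qed.

Lemma ip_eq0 u : ip u u = 0 -> u = 0.
Proof. by move=> /eqP; rewrite dnorm_eq0 => /eqP. Qed.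

Lemma ip_inj u v : (forall w, ip w u = ip w v) -> u = v.
Proof.
move=> uv; apply/eqP; rewrite -subr_eq0; apply/eqP/ip_eq0.
by rewrite ipBr uv subrr.
Qed.

Lemma hnormZ a u : norm (a *: u) = cabs a * norm u.
Proof.
apply/eqP; rewrite -(@eqrXn2 _ 2%N) ?hnorm_ge0 ?mulr_ge0 ?cabs_ge0 ?hnorm_ge0 //.
rewrite hnorm_sqr ipZl ipZr ip_norm mulrA -normCK cabsE.
by rewrite exprMn -rmorphXn -rmorphM.
Qed.

Lemma hnorm_opp u : norm (- u) = norm u.
Proof. by rewrite /hnorm ipNl ipNr opprK. Qed.

Lemma hnorm_sqrD u v :
  norm (u + v) ^+ 2 = norm u ^+ 2 + norm v ^+ 2 + complex.Re (ip u v) *+ 2.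
Proof.
rewrite !hnorm_sqr ipDl !ipDr (ipC u v).
case: (ip u v) (ip u u) (ip v v) => a b [c d] [e f] /=; rewrite mulr2n.
by lra.
Qed.

Lemma hnorm_sqrD_orth u v : ip u v = 0 ->
  norm (u + v) ^+ 2 = norm u ^+ 2 + norm v ^+ 2.
Proof. by move=> uv; rewrite hnorm_sqrD uv /= mul0rn addr0. Qed.

Lemma cauchy_schwarz u v : cabs (ip u v) <= norm u * norm v.
Proof.
have [->|v0] := eqVneq v 0; first by rewrite ip0r cabs0 hnorm0 mulr0.
have nv : 0 < norm v by rewrite lt_def hnorm_ge0 andbT; apply: contra v0 => /eqP/hnorm_eq0 ->.
pose a := ip u v / (norm v ^+ 2)%:C%C.
have nv2 : (norm v ^+ 2)%:C%C != 0 :> R[i].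
  by rewrite eq_complex /= eqxx andbT sqrf_eq0 gt_eqF.
have o : ip (u - a *: v) (a *: v) = 0.
  by rewrite ipZr ipBl ipZl ip_norm divfK // subrr mulr0.
have := hnorm_sqrD_orth o; rewrite subrK hnormZ => e.
rewrite -(@ler_pXn2r _ 2%N) ?nnegrE ?cabs_ge0 ?mulr_ge0 ?hnorm_ge0 //.
have -> : cabs (ip u v) = cabs a * norm v ^+ 2.
  by rewrite -[in LHS](divfK nv2 (ip u v)) cabsM cabsR // sqr_ge0.
rewrite !exprMn e mulrDl exprMn expr2 -mulrA.
have : 0 <= norm (u - a *: v) ^+ 2 * norm v ^+ 2 by rewrite mulr_ge0 ?sqr_ge0.
by rewrite !expr2; lra.
Qed.

Lemma hnorm_triangle u v : norm (u + v) <= norm u + norm v.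
Proof.
rewrite -(@ler_pXn2r _ 2%N) ?nnegrE ?addr_ge0 ?hnorm_ge0 //.
rewrite hnorm_sqrD sqrrD.
have := le_trans (ler_norm _) (le_trans (cabsRe (ip u v)) (cauchy_schwarz u v)).
rewrite !mulr2n; lra.
Qed.

Lemma hnorm_sqr_sum_orth (I : eqType) (s : seq I) (F : I -> U) : uniq s ->
  (forall i j, i != j -> ip (F i) (F j) = 0) ->
  norm (\sum_(i <- s) F i) ^+ 2 = \sum_(i <- s) norm (F i) ^+ 2.
Proof.
move=> us o; elim: s us => [|i s IH] /=; first by rewrite !big_nil hnorm0 expr0n.
move=> /andP[i_s us]; rewrite !big_cons hnorm_sqrD_orth ?IH //.
rewrite ip_sumr big1_seq // => j /andP[_ js]; apply: o.
by apply: contraNneq i_s => ->.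
Qed.

(** The induction hypothesis, applied to w -> <w|b>, gives the projection b' of b on A'; then d = b
    - b' is orthogonal to A', and a multiple of d corrects the vector v' that represents phi on
    A'. *)
Lemma riesz_in_span n : forall (e : 'I_n -> U) (A : set U) (phi : U -> R[i]),
  subspace A -> A `<=` in_span e ->
  (forall (a : R[i]) u v, A u -> A v -> phi (a *: u + v) = a * phi u + phi v) ->
  exists2 v, A v & forall w, A w -> phi w = ip w v.
Proof.
elim: n => [|n IH] e A phi sA eA phiL; have [A0 AL] := sA.
  have phi0 : phi 0 = 0.
    by have := phiL (-1) 0 0 A0 A0; rewrite scaler0 add0r mulN1r addNr.
  by exists 0 => // w /eA[c ->]; rewrite big_ord0 phi0 ip0l.
have [eA'|[b Ab hb]] := subspace_span_step sA eA; first exact: IH eA' phiL.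
pose e' (i : 'I_n) := e (widen_ord (leqnSn n) i); pose A' := A `&` in_span e'.
have A'L : subspace A'.
  have [s0 sL] := in_span_subspace e'.
  by split=> // a u v [Au su] [Av sv]; split; [exact: AL|exact: sL].
have IH' psi : (forall (a : R[i]) u v, A' u -> A' v -> psi (a *: u + v) = a * psi u + psi v) ->
    exists2 v, A' v & forall w, A' w -> psi w = ip w v.
  by move=> psiL; apply: (IH e') => // w [].
have [v' [Av' _] phiv'] := IH' phi (fun a u v Au Av => phiL a u v Au.1 Av.1).
have [b' A'b' bb'] := IH' (fun w => ip w b)
   (fun a u v _ _ => etrans (ipDl _ _ _) (congr1 (fun x => x + _) (ipZl _ _ _))).
pose d := b - b'.
have Ad : A d by apply: (subspaceB sA Ab); case: A'b'.
have dA' w : A' w -> ip w d = 0 by move=> /bb'; rewrite /d ipBr => ->; rewrite subrr.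
(* k solves <d | k d + v'> = phi d; the conjugate comes from antilinearity in the second variable.
   For d = 0 any k works, both sides being 0. *)
pose k := ((phi d - ip d v') / ip d d)^*.
exists (k *: d + v'); first exact: AL.
have phi_d : ip d (k *: d) = phi d - ip d v'.
  rewrite ipZr conjCK; have [d0|d0] := eqVneq d 0; last by rewrite divfK // dnorm_eq0.
  have := phiL (-1) 0 0 A0 A0; rewrite scaler0 add0r mulN1r addNr => phi0.
  by rewrite d0 phi0 !ip0l mulr0 subrr.
move=> w Aw; have [a A'wb] := hb w Aw.
have A'w : A' (w - a *: d).
  have -> : w - a *: d = a *: b' + (w - a *: b).
    by rewrite /d scalerBr opprB addrCA addrC.
  exact: A'L.2.
rewrite -(subrK (a *: d) w) [X in phi X]addrC [X in ip X _]addrC phiL //; last by case: A'w.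
rewrite (phiv' _ A'w) [RHS]ipDl ipZl !ipDr phi_d ipZr (dA' _ A'w) mulr0 add0r.
by rewrite subrK.
Qed.

Lemma riesz (A : set U) (phi : U -> R[i]) : subspace A -> finite_dim A ->
  (forall (a : R[i]) u v, A u -> A v -> phi (a *: u + v) = a * phi u + phi v) ->
  exists2 v, A v & forall w, A w -> phi w = ip w v.
Proof. by move=> sA [n [e eA]] phiL; exact: (riesz_in_span (e := e)). Qed.

End PreHilbert.

(** * Weights, L_0 and L_1 *)

Section Components.
Context (K : fieldType) (W : lmodType K) (I : choiceType) (gr : I -> set W).
Hypothesis ds : direct_sum gr.
Local Notation comp := (component gr).

Definition gsupp (w : W) : seq I := finmap.enum_fset (fset_set [set i | comp w i != 0]).

Lemma compP w : decomposition gr w (comp w).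
Proof. by have [c [cP _]] := ds.2 w; exact: (xgetI _ cP). Qed.

Lemma comp_uniq w c : decomposition gr w c -> comp w = c.
Proof. by have [c' [_ h]] := ds.2 w => /h <-; rewrite (h _ (compP w)). Qed.

Lemma gr0 i : gr i 0. Proof. by case: (ds.1 i). Qed.

Lemma grL i a u v : gr i u -> gr i v -> gr i (a *: u + v).
Proof. by case: (ds.1 i) => _; exact. Qed.

Lemma grD i u v : gr i u -> gr i v -> gr i (u + v).
Proof. by move=> iu iv; rewrite -(scale1r u); exact: grL. Qed.

Lemma grZ i a u : gr i u -> gr i (a *: u).
Proof. by move=> iu; rewrite -(addr0 (a *: u)); apply: grL => //; exact: gr0. Qed.

Lemma gr_sum i (J : Type) (s : seq J) (F : J -> W) :
  (forall j, gr i (F j)) -> gr i (\sum_(j <- s) F j).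
Proof.
move=> h; elim: s => [|j s IH]; first by rewrite big_nil; exact: gr0.
by rewrite big_cons; exact: grD.
Qed.

Lemma comp_gr w i : gr i (comp w i).
Proof. by case: (compP w). Qed.

Lemma gsupp_uniq w : uniq (gsupp w).
Proof. exact: finmap.fset_uniq. Qed.

Lemma gsuppP w i : i \notin gsupp w -> comp w i = 0.
Proof.
rewrite /gsupp in_fset_set; last by case: (compP w).
by rewrite notin_setE /= => /negP; rewrite negbK => /eqP.
Qed.

Lemma comp_sumE w s : uniq s -> (forall i, i \notin s -> comp w i = 0) ->
  w = \sum_(i <- s) comp w i.
Proof. by move=> us h; case: (compP w) => _ _ {1}->; exact: fsumE. Qed.

Lemma comp_sum w : w = \sum_(i <- gsupp w) comp w i.
Proof. by apply: comp_sumE; [exact: gsupp_uniq|exact: gsuppP]. Qed.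

Lemma comp_linear i a u v : comp (a *: u + v) i = a *: comp u i + comp v i.
Proof.
pose c j := a *: comp u j + comp v j.
suff: decomposition gr (a *: u + v) c by move=> /comp_uniq ->.
pose s := undup (gsupp u ++ gsupp v).
have s0 j : j \notin s -> comp u j = 0 /\ comp v j = 0.
  by rewrite mem_undup mem_cat negb_or => /andP[/gsuppP -> /gsuppP ->].
have c0 j : j \notin s -> c j = 0.
  by rewrite /c => /s0[-> ->]; rewrite scaler0 addr0.
split; first by move=> j; apply: grL; exact: comp_gr.
  exact: seq_supp c0.
rewrite (fsumE (undup_uniq _) c0) big_split /= -scaler_sumr.
by rewrite -!comp_sumE ?undup_uniq // => j /s0[].
Qed.

Lemma comp0 i : comp 0 i = 0.
Proof.
by have := comp_linear i (-1) 0 0; rewrite scaler0 add0r scaleN1r addNr.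
Qed.
Lemma compD i u v : comp (u + v) i = comp u i + comp v i.
Proof. by rewrite -[in LHS](scale1r u) comp_linear scale1r. Qed.
Lemma compZ i a u : comp (a *: u) i = a *: comp u i.
Proof. by rewrite -[in LHS](addr0 (a *: u)) comp_linear comp0 addr0. Qed.
Lemma compN i u : comp (- u) i = - comp u i.
Proof. by rewrite -scaleN1r compZ scaleN1r. Qed.
Lemma comp_bigsum i (J : Type) (s : seq J) (F : J -> W) :
  comp (\sum_(j <- s) F j) i = \sum_(j <- s) comp (F j) i.
Proof.
elim: s => [|j s IH]; first by rewrite !big_nil comp0.
by rewrite !big_cons compD IH.
Qed.

Lemma comp_hom i w : gr i w -> forall j, comp w j = if j == i then w else 0.
Proof.
move=> wi j; suff /comp_uniq -> : decomposition gr w (fun j => if j == i then w else 0) by [].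
split; first by move=> k; case: eqP => [->//|_]; exact: gr0.
  by apply: (seq_supp (s := [:: i])) => k; rewrite inE => /negPf ->.
by rewrite (fsum_single (i0 := i)) ?eqxx // => k /negPf ->.
Qed.

Lemma comp_id i w : gr i w -> comp w i = w.
Proof. by move=> /comp_hom ->; rewrite eqxx. Qed.

Lemma comp_neq i j w : gr i w -> j != i -> comp w j = 0.
Proof. by move=> /comp_hom -> /negPf ->. Qed.

Lemma comp_ext u v : (forall i, comp u i = comp v i) -> u = v.
Proof.
move=> h; rewrite (comp_sum u) (@comp_sumE v (gsupp u)) ?gsupp_uniq //.
  by apply: eq_bigr => i _.
by move=> i /gsuppP; rewrite h.
Qed.

Lemma comp_eq_gr i w : (forall j, j != i -> comp w j = 0) -> gr i w.
Proof.
move=> h; suff -> : w = comp w i by exact: comp_gr.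
apply: comp_ext => j; rewrite (comp_hom (comp_gr w i)).
by case: eqP => [->//|/eqP/h].
Qed.

End Components.

Section ModeCalculus.
Context (R : realType) (S : realDomainType).
Local Notation C := R[i].
Context (V A B D : lmodType C).
Context (YA : V -> int -> A -> A) (YB : V -> int -> B -> B) (YD : V -> int -> D -> D).
Context (Y : A -> S -> B -> D).
Hypothesis (blY : bilinear_modes Y).

Lemma modes0l s b : Y 0 s b = 0.
Proof.
have := blY.1 s b (-1) 0 0; rewrite scaler0 add0r => h.
by rewrite h scaleN1r addNr.
Qed.
Lemma modes0r a s : Y a s 0 = 0.
Proof.
have := blY.2 a s (-1) 0 0; rewrite scaler0 add0r => h.
by rewrite h scaleN1r addNr.
Qed.
Lemma modesZl c a s b : Y (c *: a) s b = c *: Y a s b.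
Proof. by have := blY.1 s b c a 0; rewrite addr0 modes0l addr0. Qed.
Lemma modesZr c a s b : Y a s (c *: b) = c *: Y a s b.
Proof. by have := blY.2 a s c b 0; rewrite addr0 modes0r addr0. Qed.
Lemma modesDl a a' s b : Y (a + a') s b = Y a s b + Y a' s b.
Proof. by have := blY.1 s b 1 a a'; rewrite !scale1r. Qed.
Lemma modesDr a s b b' : Y a s (b + b') = Y a s b + Y a s b'.
Proof. by have := blY.2 a s 1 b b'; rewrite !scale1r. Qed.
Lemma modes_suml (J : Type) (r : seq J) (F : J -> A) s b :
  Y (\sum_(j <- r) F j) s b = \sum_(j <- r) Y (F j) s b.
Proof.
elim: r => [|j r IH]; first by rewrite !big_nil modes0l.
by rewrite !big_cons modesDl IH.
Qed.
Lemma modes_sumr (J : Type) (r : seq J) a s (F : J -> B) :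
  Y a s (\sum_(j <- r) F j) = \sum_(j <- r) Y a s (F j).
Proof.
elim: r => [|j r IH]; first by rewrite !big_nil modes0r.
by rewrite !big_cons modesDr IH.
Qed.

Lemma gbinom_gt (m l : nat) : (m < l)%N -> gbinom R m%:Z l = 0.
Proof.
move=> ml; rewrite /gbinom (bigD1 (Ordinal ml)) //= subrr mul0r mul0r.
by [].
Qed.

Lemma gbinom0r (m : int) : gbinom R m 0 = 1.
Proof. by rewrite /gbinom big_ord0 divr1. Qed.

Lemma gbinom1r (m : int) : gbinom R m 1 = m%:~R.
Proof. by rewrite /gbinom big_ord1 /= subr0 divr1. Qed.

Lemma gbinom22 : gbinom R 2 2 = 1.
Proof.
rewrite /gbinom big_ord_recr big_ord1 /= subr0 [2 - _]/(1 : int) mulr1.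
by rewrite divff // pnatr_eq0.
Qed.

(** The Jacobi identity at n = 0: binom(0, l) leaves only l = 0 on the right, and binom(m, l) stops
    the left side at l = m. *)
Lemma mode_commutator (m : nat) u a s b : jacobi YA YB YD Y ->
  YD u m (Y a s b) - Y a s (YB u m b)
  = \sum_(l < m.+1) gbinom R m l *: Y (YA u l a) (m%:R + s - l%:R) b.
Proof.
move=> jacY; have := jacY u a b m 0 s; rewrite (@fsum_nat _ m.+1); last first.
  by move=> i mi; rewrite gbinom_gt // scale0r.
rewrite (@fsum_single _ _ 0%N); last first.
  by move=> i; rewrite -lt0n => i0; rewrite gbinom_gt // mulr0 scale0r.
rewrite (@fsum_single _ _ 0%N); last first.
  by move=> i; rewrite -lt0n => i0; rewrite gbinom_gt // mulr0 scale0r.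
rewrite !addr0 !subr0 gbinom0r expr0 mul1r !scale1r add0r => <-.
by apply: eq_bigr => l _; rewrite add0r.
Qed.

End ModeCalculus.

Section ModuleWeights.
Context (R : realType).
Local Notation C := R[i].

Section WeakModule.
Context (V : voa R) (W : lmodType C) (Y : V -> int -> W -> W) (hY : weak_module Y).

Lemma weak_bilinear : bilinear_modes Y. Proof. by case: hY. Qed.
Lemma weak_truncated : lower_truncated Y. Proof. by case: hY. Qed.
Lemma weak_jacobi : jacobi (@voa_Y R V) Y Y Y. Proof. by case: hY. Qed.
Lemma weak_translation v n w :
  Y (voa_Y (conformal V) 0 v) n w = - (n%:~R *: Y v (n - 1) w).
Proof. by case: hY. Qed.

End WeakModule.

Section Voa.
Context (V : voa R).
Local Notation nu := (conformal V).

(** nu is L_{-2} applied to the vacuum, and [L_1, L_{-2}] = 3 L_{-1} has no central term; both L_1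
    and L_{-1} kill the vacuum. *)
Lemma voa_L1_conformal : voa_Y nu 2 nu = 0.
Proof.
have hV := voa_module_axioms V; have bl := weak_bilinear hV.
have [c hc] := voa_virasoro V.
have := hc 1 (- 2) (vacuum V).
rewrite (_ : 1 + 1 = 2 :> int) // (_ : - 2 + 1 = -1 :> int) //.
rewrite (_ : 1 + - 2 + 1 = 0 :> int) //.
have [-> _] := voa_creation nu.
have [_ -> //] := voa_creation nu.
have [_ -> //] := voa_creation nu.
by rewrite (modes0r bl) subr0 scaler0 scale0r addr0.
Qed.

Lemma voa_L0_conformal : voa_Y nu 1 nu = 2 *: nu.
Proof. by rewrite (voa_L0 (voa_conformal V)). Qed.

End Voa.

(** The commutator of order 1 with nu, over a general index domain so as to serve modules and
    intertwining operators alike; the L_{-1} term stays, to be rewritten by the translation axiom of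
    each. *)
Lemma mode_L0 (V : voa R) (A B D : lmodType C) (S : realDomainType)
    (YA : V -> int -> A -> A) (YB : V -> int -> B -> B) (YD : V -> int -> D -> D)
    (Y : A -> S -> B -> D) (d : C) a s b :
  bilinear_modes Y -> jacobi YA YB YD Y ->
  YA (conformal V) 1 a = d *: a ->
  YD (conformal V) 1 (Y a s b)
  = Y (YA (conformal V) 0 a) (s + 1) b + d *: Y a s b + Y a s (YB (conformal V) 1 b).
Proof.
move=> bl jac a1; have := mode_commutator 1 (conformal V) a s b jac.
rewrite big_ord_recr big_ord1 /= gbinom0r gbinom1r !scale1r a1 (modesZl bl).
move=> /eqP; rewrite subr_eq => /eqP ->.
by rewrite subr0 [_ + s]addrC addrK.
Qed.

Lemma mode_L1 (V : voa R) (A B D : lmodType C) (S : realDomainType)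
    (YA : V -> int -> A -> A) (YB : V -> int -> B -> B) (YD : V -> int -> D -> D)
    (Y : A -> S -> B -> D) (d : C) a s b :
  bilinear_modes Y -> jacobi YA YB YD Y ->
  YA (conformal V) 1 a = d *: a ->
  YD (conformal V) 2 (Y a s b)
  = Y (YA (conformal V) 0 a) (s + 2) b + (2 * d) *: Y a (s + 1) b
    + Y (YA (conformal V) 2 a) s b + Y a s (YB (conformal V) 2 b).
Proof.
move=> bl jac a1; have := mode_commutator 2 (conformal V) a s b jac.
rewrite !big_ord_recr big_ord0 /= gbinom0r gbinom1r gbinom22 !scale1r a1 (modesZl bl).
move=> /eqP; rewrite subr_eq => /eqP ->.
rewrite subr0 add0r scalerA [_ + s]addrC addrK.
by rewrite (_ : s + 2 - 1 = s + 1) // -addrA; congr (_ + _); ring.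
Qed.

Section GradedModule.
Context (V : voa R) (W : vmod_data V) (hW : is_vmodule W).

Lemma vmod_weak : weak_module (@mY R V W). Proof. by case: hW. Qed.
Lemma vmod_ds : direct_sum (@mgr R V W). Proof. by case: hW. Qed.
Lemma vmod_fd s : finite_dim (@mgr R V W s). Proof. by case: hW. Qed.
Lemma vmod_L0 s (w : W) : mgr s w -> Ln 0 w = s%:C%C *: w.
Proof. by case: hW => _ _ _ _; exact. Qed.
Lemma vmod_bounded : exists N : R, forall s (w : W), mgr s w -> s < N -> w = 0.
Proof. by case: hW => _ _ _ [N h] _; exists N => s w sw /h; exact. Qed.

Lemma Ln0 n : Ln n (0 : W) = 0.
Proof. exact: modes0r (weak_bilinear vmod_weak) _ _. Qed.

Lemma comp_L0 (w : W) s : component (@mgr R V W) (Ln 0 w) s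
  = s%:C%C *: component (@mgr R V W) w s.
Proof.
rewrite {1}(comp_sum vmod_ds w) /Ln (modes_sumr (weak_bilinear vmod_weak)).
rewrite (comp_bigsum vmod_ds).
transitivity (\sum_(j <- gsupp (@mgr R V W) w)
   component (@mgr R V W) (s%:C%C *: component (@mgr R V W) w j) s).
  apply: eq_bigr => j _; rewrite -/(Ln 0 _) (vmod_L0 (comp_gr vmod_ds w j)).
  rewrite !(compZ vmod_ds) (comp_hom vmod_ds (comp_gr vmod_ds w j)).
  by case: eqP => [->//|_]; rewrite !scaler0.
rewrite -(comp_bigsum vmod_ds) -scaler_sumr (compZ vmod_ds) -(comp_sum vmod_ds).
by [].
Qed.

(** The component at j satisfies (j - s) w_j = 0. Weight statements can thus be proved by computing
    L_0. *)
Lemma L0_eigen_gr s (w : W) : Ln 0 w = s%:C%C *: w -> mgr s w.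
Proof.
move=> ws; apply: (comp_eq_gr vmod_ds) => j js.
have := comp_L0 w j; rewrite ws (compZ vmod_ds) => /eqP.
rewrite -subr_eq0 -scalerBl scaler_eq0 => /orP[|/eqP//].
by rewrite -rmorphB /= eq_complex /= eqxx andbT subr_eq0 eq_sym (negPf js).
Qed.

Lemma mode_shift d s v (w : W) n : voa_gr d v -> mgr s w ->
  mgr (s + d%:~R - n%:~R - 1) (mY v n w).
Proof.
move=> vd ws; apply: L0_eigen_gr; rewrite /Ln.
have hL := @voa_L0 R V d v vd.
rewrite (mode_L0 n w (weak_bilinear vmod_weak) (weak_jacobi vmod_weak) hL).
rewrite -/(Ln 0 w) (vmod_L0 ws) (modesZr (weak_bilinear vmod_weak)).
rewrite (weak_translation vmod_weak) addrK -scaleNr -!scalerDl; congr (_ *: _).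
rewrite -!(rmorph_int (real_complex R)) -!rmorphN -!rmorphD /=; congr (_%:C)%C.
by rewrite !intrD; lra.
Qed.

Lemma L1_gr s (w : W) : mgr s w -> mgr (s - 1) (Ln 1 w).
Proof.
move=> /(mode_shift 2 (voa_conformal V)).
by rewrite (_ : s + 2%:~R - 2%:~R - 1 = s - 1) //; ring.
Qed.

(** [mode_L1] for the modes of nu itself: L_1 nu = 0, the term in L_{-1} nu contributes -2 L_0 and
    the weight term 4 L_0. *)
Lemma L1_Lm1 s (w : W) : mgr s w ->
  Ln 1 (Ln (- 1) w) = Ln (- 1) (Ln 1 w) + (2 * s)%:C%C *: w.
Proof.
move=> ws; rewrite /Ln.
have bl := weak_bilinear vmod_weak.
have hL := voa_L0_conformal V.
rewrite [LHS](mode_L1 0 w bl (weak_jacobi vmod_weak) hL).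
rewrite voa_L1_conformal (modes0l bl) addr0 (weak_translation vmod_weak).
rewrite addrC; congr (_ + _); rewrite -scaleNr -scalerDl.
rewrite -[mY _ _ w]/(Ln 0 w) (vmod_L0 ws) scalerA; congr (_ *: _).
by rewrite rmorphM /= rmorph_nat; congr (_ * _); rewrite -natrM -!pmulrn; ring.
Qed.

Lemma iter_L1_gr s (w : W) m : mgr s w -> mgr (s - m%:R) (iter m (Ln 1) w).
Proof.
elim: m => [|m IH] ws; first by rewrite subr0.
rewrite (_ : s - m.+1%:R = s - m%:R - 1); last by rewrite -natr1; ring.
by apply: L1_gr; exact: IH.
Qed.

End GradedModule.

Section Intertwiner.
Context (V : voa R) (Wi Wj Wk : vmod_data V).
Context (hi : is_vmodule Wi) (hj : is_vmodule Wj) (hk : is_vmodule Wk).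
Context (Y : Wi -> R -> Wj -> Wk) (hY : intertwining Y).

Lemma inter_bl : bilinear_modes Y. Proof. by case: hY. Qed.
Lemma inter_jac : jacobi (@mY R V Wi) (@mY R V Wj) (@mY R V Wk) Y.
Proof. by case: hY. Qed.
Lemma inter_translation w s w' : Y (Ln (- 1) w) s w' = - (s%:C%C *: Y w (s - 1) w').
Proof. by case: hY. Qed.

Lemma inter_shift d s' s (a : Wi) (b : Wj) : mgr d a -> mgr s' b ->
  mgr (s' + d - s - 1) (Y a s b).
Proof.
move=> ad bs; apply: (L0_eigen_gr hk); rewrite /Ln.
rewrite (mode_L0 s b inter_bl inter_jac (vmod_L0 hi ad)).
rewrite -/(Ln 0 b) (vmod_L0 hj bs) (modesZr inter_bl).
rewrite -[mY _ 0 a]/(Ln (- 1) a) inter_translation addrK -scaleNr -!scalerDl.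
by rewrite -rmorphN -!rmorphD /=; congr ((_)%:C%C *: _); lra.
Qed.

(** The commutator with L_1 solved for the term in L_1 a. The translation axiom turns the L_{-1} a
    term into -(s + 2) times the mode s + 1. All bounds for L_1^n wi come from this identity. *)
Lemma inter_L1 d s (a : Wi) (b : Wj) : mgr d a ->
  Y (Ln 1 a) s b = Ln 1 (Y a s b) - Y a s (Ln 1 b)
    + (s + 2 - 2 * d)%:C%C *: Y a (s + 1) b.
Proof.
move=> ad; rewrite {2}/Ln (mode_L1 s b inter_bl inter_jac (vmod_L0 hi ad)).
rewrite -[mY _ 0 a]/(Ln (- 1) a) inter_translation.
rewrite -/(Ln 1 a) -/(Ln 1 b) addrK (_ : s + 2 - 1 = s + 1); last by ring.
rewrite -scaleNr -scalerDl addrAC -scalerDl (_ : - _ + _ + _ = 0) ?scale0r ?add0r //.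
by rewrite !rmorphD !rmorphN !rmorphM rmorph_nat /=; ring.
Qed.

End Intertwiner.

End ModuleWeights.

Lemma nat_bound (R : realType) (x : R) : exists k : nat, x < k%:R.
Proof.
exists (Num.bound `|x|); apply: le_lt_trans (ler_norm x) _.
by apply: archi_boundP.
Qed.

Section UnitaryModules.
Context (R : realType) (V : unitary_voa R) (W : unitary_module V).
Local Notation ip := (umod_ip W).
Local Notation norm := (hnorm (umod_ip W)).
Local Notation comp := (component (@mgr R V W)).

Lemma umodP : is_vmodule W. Proof. exact: vmoduleP. Qed.
Local Notation ds := (vmod_ds umodP).
Local Notation bl := (weak_bilinear (vmod_weak umodP)).

(** The opposite mode of nu has a single term: nu is fixed by theta, has weight 2 only, satisfies
    L_1 nu = 0, and (-1)^2 = 1. *)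
Lemma Ln_adj n (u v : W) : ip (Ln n u) v = ip u (Ln (- n) v).
Proof.
rewrite /Ln umod_invariant uvoa_theta_conformal; congr (ip u _).
have nuc := comp_hom (voa_direct_sum V) (voa_conformal V).
have it0 m : iter m (voa_Y (conformal V) 2) 0 = 0 :> V.
  by elim: m => [//|m /= ->]; rewrite (modes0r (weak_bilinear (voa_module_axioms V))).
have itnu m : iter m.+1 (voa_Y (conformal V) 2) (conformal V) = 0 :> V.
  by rewrite iterSr voa_L1_conformal it0.
rewrite /opp_mode (@fsum_single _ _ 2); last first.
  move=> d d2; rewrite fsbig1 // => m _.
  by rewrite nuc (negPf d2) it0 (modes0l bl) scaler0.
rewrite (@fsum_single _ _ 0%N); last first.
  by case=> // m _; rewrite nuc eqxx itnu (modes0l bl) scaler0.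
rewrite nuc eqxx /= fact0 divr1 (_ : (-1) ^ 2 = 1) ?scale1r; last first.
  by rewrite -exprnP sqrrN expr1n.
by congr (mY _ _ v); ring.
Qed.

Lemma ip_orth s s' (u v : W) : mgr s u -> mgr s' v -> s != s' -> ip u v = 0.
Proof.
move=> us vs ss'; have := Ln_adj 0 u v.
rewrite oppr0 (vmod_L0 umodP us) (vmod_L0 umodP vs) ipZl ipZr conjR => /eqP.
rewrite -subr_eq0 -mulrBl mulf_eq0 => /orP[|/eqP//].
by rewrite -rmorphB /= eq_complex /= eqxx andbT subr_eq0 (negPf ss').
Qed.

Lemma ip_compr s (u v : W) : mgr s u -> ip u v = ip u (comp v s).
Proof.
move=> us; have [sv|sv] := boolP (s \in gsupp (@mgr R V W) v); last first.
  rewrite (gsuppP ds sv) ip0r {1}(comp_sum ds v) ip_sumr big1_seq // => j /andP[_ jv].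
  by apply: (ip_orth us (comp_gr ds v j)); apply: contraNneq sv => ->.
rewrite {1}(comp_sum ds v) ip_sumr (bigD1_seq s) ?gsupp_uniq //=.
rewrite big1 ?addr0 // => j js; apply: (ip_orth us (comp_gr ds v j)).
by rewrite eq_sym.
Qed.

Lemma Lm1_norm s (w : W) : mgr s w ->
  norm (Ln (- 1) w) ^+ 2 = norm (Ln 1 w) ^+ 2 + 2 * s * norm w ^+ 2.
Proof.
move=> ws; rewrite [LHS]hnorm_sqr Ln_adj opprK (L1_Lm1 umodP ws) ipDr ipZr conjR.
have -> : ip w (Ln (- 1) (Ln 1 w)) = ip (Ln 1 w) (Ln 1 w) by rewrite [RHS]Ln_adj.
by rewrite !ip_norm -!rmorphM -rmorphD.
Qed.

(* On a vector w of weight s killed by L_1, |L_{-1} w|^2 = 2 s |w|^2. *)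
Lemma weight_ge0 s (w : W) : mgr s w -> w != 0 -> 0 <= s.
Proof.
have [N hN] := vmod_bounded umodP.
(* Induction on the distance from the lower bound N of the weights: when L_1 w is nonzero, the
   hypothesis for its weight s - 1 already gives s >= 1. *)
have key k : forall s (w : W), s < N + k%:R -> mgr s w -> w != 0 -> 0 <= s.
  elim: k => [|k IH] {s w} s w sN ws w0.
    by move: w0; rewrite (hN _ _ ws) ?eqxx //; rewrite addr0 in sN.
  have [L0|L1] := eqVneq (Ln 1 w) 0; last first.
    have : 0 <= s - 1; last by lra.
    by apply: (IH _ (Ln 1 w)) => //; [rewrite -natr1 in sN; lra|exact: L1_gr umodP _ _ _].
  have := Lm1_norm ws; rewrite L0 hnorm0 expr0n add0r => h.
  have n0 : 0 < norm w ^+ 2.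
    by rewrite exprn_gt0 // lt_def hnorm_ge0 andbT; apply: contra w0 => /eqP/hnorm_eq0 ->.
  have : 0 <= 2 * s * norm w ^+ 2 by rewrite -h sqr_ge0.
  by rewrite pmulr_lge0 //; lra.
move=> ws w0; have [k hk] := nat_bound (s - N).
by apply: (key k _ w) => //; lra.
Qed.

(* With v = L_1 w: |v|^2 = <w | L_{-1} v> and |L_{-1} v|^2 = |L_1 v|^2 + 2 (s - 1) |v|^2,
   so the bound for v gives |L_{-1} v| <= s |v|. *)
Lemma L1_bound s (w : W) : mgr s w -> norm (Ln 1 w) <= s * norm w.
Proof.
suff key (k : nat) : forall s (w : W), s < k%:R -> mgr s w -> norm (Ln 1 w) <= s * norm w.
  by have [k hk] := nat_bound s => ws; exact: (key k).
elim: k => [|k IH] {s w} s w sk ws.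
  have [->|w0] := eqVneq w 0; first by rewrite (Ln0 umodP) hnorm0 mulr0.
  by have := weight_ge0 ws w0; rewrite leNgt sk.
have [->|w0] := eqVneq w 0; first by rewrite (Ln0 umodP) hnorm0 mulr0.
have s0 := weight_ge0 ws w0.
set v := Ln 1 w; have vs : mgr (s - 1) v by exact: L1_gr umodP _ _ _.
have [->|v0] := eqVneq v 0; first by rewrite hnorm0 mulr_ge0 ?hnorm_ge0.
have s1 := weight_ge0 vs v0.
have IHv : norm (Ln 1 v) <= (s - 1) * norm v.
  by apply: IH => //; rewrite -natr1 in sk; lra.
have nv : 0 < norm v by rewrite lt_def hnorm_ge0 andbT; apply: contra v0 => /eqP/hnorm_eq0 ->.
have h2 : norm (Ln (- 1) v) <= s * norm v.
  rewrite -(@ler_pXn2r _ 2%N) ?nnegrE ?mulr_ge0 ?hnorm_ge0 //.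
  rewrite (Lm1_norm vs).
  have : norm (Ln 1 v) ^+ 2 <= ((s - 1) * norm v) ^+ 2.
    by rewrite ler_pXn2r ?nnegrE ?mulr_ge0 ?hnorm_ge0.
  move=> h; apply: (le_trans (lerD h (lexx _))).
  (* (s - 1)^2 + 2 (s - 1) = s^2 - 1 <= s^2. *)
  rewrite !exprMn -mulrDl ler_wpM2r ?sqr_ge0 // !expr2.
  by rewrite -subr_ge0; lra.
have h3 : norm v ^+ 2 <= norm w * norm (Ln (- 1) v).
  rewrite hnorm_sqr {1}/v Ln_adj; apply: le_trans (cauchy_schwarz _ _ _).
  exact: le_trans (ler_norm _) (cabsRe _).
rewrite -(ler_pM2r nv) -expr2 (le_trans h3) //.
by rewrite [s * _]mulrC -mulrA ler_wpM2l ?hnorm_ge0.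
Qed.

Lemma ip_ext_hom (u v : W) :
  (forall s (w : W), mgr s w -> ip w u = ip w v) -> u = v.
Proof.
move=> h; apply: (@ip_inj _ _ ip) => w; rewrite (comp_sum ds w) !ip_suml.
by apply: eq_bigr => j _; apply: h; exact: comp_gr ds _ _.
Qed.

Lemma riesz_gr s (phi : W -> R[i]) :
  (forall (a : R[i]) u v, phi (a *: u + v) = a * phi u + phi v) ->
  exists2 v : W, mgr s v & forall w : W, mgr s w -> phi w = ip w v.
Proof.
move=> phiL; apply: (@riesz _ _ ip) => //.
- exact: ds.1.
- exact: vmod_fd umodP s.
Qed.

End UnitaryModules.

(** * Energy norms on the completion *)

Section HilbertTopology.
Context (R : realType).
Local Notation C := R[i].

Section One.
Context (U : lmodType C) (ip : {dot U for @Num.conj C}) (H : completion ip).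
Local Notation nrm := (hnorm (hip H)).

Lemma norm_hnorm (x : H) : `|x| = (nrm x)%:C%C.
Proof.
apply/eqP; rewrite -(@eqrXn2 _ 2%N) ?normr_ge0 ?ler0c ?hnorm_ge0 //.
by rewrite -hipE ip_norm rmorphXn.
Qed.

Lemma ball_hnorm (x y : H) (e : R) : ball x (e%:C%C) y <-> nrm (x - y) < e.
Proof. by rewrite -ball_normE /ball_ /= norm_hnorm ltcR. Qed.

(** Radii in this normed space are positive elements of R[i], that is, positive reals; from here on
    distances are real and measured by [hnorm]. *)
Lemma hilbert_nbhs (x : H) (A : set H) :
  nbhs x A <-> exists2 e : R, 0 < e & forall y, nrm (x - y) < e -> A y.
Proof.
split=> [/nbhs_ballP[e /= e0 xeA]|[e e0 h]].
  have [e1 e1E] : exists e1 : R, e = e1%:C%C.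
    by exists (complex.Re e); rewrite RRe_real // ger0_real // ltW.
  rewrite e1E ltcR in e0; exists e1 => // y /ball_hnorm; rewrite -e1E; exact: xeA.
apply/nbhs_ballP; exists (e%:C%C); first by rewrite /= ltcR.
by move=> y /ball_hnorm; exact: h.
Qed.

Lemma hemb_approx (x : H) (e : R) : 0 < e -> exists w, nrm (x - hemb H w) < e.
Proof.
move=> e0; have : closure (range (hemb H)) x by rewrite hemb_dense.
move=> /(_ [set y | nrm (x - y) < e])[|y [[w _ <-] h]]; last by exists w.
by apply/hilbert_nbhs; exists e.
Qed.

Lemma hilbert_complete (u : nat -> H) :
  (forall e : R, 0 < e -> exists N, forall m n, (N <= m)%N -> (N <= n)%N -> nrm (u m - u n) < e) ->
  exists l, forall e : R, 0 < e -> exists N, forall n, (N <= n)%N -> nrm (l - u n) < e.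
Proof.
move=> hu.
have cu : cauchy (u @ \oo).
  apply/cauchy_ballP => e e0.
  have [e1 e1E] : exists e1 : R, e = e1%:C%C.
    by exists (complex.Re e); rewrite RRe_real // ger0_real // ltW.
  rewrite e1E ltcR in e0; have [N hN] := hu _ e0.
  exists (u @` [set n | (N <= n)%N], u @` [set n | (N <= n)%N]) => /=.
    by split; exists N => // n /= Nn; exists n.
  by move=> [x y] /= [[m Nm <-] [n Nn <-]]; rewrite e1E; apply/ball_hnorm; exact: hN.
have /cvg_ex[l hl] : cvg (u @ \oo) by exact: cauchy_cvg.
exists l => e e0.
have /hl[N _ hN] : nbhs l [set y | nrm (l - y) < e] by apply/hilbert_nbhs; exists e.
by exists N => n /hN.
Qed.

Lemma hembD u v : hemb H (u + v) = hemb H u + hemb H v.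
Proof. by have := hemb_linear H 1 u v; rewrite !scale1r. Qed.
Lemma hemb0 : hemb H 0 = 0.
Proof. by have := hemb_linear H (-1) 0 0; rewrite scaler0 add0r !scaleN1r addNr. Qed.
Lemma hembZ a u : hemb H (a *: u) = a *: hemb H u.
Proof. by have := hemb_linear H a u 0; rewrite addr0 hemb0 addr0. Qed.
Lemma hembN u : hemb H (- u) = - hemb H u.
Proof. by rewrite -scaleN1r hembZ scaleN1r. Qed.
Lemma hemb_sum (I : Type) (s : seq I) (F : I -> U) :
  hemb H (\sum_(i <- s) F i) = \sum_(i <- s) hemb H (F i).
Proof.
elim: s => [|i s IH]; first by rewrite !big_nil hemb0.
by rewrite !big_cons hembD IH.
Qed.
Lemma hemb_norm u : nrm (hemb H u) = hnorm ip u.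
Proof. by rewrite /hnorm hemb_isometry. Qed.

Lemma small_eq0 (a : R) : 0 <= a -> (forall e, 0 < e -> a <= e) -> a = 0.
Proof.
move=> a0 h; apply/eqP; rewrite eq_le a0 andbT leNgt; apply/negP => a1.
by have := h (a / 2); rewrite leNgt; lra.
Qed.

Lemma hilbert_ext (x y : H) : (forall w, hip H x (hemb H w) = hip H y (hemb H w)) -> x = y.
Proof.
move=> h; apply/eqP; rewrite -subr_eq0; apply/eqP/(@hnorm_eq0 _ _ (hip H)).
apply: small_eq0 (hnorm_ge0 _ _) _ => e e0.
have [w hw] := hemb_approx (x - y) e0.
set d := x - y in hw *.
have dw : hip H d (hemb H w) = 0 by rewrite /d ipBl h subrr.
have [->|d0] := eqVneq d 0; first by rewrite hnorm0 ltW.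
have nd : 0 < nrm d by rewrite lt_def hnorm_ge0 andbT; apply: contra d0 => /eqP/hnorm_eq0 ->.
have : nrm d ^+ 2 <= nrm d * nrm (d - hemb H w).
  apply: le_trans (cauchy_schwarz _ _ _).
  by rewrite ipBr dw subr0 hnorm_sqr (le_trans (ler_norm _) (cabsRe _)).
by rewrite expr2 ler_pM2l // => h1; apply: le_trans h1 (ltW hw).
Qed.

End One.

Lemma closure_graphP (U1 U2 : lmodType C) (ip1 : {dot U1 for @Num.conj C})
    (ip2 : {dot U2 for @Num.conj C}) (H1 : completion ip1) (H2 : completion ip2)
    (A : set (H1 * H2)) x y :
  closure A (x, y) <-> forall e : R, 0 < e -> exists x' y',
    [/\ A (x', y'), hnorm (hip H1) (x - x') < e & hnorm (hip H2) (y - y') < e].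
Proof.
split=> [cA e e0|h B].
  have [|[x' y'] [Axy [/= h1 h2]]] :=
      cA [set z | hnorm (hip H1) (x - z.1) < e /\ hnorm (hip H2) (y - z.2) < e].
    exists ([set z | hnorm (hip H1) (x - z) < e], [set z | hnorm (hip H2) (y - z) < e]) => /=.
      by split; apply/hilbert_nbhs; exists e.
    by move=> [a b] /= [].
  by exists x', y'.
move=> [[B1 B2] /= [/hilbert_nbhs[e1 e10 h1] /hilbert_nbhs[e2 e20 h2]] hB].
have [|x' [y' [Axy l1 l2]]] := h (Num.min e1 e2); first by rewrite lt_min e10.
rewrite !lt_min in l1 l2; case/andP: l1 => l1 _; case/andP: l2 => _ l2.
by exists (x', y'); split => //; apply: hB; split; [exact: h1|exact: h2].
Qed.

End HilbertTopology.

Section SpectralProjections.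
Context (R : realType) (V : unitary_voa R) (W : unitary_module V)
  (H : completion (umod_ip W)).
Local Notation ip := (umod_ip W).
Local Notation hp := (hip H).
Local Notation norm := (hnorm (umod_ip W)).
Local Notation nrm := (hnorm (hip H)).
Local Notation comp := (component (@mgr R V W)).
Local Notation ds := (vmod_ds (umodP W)).
Implicit Types (x y : H) (a s : R) (F : seq R).

(** The spectral projection of L_0 at a, with values in W and not in H: the weight spaces are
    finite-dimensional, so Riesz vectors exist in them. *)
Definition hproj x a : W :=
  xget 0 [set v | mgr a v /\ forall w, mgr a w -> hp (hemb H w) x = ip w v].

Lemma hprojP x a : mgr a (hproj x a) /\
  forall w, mgr a w -> hp (hemb H w) x = ip w (hproj x a).
Proof.
have [|v av hv] := @riesz_gr _ _ W a (fun w => hp (hemb H w) x).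
  by move=> c u v; rewrite hembD hembZ ipDl ipZl.
have Pv : [set v | mgr a v /\ forall w, mgr a w -> hp (hemb H w) x = ip w v] v by [].
exact: (xgetI 0 Pv).
Qed.

Lemma hproj_gr x a : mgr a (hproj x a). Proof. by case: (hprojP x a). Qed.
Lemma hproj_ip x a w : mgr a w -> hp (hemb H w) x = ip w (hproj x a).
Proof. by case: (hprojP x a) => _; exact. Qed.

Lemma hproj_uniq x a v : mgr a v ->
  (forall w, mgr a w -> hp (hemb H w) x = ip w v) -> hproj x a = v.
Proof.
move=> av h; apply: ip_ext_hom => s w ws.
have [as'|as'] := eqVneq s a.
  by rewrite as' in ws; rewrite -(hproj_ip _ ws) h.
by rewrite (ip_orth ws (hproj_gr x a) as') (ip_orth ws av as').
Qed.

Lemma hproj_linear c x y a : hproj (c *: x + y) a = c *: hproj x a + hproj y a.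
Proof.
apply: hproj_uniq; first by apply: (grL ds); exact: hproj_gr.
by move=> w wa; rewrite !ipDr !ipZr !(hproj_ip _ wa).
Qed.

Lemma hproj0 a : hproj 0 a = 0.
Proof. by apply: hproj_uniq => [|w _]; [exact: gr0 ds _|rewrite !ip0r]. Qed.

Lemma hprojZ c x a : hproj (c *: x) a = c *: hproj x a.
Proof. by rewrite -[c *: x]addr0 hproj_linear hproj0 addr0. Qed.

Lemma hprojD x y a : hproj (x + y) a = hproj x a + hproj y a.
Proof. by rewrite -[x in LHS]scale1r hproj_linear scale1r. Qed.

Lemma hprojB x y a : hproj (x - y) a = hproj x a - hproj y a.
Proof. by rewrite hprojD -[- y]scaleN1r hprojZ scaleN1r. Qed.

Lemma hproj_hemb w a : hproj (hemb H w) a = comp w a.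
Proof.
apply: hproj_uniq; first exact: comp_gr ds _ _.
by move=> v va; rewrite hemb_isometry (ip_compr _ va).
Qed.

Lemma hproj_ext x y : (forall a, hproj x a = hproj y a) -> x = y.
Proof.
move=> h; apply: hilbert_ext => w; rewrite ipC [RHS]ipC; congr (_^*).
rewrite (comp_sum ds w) hemb_sum !ip_suml; apply: eq_bigr => a _.
by rewrite !(hproj_ip _ (comp_gr ds w a)) h.
Qed.

Lemma hproj_weight x a : hproj x a != 0 -> 0 <= a.
Proof. exact: weight_ge0 (hproj_gr x a). Qed.

Definition trunc x F : W := \sum_(a <- F) hproj x a.

Lemma comp_trunc x F a : uniq F ->
  comp (trunc x F) a = if a \in F then hproj x a else 0.
Proof.
move=> uF; rewrite /trunc (comp_bigsum ds); case: ifPn => aF.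
  rewrite (bigD1_seq a) //= (comp_id ds (hproj_gr x a)) big1 ?addr0 // => b ba.
  by apply: (comp_neq ds (hproj_gr x b)); rewrite eq_sym.
rewrite big1_seq // => b /andP[_ bF]; apply: (comp_neq ds (hproj_gr x b)).
by apply: contraNneq aF => ->.
Qed.

Lemma trunc_norm x F : uniq F ->
  norm (trunc x F) ^+ 2 = \sum_(a <- F) norm (hproj x a) ^+ 2.
Proof.
move=> uF; rewrite hnorm_sqr_sum_orth // => a b.
exact: ip_orth (hproj_gr _ _) (hproj_gr _ _).
Qed.

Lemma trunc_orth x F w : uniq F -> (forall a, a \notin F -> comp w a = 0) ->
  hp (x - hemb H (trunc x F)) (hemb H w) = 0.
Proof.
move=> uF wF; rewrite ipC (comp_sumE ds uF wF) hemb_sum ip_suml big1_seq ?rmorph0 //.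
move=> a /andP[_ aF]; rewrite (hproj_ip _ (comp_gr ds w a)) hprojB hproj_hemb.
by rewrite comp_trunc // aF subrr ip0r.
Qed.

Lemma bessel x F : uniq F -> \sum_(a <- F) norm (hproj x a) ^+ 2 <= nrm x ^+ 2.
Proof.
move=> uF; rewrite -trunc_norm // -(hemb_norm H).
rewrite -{2}(subrK (hemb H (trunc x F)) x) hnorm_sqrD_orth ?lerDr ?sqr_ge0 //.
by apply: trunc_orth => // a aF; rewrite comp_trunc // (negPf aF).
Qed.

(** Best approximation: let w in W be close to x with support F. For F' containing F the truncation
    is the orthogonal projection of x on a space that contains w. *)
Lemma trunc_approx x (e : R) : 0 < e -> exists2 F, uniq F &
  forall F', uniq F' -> {subset F <= F'} -> nrm (x - hemb H (trunc x F')) < e.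
Proof.
move=> e0; have [w hw] := hemb_approx x e0.
exists (gsupp (@mgr R V W) w); first exact: gsupp_uniq.
move=> F' uF' sub; apply: le_lt_trans hw.
rewrite -(@ler_pXn2r _ 2%N) ?nnegrE ?hnorm_ge0 //.
have -> : x - hemb H w = (x - hemb H (trunc x F')) + hemb H (trunc x F' - w).
  by rewrite hembD hembN addrA subrK.
rewrite [leRHS]hnorm_sqrD_orth ?lerDl ?sqr_ge0 //.
apply: trunc_orth => // a aF; rewrite (compD ds) (compN ds) comp_trunc // (negPf aF).
by rewrite (gsuppP ds) ?subr0 //; apply: contra aF => /sub.
Qed.

Lemma norm_le_partial x (K : R) : 0 <= K ->
  (forall F, uniq F -> \sum_(a <- F) norm (hproj x a) ^+ 2 <= K ^+ 2) -> nrm x <= K.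
Proof.
move=> K0 h; rewrite leNgt; apply/negP => Kx.
have e0 : 0 < nrm x - K by rewrite subr_gt0.
have [F uF hF] := trunc_approx x e0.
have h1 := hF F uF (fun _ => id).
have h2 : norm (trunc x F) <= K.
  by rewrite -(@ler_pXn2r _ 2%N) ?nnegrE ?hnorm_ge0 // trunc_norm // h.
have := hnorm_triangle hp (x - hemb H (trunc x F)) (hemb H (trunc x F)).
by rewrite subrK hemb_norm; lra.
Qed.

(** The index set R is uncountable, so finite sets whose partial sums come within 1/(n+1) of the
    supremum are merged into an increasing sequence; the vectors summed over them form a Cauchy
    sequence. *)
Lemma riesz_fischer (y : R -> W) (K : R) : (forall a, mgr a (y a)) ->
  (forall F, uniq F -> \sum_(a <- F) norm (y a) ^+ 2 <= K ^+ 2) ->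
  exists x, forall a, hproj x a = y a.
Proof.
move=> yg yK.
pose S F := \sum_(a <- F) norm (y a) ^+ 2.
pose A := [set t | exists2 F, uniq F & t = S F].
have supA : has_sup A.
  split; first by exists (S [::]); exists [::].
  by exists (K ^+ 2) => t [F uF ->]; exact: yK.
have Sle F : uniq F -> S F <= sup A.
  by move=> uF; apply: (sup_upper_bound supA); exists F.
have approx (n : nat) : exists F, uniq F /\ sup A - n.+1%:R^-1 < S F.
  have n0 : 0 < n.+1%:R^-1 :> R by rewrite invr_gt0 ltr0n.
  by have [t [F uF ->] h] := sup_adherent n0 supA; exists F.
have [Fs hFs] := choice approx.
pose G n := undup (flatten [seq Fs i | i <- iota 0 n.+1]).
have uG n : uniq (G n) by exact: undup_uniq.
have sub_sum F F' : uniq F -> uniq F' -> {subset F <= F'} ->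
    S F' = S F + \sum_(a <- F' | a \notin F) norm (y a) ^+ 2.
  move=> uF uF' sub; rewrite /S (bigID (mem F)) /=; congr (_ + _).
  rewrite -big_filter; apply: perm_big; apply: uniq_perm => //.
    exact: filter_uniq.
  by move=> a; rewrite mem_filter; apply/andP/idP => [[]//|aF]; split=> //; exact: sub.
have Gmono m n : (m <= n)%N -> {subset G m <= G n}.
  move=> mn a; rewrite !mem_undup => /flattenP[_ /mapP[i + ->] ai].
  rewrite mem_iota => /andP[_ im]; apply/flattenP; exists (Fs i) => //.
  by apply: map_f; rewrite mem_iota /=; lia.
have Glarge n : sup A - n.+1%:R^-1 < S (G n).
  have [uF h] := hFs n; apply: lt_le_trans h _.
  rewrite (sub_sum _ _ uF (uG n)); first by rewrite lerDl sumr_ge0 // => a _; exact: sqr_ge0.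
  move=> a aF; rewrite mem_undup; apply/flattenP; exists (Fs n) => //.
  by apply: map_f; rewrite mem_iota /=; lia.
pose u n : W := \sum_(a <- G n) y a.
have udiff m n : (n <= m)%N -> norm (u m - u n) ^+ 2 <= n.+1%:R^-1.
  move=> nm; have -> : u m - u n = \sum_(a <- [seq a <- G m | a \notin G n]) y a.
    rewrite /u (bigID (mem (G n))) /= addrC [X in _ + X - _](_ : _ = u n).
      by rewrite addrK big_filter.
    rewrite -big_filter; apply: perm_big; apply: uniq_perm => //; first exact: filter_uniq.
    by move=> a; rewrite mem_filter; apply/andP/idP => [[]//|aF]; split=> //; exact: Gmono nm _ aF.
  rewrite hnorm_sqr_sum_orth ?filter_uniq //; last first.
    by move=> a b; exact: ip_orth (yg _) (yg _).
  rewrite big_filter; have := sub_sum _ _ (uG n) (uG m) (Gmono _ _ nm).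
  move=> h; have h1 := Sle _ (uG m); have h2 := Glarge n; rewrite h in h1.
  rewrite -(lerD2l (S (G n))); apply: le_trans h1 _.
  by rewrite -lerBlDr ltW.
have inv_small (e : R) : 0 < e -> exists N, forall n, (N <= n)%N -> n.+1%:R^-1 < e ^+ 2 :> R.
  move=> e0; have [N hN] := nat_bound ((e ^+ 2)^-1).
  exists N => n Nn; rewrite invf_plt ?posrE ?ltr0n ?exprn_gt0 //.
  by apply: lt_le_trans hN _; rewrite ler_nat; lia.
have [|l hl] := @hilbert_complete _ _ _ H (fun n => hemb H (u n)).
  move=> e e0; have [N hN] := inv_small _ e0; exists N => m n.
  wlog nm : m n / (n <= m)%N.
    move=> wl Nm Nn; case/orP: (leq_total n m) => nm; first exact: wl.
    by rewrite -opprB hnorm_opp; exact: wl.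
  move=> Nm Nn; rewrite -hembN -hembD hemb_norm.
  have h := le_lt_trans (udiff _ _ nm) (hN _ Nn).
  by rewrite ltr_pXn2r ?nnegrE ?hnorm_ge0 ?(ltW e0) in h.
exists l => a; apply: hproj_uniq (yg a) _ => w wa.
apply/eqP; rewrite -subr_eq0; apply/eqP/cabs_eq0.
apply: small_eq0 (cabs_ge0 _) _ => e e0.
pose c := norm w + 1; have c0 : 0 < c by rewrite /c; have := hnorm_ge0 ip w; lra.
have e1 : 0 < e / (2 * c) by rewrite divr_gt0 // mulr_gt0.
have [N1 hN1] := hl _ e1; have [N2 hN2] := inv_small _ e1.
pose n := maxn N1 N2.
have {}hN1 := hN1 n (leq_maxl _ _); have {}hN2 := hN2 n (leq_maxr _ _).
have wn : norm w <= c by rewrite /c lerDl.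
have split_e : e = c * (e / (2 * c)) + c * (e / (2 * c)).
  by field; rewrite gt_eqF.
rewrite (_ : _ - _ = hp (hemb H w) (l - hemb H (u n)) + (ip w (u n) - ip w (y a))); last first.
  by rewrite ipBr hemb_isometry addrA subrK.
apply: le_trans (cabsD _ _) _; rewrite [leRHS]split_e; apply: lerD.
  apply: le_trans (cauchy_schwarz _ _ _) _; rewrite hemb_norm.
  by apply: ler_pM => //; rewrite ?hnorm_ge0 // ltW.
have [aG|aG] := boolP (a \in G n).
  rewrite /u ip_sumr (bigD1_seq a) //= big1 ?addr0 ?subrr ?cabs0.
    by rewrite mulr_ge0 // ltW.
  by move=> b ba; apply: ip_orth wa (yg b) _; rewrite eq_sym.
rewrite /u ip_sumr big1_seq ?add0r ?cabsN; last first.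
  by move=> b /andP[_ bG]; apply: ip_orth wa (yg b) _; apply: contraNneq aG => ->.
apply: le_trans (cauchy_schwarz _ _ _) _.
apply: ler_pM; rewrite ?hnorm_ge0 //.
rewrite -(@ler_pXn2r _ 2%N) ?nnegrE ?hnorm_ge0 ?(ltW e1) //.
apply: le_trans (ltW hN2).
(* Adding a to G n keeps the sum below the supremum, so |y a|^2 is at most the gap 1/(n+1). *)
have := Sle (a :: G n); rewrite /= aG uG => /(_ isT); rewrite /S big_cons -/(S (G n)).
rewrite -lerBrDr => h; apply: le_trans h _.
by rewrite lerBlDr -lerBlDl ltW.
Qed.

End SpectralProjections.

Section EnergyNorms.
Context (R : realType) (V : unitary_voa R) (W : unitary_module V)
  (H : completion (umod_ip W)).
Local Notation hp := (hip H).
Local Notation norm := (hnorm (umod_ip W)).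
Local Notation nrm := (hnorm (hip H)).
Local Notation ds := (vmod_ds (umodP W)).
Implicit Types (x y : H) (a s p q : R) (F : seq R).

Lemma L0_closure_hemb a (w : W) : mgr a w ->
  L0_closure (hemb H w, a%:C%C *: hemb H w).
Proof.
move=> wa; apply: subset_closure; exists w.
by rewrite (vmod_L0 (umodP W) wa) hembZ.
Qed.

(** Passing to the closure creates no eigenvectors: a graph point near (e, s e), paired with w of
    weight a, shows (s - a) <w|e> = 0. So e has a component at s only. *)
Lemma L0_closure_eigen s (e : H) : L0_closure (e, s%:C%C *: e) ->
  exists2 w : W, mgr s w & e = hemb H w.
Proof.
move=> /closure_graphP ce; exists (hproj e s); first exact: hproj_gr.
apply: hproj_ext => a; rewrite hproj_hemb (comp_hom ds (hproj_gr e s)).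
case: eqP => [->//|/eqP as_]; apply: hproj_uniq (gr0 ds a) _ => w wa.
rewrite ip0r; apply/cabs_eq0.
have d0 : 0 < `|s - a| by rewrite normr_gt0 subr_eq0 eq_sym.
apply: small_eq0 (cabs_ge0 _) _ => t t0.
pose c := norm w * (1 + `|a|) + 1.
have c0 : 0 < c by rewrite ltr_pwDr // mulr_ge0 ?hnorm_ge0 // addr_ge0.
have [|x' [y' [[w' [xE yE]] h1 h2]]] := ce (t * `|s - a| / c).
  by rewrite divr_gt0 // mulr_gt0.
subst x' y'.
set ep := t * `|s - a| / c in h1 h2.
(* The contributions of the graph point (w', L_0 w') cancel, as L_0 is symmetric and w has weight a;
   only the two errors remain. *)
have E : (s - a)%:C%C * hp (hemb H w) e
   = hp (hemb H w) (s%:C%C *: e - hemb H (Ln 0 w')) - a%:C%C * hp (hemb H w) (e - hemb H w').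
  have aE : hp (hemb H w) (hemb H (Ln 0 w')) = a%:C%C * hp (hemb H w) (hemb H w').
    by rewrite !hemb_isometry -[X in Ln X](oppr0) -Ln_adj (vmod_L0 (umodP W) wa) ipZl.
  rewrite !ipBr ipZr conjR aE rmorphB /=; ring.
have ep0 : 0 < ep by rewrite divr_gt0 // mulr_gt0.
have : `|s - a| * cabs (hp (hemb H w) e) <= c * ep.
  have -> : `|s - a| * cabs (hp (hemb H w) e) = cabs ((s - a)%:C%C * hp (hemb H w) e).
    by rewrite cabsM cabs_real.
  rewrite E; apply: le_trans (cabsD _ _) _; rewrite cabsN cabsM cabs_real.
  apply: (@le_trans _ _ (norm w * ep + `|a| * (norm w * ep))); last first.
    rewrite (_ : _ + _ = norm w * (1 + `|a|) * ep); last by ring.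
    by rewrite ler_wpM2r ?lerDl // ltW.
  have cs z : nrm z < ep -> cabs (hp (hemb H w) z) <= norm w * ep.
    move=> zep; apply: le_trans (cauchy_schwarz _ _ _) _.
    by rewrite hemb_norm ler_wpM2l ?hnorm_ge0 ?ltW.
  by apply: lerD; rewrite ?ler_wpM2l //; exact: cs.
rewrite [leRHS](_ : _ = `|s - a| * t); last by rewrite /ep; field; rewrite gt_eqF.
by rewrite ler_pM2l.
Qed.

(** The test vectors of [fun_calculus] are exactly the embedded homogeneous vectors, so powers of 1
    + L_0 act coordinatewise. *)
Lemma energy_powP p x y : energy_pow p (x, y) <->
  forall a, hproj y a = ((1 + a) `^ p)%:C%C *: hproj x a.
Proof.
split=> [h a|h s e /L0_closure_eigen[w ws ->] /=].
  apply: hproj_uniq; first by apply: (grZ ds); exact: hproj_gr.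
  move=> w wa; have /= := h a (hemb H w) (L0_closure_hemb wa).
  move=> /(congr1 (@Num.conj R[i])); rewrite -ipC rmorphM /= -ipC conjR => ->.
  by rewrite ipZr conjR (hproj_ip _ wa).
by rewrite ipC [in RHS]ipC !(hproj_ip _ ws) h ipZr conjR rmorphM /= conjR.
Qed.

Lemma energy_pow_uniq p x y y' : energy_pow p (x, y) -> energy_pow p (x, y') -> y = y'.
Proof.
by move=> /energy_powP h /energy_powP h'; apply: hproj_ext => a; rewrite h h'.
Qed.

Lemma energy_normE p x y : energy_pow p (x, y) -> energy_norm p x = nrm y.
Proof.
move=> xy; rewrite /energy_norm; congr (hnorm _ _).
have h : [set y | energy_pow p (x, y)] (xget 0 [set y | energy_pow p (x, y)]) by exact: (xgetI 0 (xy : [set y | energy_pow p (x, y)] y)).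
exact: energy_pow_uniq h xy.
Qed.

(** A bound K >= 0 on the p-norm through finite partial sums, meaningful for every x in H before x
    is known to lie in the domain. *)
Definition energy_le p x (K : R) : Prop :=
  forall F, uniq F -> \sum_(a <- F) ((1 + a) `^ p * norm (hproj x a)) ^+ 2 <= K ^+ 2.

Lemma powC_norm (t : R) (w : W) : 0 <= t -> norm (t%:C%C *: w) = t * norm w.
Proof. by move=> t0; rewrite hnormZ cabsR. Qed.

Lemma energy_le_pow p x K : 0 <= K -> energy_le p x K ->
  exists2 y, energy_pow p (x, y) & nrm y <= K.
Proof.
move=> K0 xK; have [||y hy] := @riesz_fischer _ _ _ H (fun a => ((1 + a) `^ p)%:C%C *: hproj x a) K.
- by move=> a; apply: (grZ ds); exact: hproj_gr.
- move=> F /xK; under eq_bigr do rewrite -powC_norm ?powR_ge0 //.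
  by [].
exists y; first by apply/energy_powP.
apply: norm_le_partial => // F /xK.
by under eq_bigr do rewrite -powC_norm ?powR_ge0 // -hy.
Qed.

Lemma pow_energy_le p x y : energy_pow p (x, y) -> energy_le p x (nrm y).
Proof.
move=> /energy_powP h F uF; apply: le_trans (bessel y uF).
by under eq_bigr do rewrite -powC_norm ?powR_ge0 // -h.
Qed.

Lemma HrP p x : Hr p x <-> exists2 K, 0 <= K & energy_le p x K.
Proof.
split=> [[y xy]|[K K0 /energy_le_pow[//|y xy _]]]; last by exists y.
by exists (nrm y); [exact: hnorm_ge0|exact: pow_energy_le].
Qed.

Lemma energy_norm_ge0 p x : 0 <= energy_norm p x.
Proof. exact: hnorm_ge0. Qed.

Lemma energy_norm_le p x K : 0 <= K -> energy_le p x K -> energy_norm p x <= K.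
Proof. by move=> K0 /energy_le_pow[//|y /energy_normE ->]. Qed.

Lemma energy_le_norm p x : Hr p x -> energy_le p x (energy_norm p x).
Proof. by move=> [y xy]; rewrite (energy_normE xy); exact: pow_energy_le. Qed.

(** Nonnegative weights give 1 + a >= 1, so the powers increase with the exponent. *)
Lemma energy_le_mono p q x K : p <= q -> energy_le q x K -> energy_le p x K.
Proof.
move=> pq h F /h; apply: le_trans; apply: ler_sum => a _.
have [->|xa] := eqVneq (hproj x a) 0; first by rewrite hnorm0 !mulr0.
have a0 := hproj_weight xa.
rewrite ler_pXn2r ?nnegrE ?mulr_ge0 ?powR_ge0 ?hnorm_ge0 //.
by rewrite ler_wpM2r ?hnorm_ge0 // ler_powR // lerDl.
Qed.

(** [Hinf] asks for nonnegative exponents; negative ones follow by comparison with max(p, 0). *)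
Lemma HinfP x : Hinf x <-> forall p, exists2 K, 0 <= K & energy_le p x K.
Proof.
split=> [h p|h p _]; last exact/HrP.
have p0 : 0 <= Num.max p 0 by rewrite le_max lexx orbT.
have /HrP[K K0 xK] := h _ p0; exists K => //.
by apply: energy_le_mono xK; rewrite le_max lexx.
Qed.

Lemma Hinf_Hr p x : Hinf x -> Hr p x.
Proof. by move=> /HinfP/(_ p)/HrP. Qed.

Lemma energy_norm_hom p a (w : W) : mgr a w ->
  energy_norm p (hemb H w) = (1 + a) `^ p * norm w.
Proof.
move=> wa; rewrite (@energy_normE _ _ (hemb H (((1 + a) `^ p)%:C%C *: w))).
  by rewrite hemb_norm powC_norm // powR_ge0.
apply/energy_powP => b; rewrite !hproj_hemb (compZ ds) (comp_hom ds wa).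
by case: eqP => [->//|_]; rewrite !scaler0.
Qed.

Lemma Hinf_hemb (w : W) : Hinf (hemb H w).
Proof.
have hom a (u : W) : mgr a u -> Hinf (hemb H u).
  move=> ua p _; exists (hemb H (((1 + a) `^ p)%:C%C *: u)).
  apply/energy_powP => b; rewrite !hproj_hemb (compZ ds) (comp_hom ds ua).
  by case: eqP => [->//|_]; rewrite !scaler0.
move=> p p0; rewrite (comp_sum ds w) hemb_sum.
elim: (gsupp _ _) => [|a s [y /energy_powP hy]].
  rewrite big_nil; exists 0; apply/energy_powP => b.
  by rewrite hproj0 scaler0.
have [y' /energy_powP hy'] := hom _ _ (comp_gr ds w a) p p0.
rewrite big_cons; exists (y' + y); apply/energy_powP => b.
by rewrite !hprojD hy hy' scalerDr.
Qed.

End EnergyNorms.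

(** * Operators defined by sesquilinear forms *)

Section SchurTest.
Context (R : realType) (I J : eqType).

Lemma sum_sqr_eq0 (s : seq I) (al : I -> R) i :
  \sum_(i <- s) al i ^+ 2 <= 0 -> i \in s -> al i = 0.
Proof.
move=> h si; apply/eqP; rewrite -sqrf_eq0 eq_le sqr_ge0 andbT (le_trans _ h) //.
by rewrite (big_rem i) //= lerDl sumr_ge0 // => j _; exact: sqr_ge0.
Qed.

(** From (B al - A be)^2 >= 0 comes 2 A B al be <= B^2 al^2 + A^2 be^2, and then the row and column
    sums of [ga] are at most C. This needs A, B > 0; if one is 0, all the al or all the be
    vanish. *)
Lemma schur_test (F : seq I) (G : seq J) (ga : I -> J -> R) (al : I -> R) (be : J -> R)
    (C A B : R) :
  (forall i j, 0 <= ga i j) -> 0 <= C ->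
  (forall j, \sum_(i <- F) ga i j <= C) -> (forall i, \sum_(j <- G) ga i j <= C) ->
  0 <= A -> 0 <= B ->
  \sum_(i <- F) al i ^+ 2 <= A ^+ 2 -> \sum_(j <- G) be j ^+ 2 <= B ^+ 2 ->
  \sum_(i <- F) \sum_(j <- G) ga i j * (al i * be j) <= C * A * B.
Proof.
move=> ga0 C0 hF hG; rewrite le_eqVlt => /predU1P[<-|A0].
  move=> _; rewrite expr0n mulr0 mul0r => hA _.
  rewrite big1_seq // => i /andP[_ iF]; rewrite big1 // => j _.
  by rewrite (sum_sqr_eq0 hA iF) mul0r mulr0.
rewrite le_eqVlt => /predU1P[<-|B0].
  move=> _; rewrite expr0n mulr0 => hB.
  rewrite big1_seq // => i /andP[_ iF]; rewrite big1_seq // => j /andP[_ jG].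
  have -> : be j = 0; last by rewrite !mulr0.
  apply/eqP; rewrite -sqrf_eq0 eq_le sqr_ge0 andbT (le_trans _ hB) //.
  by rewrite (big_rem j) //= lerDl sumr_ge0 // => k _; exact: sqr_ge0.
move=> hA hB.
have AB : 0 < 2 * (A * B) by rewrite !mulr_gt0.
rewrite -(ler_pM2l AB) mulr_sumr.
apply: (@le_trans _ _ (\sum_(i <- F) \sum_(j <- G)
    (B ^+ 2 * (ga i j * al i ^+ 2) + A ^+ 2 * (ga i j * be j ^+ 2)))).
  apply: ler_sum => i _; rewrite mulr_sumr; apply: ler_sum => j _.
  rewrite -subr_ge0 (_ : _ - _ = ga i j * (B * al i - A * be j) ^+ 2); last by ring.
  by rewrite mulr_ge0 ?sqr_ge0.
under eq_bigr do rewrite big_split /=.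
rewrite big_split /= [X in _ + X]exchange_big /=.
have -> : 2 * (A * B) * (C * A * B) = B ^+ 2 * (C * A ^+ 2) + A ^+ 2 * (C * B ^+ 2) by ring.
apply: lerD.
  under eq_bigr do rewrite -mulr_sumr -mulr_suml.
  rewrite -mulr_sumr ler_wpM2l ?sqr_ge0 //.
  apply: (@le_trans _ _ (\sum_(i <- F) C * al i ^+ 2)).
    by apply: ler_sum => i _; rewrite ler_wpM2r ?sqr_ge0.
  by rewrite -mulr_sumr ler_wpM2l.
under eq_bigr do rewrite -mulr_sumr -mulr_suml.
rewrite -mulr_sumr ler_wpM2l ?sqr_ge0 //.
apply: (@le_trans _ _ (\sum_(j <- G) C * be j ^+ 2)).
  by apply: ler_sum => j _; rewrite ler_wpM2r ?sqr_ge0.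
by rewrite -mulr_sumr ler_wpM2l.
Qed.

Lemma le_sqr_sqrt (S c : R) : 0 <= S -> 0 <= c -> S <= c * Num.sqrt S -> S <= c ^+ 2.
Proof.
move=> S0 c0 h; have [->|Sn] := eqVneq S 0; first exact: sqr_ge0.
have s0 : 0 < Num.sqrt S by rewrite sqrtr_gt0 lt_def Sn.
have := h; rewrite -{1}(sqr_sqrtr S0) expr2 ler_pM2r // => h1.
by rewrite -(sqr_sqrtr S0) ler_pXn2r ?nnegrE ?sqrtr_ge0.
Qed.

Lemma sum_sqr_le (s : seq I) (al : I -> R) : (forall i, 0 <= al i) ->
  \sum_(i <- s) al i ^+ 2 <= (\sum_(i <- s) al i) ^+ 2.
Proof.
move=> al0; elim: s => [|i s IH]; first by rewrite !big_nil expr0n.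
rewrite !big_cons sqrrD -addrA lerD2l (le_trans IH) // lerDr mulrn_wge0 //.
by rewrite mulr_ge0 // sumr_ge0.
Qed.

End SchurTest.

(** * Tame forms and their operators *)

Section Forms.
Context (R : realType) (V : unitary_voa R).

Section OneForm.
Context (Wj Wk : unitary_module V).
Local Notation normj := (hnorm (umod_ip Wj)).
Local Notation normk := (hnorm (umod_ip Wk)).
Local Notation dsj := (vmod_ds (umodP Wj)).
Local Notation dsk := (vmod_ds (umodP Wk)).
Implicit Types (Phi : Wj -> Wk -> R[i]) (p q r C K : R).

Definition sesquilinear_form Phi : Prop :=
  (forall a u v w, Phi (a *: u + v) w = a * Phi u w + Phi v w) /\
  (forall a u v w, Phi w (a *: u + v) = a^* * Phi w u + Phi w v).

(* [Phi] satisfies the hypotheses of the Schur test after conjugation by powers of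
   1 + L_0: its operator is bounded by [C] from the [q]-norm to the [p]-norm. *)
Definition schur_bounded Phi p q C : Prop := exists ga : R -> R -> R,
  [/\ forall a b, 0 <= ga a b,
      forall b F, uniq F -> \sum_(a <- F) ga a b <= C,
      forall a F, uniq F -> \sum_(b <- F) ga a b <= C &
      forall a b w w', mgr a w -> mgr b w' ->
        cabs (Phi w w') <= ga a b * ((1 + a) `^ q * normj w) * ((1 + b) `^ (- p) * normk w')].

(* [Phi] is the form of an operator of order [r] on the whole scale of energy norms. *)
Definition tame Phi : Prop := sesquilinear_form Phi /\
  exists2 r, 0 <= r & forall p, exists2 C, 0 <= C & schur_bounded Phi p (p + r) C.

Section OneFormTheory.
Context (Phi : Wj -> Wk -> R[i]) (tPhi : tame Phi).
Context (Hj : completion (umod_ip Wj)) (Hk : completion (umod_ip Wk)).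
Local Notation nrmj := (hnorm (hip Hj)).
Local Notation nrmk := (hnorm (hip Hk)).

Lemma formDl u v w : Phi (u + v) w = Phi u w + Phi v w.
Proof. by have := tPhi.1.1 1 u v w; rewrite scale1r mul1r. Qed.
Lemma formDr u v w : Phi w (u + v) = Phi w u + Phi w v.
Proof. by have := tPhi.1.2 1 u v w; rewrite scale1r rmorph1 mul1r. Qed.
Lemma form0l w : Phi 0 w = 0.
Proof. by have := tPhi.1.1 (-1) 0 0 w; rewrite scaler0 add0r mulN1r addNr. Qed.
Lemma form0r w : Phi w 0 = 0.
Proof. by have := tPhi.1.2 (-1) 0 0 w; rewrite scaler0 add0r rmorphN1 mulN1r addNr. Qed.
Lemma form_suml (I : Type) (s : seq I) F w :
  Phi (\sum_(i <- s) F i) w = \sum_(i <- s) Phi (F i) w.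
Proof.
elim: s => [|i s IH]; first by rewrite !big_nil form0l.
by rewrite !big_cons formDl IH.
Qed.
Lemma form_sumr (I : Type) (s : seq I) F w :
  Phi w (\sum_(i <- s) F i) = \sum_(i <- s) Phi w (F i).
Proof.
elim: s => [|i s IH]; first by rewrite !big_nil form0r.
by rewrite !big_cons formDr IH.
Qed.

(** At p = -r the Schur bound involves the plain norm of W_j. The Riesz vectors of w -> Phi w wk on
    the weight spaces have norms at most ga a b * k, with sum at most C k, and [riesz_fischer]
    assembles them. *)
Lemma form_vec_hom b (wk : Wk) : mgr b wk ->
  exists v : Hj, forall wj, hip Hj (hemb Hj wj) v = Phi wj wk.
Proof.
move=> wkb; have [r r0 hr] := tPhi.2; have [C C0] := hr (- r).
rewrite addNr => -[ga [ga0 hF _ hPhi]].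
have /choice[va hva] : forall a, exists v, mgr a v /\ forall w, mgr a w -> Phi w wk = umod_ip Wj w v.
  move=> a; have [|v av hv] := @riesz_gr _ _ Wj a (Phi ^~ wk).
    by move=> c u v; rewrite tPhi.1.1.
  by exists v.
pose k := (1 + b) `^ r * normk wk.
have k0 : 0 <= k by rewrite mulr_ge0 ?powR_ge0 ?hnorm_ge0.
have vle a : normj (va a) <= ga a b * k.
  have [ga_a hv] := hva a.
  have [->|n0] := eqVneq (va a) 0; first by rewrite hnorm0 mulr_ge0.
  have nv : 0 < normj (va a) by rewrite lt_def hnorm_ge0 andbT; apply: contra n0 => /eqP/hnorm_eq0 ->.
  have := hPhi a b _ _ ga_a wkb; rewrite hv // ip_norm cabsR ?sqr_ge0 //.
  rewrite powRr0 mul1r opprK -/k expr2 -[ga a b * _ * _]mulrAC.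
  by rewrite ler_pM2r.
have [||v hv] := @riesz_fischer _ _ _ Hj va (C * k).
- by move=> a; case: (hva a).
- move=> F uF; apply: le_trans (sum_sqr_le _ _) _; first by move=> a; exact: hnorm_ge0.
  rewrite ler_pXn2r ?nnegrE ?sumr_ge0 ?(mulr_ge0 C0 k0) //; last by move=> a _; exact: hnorm_ge0.
  apply: (@le_trans _ _ (\sum_(a <- F) ga a b * k)); first by apply: ler_sum.
  by rewrite -mulr_suml ler_wpM2r // hF.
exists v => wj; rewrite {1}(comp_sum dsj wj) hemb_sum ip_suml.
rewrite [in RHS](comp_sum dsj wj) form_suml; apply: eq_bigr => a _.
have ca := comp_gr dsj wj a.
by rewrite (hproj_ip _ ca) hv; case: (hva a) => _ ->.
Qed.

(* The image of [wk] under the adjoint of the operator of [Phi]. *)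
Definition form_vec (wk : Wk) : Hj :=
  xget 0 [set v | forall wj, hip Hj (hemb Hj wj) v = Phi wj wk].

Lemma form_vecP wk wj : hip Hj (hemb Hj wj) (form_vec wk) = Phi wj wk.
Proof.
suff [v hv] : exists v : Hj, forall wj, hip Hj (hemb Hj wj) v = Phi wj wk.
  have hv' : [set v | forall wj, hip Hj (hemb Hj wj) v = Phi wj wk] v by [].
  exact: (xgetI 0 hv').
rewrite (comp_sum dsk wk); elim: (gsupp _ _) => [|b s [v hv]].
  by exists 0 => w; rewrite big_nil form0r ip0r.
have [v' hv'] := form_vec_hom (comp_gr dsk wk b).
by exists (v' + v) => w; rewrite big_cons ipDr hv hv' formDr.
Qed.

Lemma form_vec_uniq wk v :
  (forall wj, hip Hj (hemb Hj wj) v = Phi wj wk) -> form_vec wk = v.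
Proof.
move=> hv; apply: hilbert_ext => w; rewrite ipC [RHS]ipC; congr (_^*).
by rewrite form_vecP hv.
Qed.

Lemma form_vecL a u v : form_vec (a *: u + v) = a *: form_vec u + form_vec v.
Proof.
by apply: form_vec_uniq => w; rewrite ipDr ipZr !form_vecP tPhi.1.2.
Qed.

Lemma form_vec_sum (I : Type) (s : seq I) F :
  form_vec (\sum_(i <- s) F i) = \sum_(i <- s) form_vec (F i).
Proof.
apply: form_vec_uniq => w; rewrite ip_sumr form_sumr.
by apply: eq_bigr => i _; rewrite form_vecP.
Qed.

(** For a truncation of x the pairing with [form_vec] unfolds to [Phi] and the Schur test applies;
    with G fixed, the truncation error is as small as desired. *)
Lemma form_vec_bound p q C K B (x : Hj) G (z : R -> Wk) :
  0 <= C -> 0 <= K -> 0 <= B -> schur_bounded Phi p q C -> energy_le q x K ->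
  uniq G -> (forall b, mgr b (z b)) ->
  \sum_(b <- G) ((1 + b) `^ (- p) * normk (z b)) ^+ 2 <= B ^+ 2 ->
  cabs (\sum_(b <- G) hip Hj x (form_vec (z b))) <= C * K * B.
Proof.
move=> C0 K0 B0 [ga [ga0 hF hG hPhi]] xK uG zb hB.
rewrite -ip_sumr -form_vec_sum; set v := form_vec _.
apply/ler_addgt0Pr => e e0.
have c0 : 0 < nrmj v + 1 by rewrite ltr_wpDl ?hnorm_ge0.
have [F uF /(_ F uF (fun _ => id)) hx] := trunc_approx x (divr_gt0 e0 c0).
rewrite -[x](subrK (hemb Hj (trunc x F))) ipDl addrC.
apply: le_trans (cabsD _ _) _; apply: lerD; last first.
  apply: le_trans (cauchy_schwarz _ _ _) _.
  rewrite -[leRHS](divfK (lt0r_neq0 c0)); apply: ler_pM; rewrite ?hnorm_ge0 //.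
    exact: ltW.
  by rewrite lerDl.
rewrite form_vecP /trunc form_suml; apply: le_trans (cabs_sum _ _) _.
apply: le_trans (schur_test ga0 C0 (fun b => hF b F uF) (fun a => hG a G uG) K0 B0 (xK F uF) hB).
apply: ler_sum => a _; rewrite form_sumr; apply: le_trans (cabs_sum _ _) _.
apply: ler_sum => b _; rewrite mulrA; apply: hPhi => //; exact: hproj_gr.
Qed.

(** The weak form of y = T x: the adjoint of T is available on W_k as [form_vec], so x may be any
    vector of H_j. *)
Definition form_act (x : Hj) (y : Hk) : Prop :=
  forall wk, hip Hk y (hemb Hk wk) = hip Hj x (form_vec wk).

Lemma form_act_uniq x y y' : form_act x y -> form_act x y' -> y = y'.
Proof. by move=> h h'; apply: hilbert_ext => w; rewrite h h'. Qed.

(** Duality: z is tested against z' = (1 + b)^(2p) z. The pairing is the sum S itself and the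
    (-p)-norm of z' is sqrt S, so S <= C K sqrt S. *)
Lemma form_dual_bound p q C K (x : Hj) (z : R -> Wk) G : uniq G ->
  0 <= C -> 0 <= K -> schur_bounded Phi p q C -> energy_le q x K ->
  (forall b, mgr b (z b)) ->
  (forall b w, mgr b w -> hip Hj x (form_vec w) = umod_ip Wk (z b) w) ->
  \sum_(b <- G) ((1 + b) `^ p * normk (z b)) ^+ 2 <= (C * K) ^+ 2.
Proof.
move=> uG C0 K0 sPhi xK zb hz; set S := \sum_(b <- G) _.
have S0 : 0 <= S by apply: sumr_ge0 => b _; exact: sqr_ge0.
apply: le_sqr_sqrt => //; first exact: mulr_ge0.
pose z' b := (((1 + b) `^ p) ^+ 2)%:C%C *: z b.
have z'b b : mgr b (z' b) by exact: grZ dsk _ _ _ (zb b).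
have := @form_vec_bound p q C K (Num.sqrt S) x G z' C0 K0 (sqrtr_ge0 _) sPhi xK uG z'b.
rewrite sqr_sqrtr //.
have -> : \sum_(b <- G) hip Hj x (form_vec (z' b)) = S%:C%C.
  rewrite rmorph_sum; apply: eq_bigr => b _.
  by rewrite (hz b) // ipZr conjR ip_norm -rmorphM exprMn.
rewrite cabsR // => h; apply: h.
rewrite le_eqVlt; apply/orP; left; apply/eqP; apply: eq_bigr => b _.
rewrite {1}/z'; have [->|zn] := eqVneq (z b) 0; first by rewrite scaler0 hnorm0 !mulr0.
have b0 := weight_ge0 (zb b) zn.
have pb : 0 < (1 + b) `^ p by rewrite powR_gt0 // ltr_pwDl.
congr (_ ^+ 2); rewrite powC_norm ?sqr_ge0 // mulrA powRN; congr (_ * _).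
by rewrite expr2 mulrA mulVf ?mul1r // gt_eqF.
Qed.

(** At level p = 0 the bound makes the components of the image square-summable. *)
Lemma form_act_exists x : Hinf x -> exists y, form_act x y.
Proof.
move=> /HinfP hx; have [r r0 hr] := tPhi.2; have [C C0] := hr 0.
rewrite add0r => sPhi; have [K K0 xK] := hx r.
have /choice[z hz] : forall b, exists v, mgr b v /\
    forall w, mgr b w -> (hip Hj x (form_vec w))^* = umod_ip Wk w v.
  move=> b; have [|v bv hv] := @riesz_gr _ _ Wk b (fun w => (hip Hj x (form_vec w))^*).
    by move=> c u v; rewrite form_vecL ipDr ipZr rmorphD rmorphM /= conjCK.
  by exists v.
have zb b : mgr b (z b) by case: (hz b).
have hz' b w : mgr b w -> hip Hj x (form_vec w) = umod_ip Wk (z b) w.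
  by move=> wb; rewrite ipC; case: (hz b) => _ /(_ _ wb) <-; rewrite conjCK.
have [||y hy] := @riesz_fischer _ _ _ Hk z (C * K) => //.
  move=> F uF; have := form_dual_bound uF C0 K0 sPhi xK zb hz'.
  by under eq_bigr do rewrite powRr0 mul1r.
exists y => wk; rewrite ipC (comp_sum dsk wk) hemb_sum ip_suml form_vec_sum ip_sumr.
rewrite rmorph_sum; apply: eq_bigr => b _; have cb := comp_gr dsk wk b.
by rewrite (hproj_ip _ cb) hy (hz' b _ cb) [RHS]ipC.
Qed.

Lemma form_act_bound p q C K x y : form_act x y -> 0 <= C -> 0 <= K ->
  schur_bounded Phi p q C -> energy_le q x K -> energy_le p y (C * K).
Proof.
move=> xy C0 K0 sPhi xK F uF.
apply: (form_dual_bound uF C0 K0 sPhi xK (hproj_gr y)) => b w wb.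
by rewrite -xy [LHS]ipC [RHS]ipC (hproj_ip _ wb).
Qed.

Lemma form_act_Hinf x y : Hinf x -> form_act x y -> Hinf y.
Proof.
move=> /HinfP hx xy; apply/HinfP => p; have [r r0 /(_ p)[C C0 sPhi]] := tPhi.2.
have [K K0 xK] := hx (p + r); exists (C * K); first exact: mulr_ge0.
exact: form_act_bound xy C0 K0 sPhi xK.
Qed.

Definition form_graph : set (Hj * Hk) :=
  [set x : Hj * Hk | exists2 wj : Wj, x.1 = hemb Hj wj &
     forall wk : Wk, hip Hk x.2 (hemb Hk wk) = Phi wj wk].

Definition form_op (x : Hj) : Hk := xget 0 [set y | closure form_graph (x, y)].

(** On the graph the relation holds by [form_vecP]; it is tested by inner products with fixed
    vectors, hence passes to limits. *)
Lemma closure_form_act x y : closure form_graph (x, y) -> form_act x y.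
Proof.
move=> /closure_graphP h wk; apply/eqP; rewrite -subr_eq0; apply/eqP/cabs_eq0.
apply: small_eq0 (cabs_ge0 _) _ => e e0.
pose c := nrmk (hemb Hk wk) + nrmj (form_vec wk) + 1.
have c0 : 0 < c by rewrite ltr_wpDl // addr_ge0 ?hnorm_ge0.
have [x' [y' [[wj /= -> hy'] hx hy]]] := h (e / c) (divr_gt0 e0 c0).
have -> : hip Hk y (hemb Hk wk) - hip Hj x (form_vec wk)
    = hip Hk (y - y') (hemb Hk wk) - hip Hj (x - hemb Hj wj) (form_vec wk).
  by rewrite !ipBl hy' form_vecP opprB addrA subrK.
apply: le_trans (cabsD _ _) _; rewrite cabsN.
apply: (@le_trans _ _ (e / c * nrmk (hemb Hk wk) + e / c * nrmj (form_vec wk))).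
  by apply: lerD; apply: le_trans (cauchy_schwarz _ _ _) _; rewrite ler_wpM2r ?hnorm_ge0 ?ltW.
rewrite -mulrDr -[leRHS](divfK (lt0r_neq0 c0)) ler_wpM2l //; first by rewrite ltW // divr_gt0.
by rewrite lerDl.
Qed.

(** The operator is controlled by the r-norm, so x is truncated on one finite set F that is good
    both for x and for (1 + L_0)^r x. *)
Lemma form_act_closure x y : Hinf x -> form_act x y -> closure form_graph (x, y).
Proof.
move=> hx xy; apply/closure_graphP => e e0.
have [r r0 /(_ 0)[C C0]] := tPhi.2; rewrite add0r => sPhi.
have [xr hxr] := Hinf_Hr r hx.
have c0 : 0 < C + 1 by rewrite ltr_wpDl.
have [F1 uF1 h1] := trunc_approx x e0.
have [F2 uF2 h2] := trunc_approx xr (divr_gt0 e0 c0).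
pose F := undup (F1 ++ F2).
have uF : uniq F by exact: undup_uniq.
have {}h1 : nrmj (x - hemb Hj (trunc x F)) < e.
  by apply: h1 => // a aF; rewrite mem_undup mem_cat aF.
have {}h2 : nrmj (xr - hemb Hj (trunc xr F)) < e / (C + 1).
  by apply: h2 => // a aF; rewrite mem_undup mem_cat aF orbT.
set w := trunc x F in h1.
have [y' wy'] := form_act_exists (Hinf_hemb Hj w).
exists (hemb Hj w), y'; split=> //; first by exists w => // wk; rewrite /= wy' form_vecP.
have hd : form_act (x - hemb Hj w) (y - y').
  by move=> wk; rewrite !ipBl xy wy'.
have pd : energy_pow r (x - hemb Hj w, xr - hemb Hj (trunc xr F)).
  apply/energy_powP => a; rewrite !hprojB !hproj_hemb !comp_trunc //.
  move/energy_powP: hxr => ->; case: ifP; rewrite ?subrr ?subr0 ?scaler0 //.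
have := form_act_bound hd C0 (hnorm_ge0 _ _) sPhi (pow_energy_le pd).
move=> ye; have : nrmk (y - y') <= C * nrmj (xr - hemb Hj (trunc xr F)).
  apply: norm_le_partial; first by rewrite mulr_ge0 ?hnorm_ge0.
  by move=> G /ye; under eq_bigr do rewrite powRr0 mul1r.
move=> h3; apply: le_lt_trans h3 _.
apply: (@le_lt_trans _ _ (C * (e / (C + 1)))); first by rewrite ler_wpM2l // ltW.
rewrite mulrCA -[ltRHS]mulr1 ltr_pM2l // ltr_pdivrMr // mul1r.
by rewrite ltrDl.
Qed.

Lemma form_opP x : Hinf x -> form_act x (form_op x).
Proof.
move=> hx; apply: closure_form_act; have [y xy] := form_act_exists hx.
have cxy := form_act_closure hx xy.
have cxy' : [set y | closure form_graph (x, y)] y by [].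
exact: (xgetI 0 cxy').
Qed.

Lemma form_op_Hinf x : Hinf x -> Hinf (form_op x).
Proof. by move=> hx; apply: form_act_Hinf (form_opP hx). Qed.

Lemma form_op_bound p q C x : Hinf x -> 0 <= C -> schur_bounded Phi p q C ->
  energy_norm p (form_op x) <= C * energy_norm q x.
Proof.
move=> hx C0 sPhi; apply: energy_norm_le; first by rewrite mulr_ge0 ?energy_norm_ge0.
apply: form_act_bound (form_opP hx) C0 (energy_norm_ge0 _ _) sPhi _.
exact: energy_le_norm (Hinf_Hr _ hx).
Qed.

End OneFormTheory.

Lemma schur_mono Phi p q q' C : q <= q' ->
  schur_bounded Phi p q C -> schur_bounded Phi p q' C.
Proof.
move=> qq' [ga [ga0 hF hG h]]; exists ga; split=> // a b w w' wa w'b.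
apply: le_trans (h _ _ _ _ wa w'b) _.
rewrite ler_wpM2r ?mulr_ge0 ?powR_ge0 ?hnorm_ge0 // ler_wpM2l //.
have [->|w0] := eqVneq w 0; first by rewrite hnorm0 !mulr0.
have a0 := weight_ge0 wa w0.
by rewrite ler_wpM2r ?hnorm_ge0 // ler_powR // lerDl.
Qed.

Lemma tame0 : tame (fun _ _ => 0).
Proof.
split; first by split=> *; rewrite mulr0 addr0.
exists 0 => // p; exists 0 => //; exists (fun _ _ => 0); split=> //.
- by move=> b F _; rewrite big1.
- by move=> b F _; rewrite big1.
- by move=> *; rewrite cabs0 !mul0r.
Qed.

Lemma tame_lin c Phi Phi' : tame Phi -> tame Phi' ->
  tame (fun w w' => c * Phi w w' + Phi' w w').
Proof.
move=> [[l1 l2] [r r0 h]] [[l1' l2'] [r' r'0 h']]; split.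
  by split=> a u v w; rewrite ?l1 ?l1' ?l2 ?l2'; ring.
exists (r + r') => [|p]; first exact: addr_ge0.
have [C C0 /(@schur_mono _ _ _ (p + (r + r'))) sC] := h p.
have [C' C'0 /(@schur_mono _ _ _ (p + (r + r'))) sC'] := h' p.
have [|ga [ga0 hF hG b]] := sC; first lra.
have [|ga' [ga'0 hF' hG' b']] := sC'; first lra.
exists (cabs c * C + C'); first by rewrite addr_ge0 ?mulr_ge0 ?cabs_ge0.
exists (fun x y => cabs c * ga x y + ga' x y); split.
- by move=> x y; rewrite addr_ge0 ?mulr_ge0 ?cabs_ge0.
- move=> y F uF; rewrite big_split /= -mulr_sumr lerD // ?ler_wpM2l ?cabs_ge0 //; [exact: hF|exact: hF'].
- move=> y F uF; rewrite big_split /= -mulr_sumr lerD // ?ler_wpM2l ?cabs_ge0 //; [exact: hG|exact: hG'].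
move=> x y w w' wx w'y; apply: le_trans (cabsD _ _) _; rewrite cabsM !mulrDl lerD //.
  by rewrite -!mulrA ler_wpM2l ?cabs_ge0 // !mulrA -[X in _ <= X * _ * _]mulrA -mulrA; move: (b _ _ _ _ wx w'y); rewrite !mulrA.
exact: b'.
Qed.

Lemma tame_sum n (c : 'I_n -> R[i]) (Psi : 'I_n -> Wj -> Wk -> R[i]) :
  (forall l, tame (Psi l)) -> tame (fun w w' => \sum_(l < n) c l * Psi l w w').
Proof.
elim: n c Psi => [|n IH] c Psi h.
  rewrite (_ : (fun w w' => _) = (fun _ _ => 0)); first exact: tame0.
  by apply/funext => w; apply/funext => w'; rewrite big_ord0.
rewrite (_ : (fun w w' => _) = (fun w w' => c ord0 * Psi ord0 w w' +
    \sum_(l < n) c (lift ord0 l) * Psi (lift ord0 l) w w')).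
  by apply: tame_lin => //; apply: IH => l; exact: h.
by apply/funext => w; apply/funext => w'; rewrite big_ord_recl.
Qed.

End OneForm.

(** At level -(p + r) the form weighs its first argument with exponent -p and its second with p + r,
    which is level p for the exchanged form; the conditions on [ga] are symmetric in rows and
    columns. *)
Lemma tame_swap (Wj Wk : unitary_module V) (Phi : Wj -> Wk -> R[i]) :
  tame Phi -> tame (fun w' w => (Phi w w')^*).
Proof.
move=> [[l1 l2] [r r0 h]]; split.
  by split=> a u v w; rewrite ?l1 ?l2 rmorphD rmorphM /= ?conjCK.
exists r => // p; have [C C0 [ga [ga0 hF hG b]]] := h (- (p + r)); exists C => //.
exists (fun x y => ga y x); split=> // x y w w' wx w'y.
rewrite cabsJ; apply: le_trans (b _ _ _ _ w'y wx) _.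
by rewrite (_ : - (p + r) + r = - p) ?opprK 1?mulrAC //; ring.
Qed.

(** For x in W_j the image is the combination of the vectors [form_vec (Psi m)] with conjugate
    coefficients, and y enters through [form_act] of each [Psi m]. A general x is reached along the
    graph, whose closure contains (x, form_op x). *)
Lemma form_adjoint (Wj Wk : unitary_module V)
    (Hj : completion (umod_ip Wj)) (Hk : completion (umod_ip Wk))
    (Phi : Wj -> Wk -> R[i]) n (c : 'I_n -> R[i]) (Psi : 'I_n -> Wk -> Wj -> R[i]) :
  tame Phi -> (forall m, tame (Psi m)) ->
  (forall wk wj, \sum_(m < n) c m * Psi m wk wj = (Phi wj wk)^*) ->
  forall (x : Hj) (y : Hk), Hinf x -> Hinf y ->
  hip Hk (form_op Phi Hk x) y
  = hip Hj x (\sum_(m < n) c m *: form_op (Psi m) Hj y).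
Proof.
move=> tPhi tPsi hc x y hx hy; set By := \sum_(m < n) _.
have hom wj : hip Hk (form_op Phi Hk (hemb Hj wj)) y = hip Hj (hemb Hj wj) By.
  have -> : form_op Phi Hk (hemb Hj wj) = \sum_(m < n) (c m)^* *: form_vec (Psi m) Hk wj.
    apply: hilbert_ext => wk; rewrite (form_opP tPhi Hk (Hinf_hemb Hj wj)) form_vecP //.
    rewrite ipC ip_sumr -[LHS]conjCK -hc; congr (_^*); apply: eq_bigr => m _.
    by rewrite ipZr conjCK form_vecP.
  rewrite ip_suml ip_sumr; apply: eq_bigr => m _; rewrite ipZl ipZr; congr (_ * _).
  by rewrite [RHS]ipC (form_opP (tPsi m) Hj hy) -ipC.
apply/eqP; rewrite -subr_eq0; apply/eqP/cabs_eq0.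
apply: small_eq0 (cabs_ge0 _) _ => e e0.
pose k := hnorm (hip Hk) y + hnorm (hip Hj) By + 1.
have k0 : 0 < k by rewrite ltr_wpDl // addr_ge0 ?hnorm_ge0.
have := form_act_closure tPhi hx (form_opP tPhi Hk hx).
move=> /closure_graphP/(_ (e / k) (divr_gt0 e0 k0))[x' [y' [[wj /= -> hy'] h1 h2]]].
have y'E : y' = form_op Phi Hk (hemb Hj wj).
  apply: hilbert_ext => wk; rewrite hy' (form_opP tPhi Hk (Hinf_hemb Hj wj)).
  by rewrite form_vecP.
have -> : hip Hk (form_op Phi Hk x) y - hip Hj x By
    = hip Hk (form_op Phi Hk x - y') y - hip Hj (x - hemb Hj wj) By.
  by rewrite !ipBl y'E hom opprB addrA subrK.
apply: le_trans (cabsD _ _) _; rewrite cabsN.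
apply: (@le_trans _ _ (e / k * hnorm (hip Hk) y + e / k * hnorm (hip Hj) By)).
  by apply: lerD; apply: le_trans (cauchy_schwarz _ _ _) _; rewrite ler_wpM2r ?hnorm_ge0 ?ltW.
rewrite -mulrDr -[leRHS](divfK (lt0r_neq0 k0)) ler_wpM2l //; first by rewrite ltW // divr_gt0.
by rewrite lerDl.
Qed.

End Forms.

(** * Finiteness of the weight classes *)

Section SubLmodule.
Context (K : fieldType) (E : lmodType K) (A : set E) (hA : subspace A).

(** Complete reducibility and [vmodule] speak of types with an lmodule structure, so subspaces,
    which are sets, have to be made into such types. *)
Definition in_subspace of subspace A : pred E := fun w => `[< A w >].

Lemma in_subspace_closed : submod_closed (in_subspace hA).
Proof.
split; first by apply/asboolP; case: hA.
by move=> a u v /asboolP Au /asboolP Av; apply/asboolP; case: hA => _; exact.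
Qed.

HB.instance Definition _ :=
  GRing.isSubmodClosed.Build K E (in_subspace hA) in_subspace_closed.

Record sub_lmodule := SubLmodule { sub_val :> E; _ : in_subspace hA sub_val }.

HB.instance Definition _ := [isSub for sub_val].
HB.instance Definition _ := [Choice of sub_lmodule by <:].
HB.instance Definition _ := [SubChoice_isSubLmodule of sub_lmodule by <:].

Lemma sub_valP (x : sub_lmodule) : A (sub_val x).
Proof. by case: x => w /= /asboolP. Qed.

Definition sub_mk w (Aw : A w) : sub_lmodule := SubLmodule (asboolT Aw).

Lemma sub_val_linear a (u v : sub_lmodule) :
  sub_val (a *: u + v) = a *: sub_val u + sub_val v.
Proof. exact: (linearP (val : sub_lmodule -> E)). Qed.

Lemma sub_val0 : sub_val 0 = 0. Proof. exact: (raddf0 (val : sub_lmodule -> E)). Qed.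

Lemma sub_valB (u v : sub_lmodule) : sub_val (u - v) = sub_val u - sub_val v.
Proof. exact: (raddfB (val : sub_lmodule -> E)). Qed.

Lemma sub_valZ a (u : sub_lmodule) : sub_val (a *: u) = a *: sub_val u.
Proof. by rewrite -[a *: u]addr0 sub_val_linear sub_val0 addr0. Qed.

Lemma sub_val_inj : injective sub_val. Proof. exact: val_inj. Qed.

Lemma sub_val_sum (I : Type) (s : seq I) (F : I -> sub_lmodule) :
  sub_val (\sum_(i <- s) F i) = \sum_(i <- s) sub_val (F i).
Proof. exact: (raddf_sum (val : sub_lmodule -> E)). Qed.

(** A sum with infinite support is 0 by convention; [sub_val] is injective, so both supports agree
    and this case is consistent. *)
Lemma sub_val_fsum (I : choiceType) (F : I -> sub_lmodule) :
  sub_val (\sum_(i \in [set: I]) F i) = \sum_(i \in [set: I]) sub_val (F i).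
Proof.
have sE : [set: I] `&` F @^-1` [set~ 0] = [set: I] `&` (fun i => sub_val (F i)) @^-1` [set~ 0].
  rewrite !setTI; apply/seteqP; split=> i /= h e; apply: h.
    by apply: sub_val_inj; rewrite e sub_val0.
  by rewrite e sub_val0.
have [fF|iF] := pselect (finite_set ([set: I] `&` F @^-1` [set~ 0])); last first.
  by rewrite !fsbig_dflt -?sE // sub_val0.
have [s us hs] := (finite_set_seqP _).1 fF.
have F0 i : i \notin s -> F i = 0.
  by move=> /negP h; apply: contrapT => Fi; apply: h; apply: hs.
rewrite !(fsumE us) ?sub_val_sum // => i /F0 ->; exact: sub_val0.
Qed.

End SubLmodule.

Section Submodules.
Context (R : realType) (V : voa R) (W : vmod_data V) (hW : is_vmodule W).
Local Notation comp := (component (@mgr R V W)).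
Local Notation ds := (vmod_ds hW).
Local Notation bl := (weak_bilinear (vmod_weak hW)).

Section OneSubmodule.
Context (U : set W) (hU : submodule (@mY R V W) U).

(** Induction on the number of components: L_0 - a removes the one at a and multiplies the one at b
    by b - a, which is divided out. The component at a is the remainder. *)
Lemma submodule_comp (w : W) s : U w -> U (comp w s).
Proof.
suff key (l : seq R) : forall w s, uniq l -> U w ->
    (forall a, a \notin l -> comp w a = 0) -> U (comp w s).
  by move=> Uw; apply: (key (gsupp (@mgr R V W) w)) => //; [exact: gsupp_uniq|exact: gsuppP ds _].
elim: l => [|a l IH] {s}w s; first by move=> _ _ -> //; case: hU.1.
move=> /= /andP[al ul] Uw wl.
pose w' := Ln 0 w - a%:C%C *: w.
have Uw' : U w' by apply: (subspaceB hU.1); [exact: hU.2|exact: (subspaceZ _ hU.1)].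
have w'E b : comp w' b = (b - a)%:C%C *: comp w b.
  by rewrite /w' (compD ds) (compN ds) (compZ ds) (comp_L0 hW) -scalerBl rmorphB.
have Ul b : b != a -> U (comp w b).
  move=> ba; have -> : comp w b = ((b - a)%:C%C)^-1 *: comp w' b.
    rewrite w'E scalerA mulVf ?scale1r // eq_complex /= eqxx andbT subr_eq0.
    by [].
  apply: (subspaceZ _ hU.1); apply: IH => // d dl; rewrite w'E.
  have [->|da] := eqVneq d a; first by rewrite subrr scale0r.
  by rewrite wl ?scaler0 // inE negb_or da.
have [->|sa] := eqVneq s a; last exact: Ul.
have -> : comp w a = w - \sum_(b <- l) comp w b.
  by rewrite {2}(@comp_sumE _ _ _ _ ds w (a :: l)) //= ?al // big_cons addrK.
apply: (subspaceB hU.1) => //; apply: (subspace_sum hU.1) => b bl_.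
by apply: Ul; apply: contraNneq al => <-.
Qed.

Definition sub_mode (v : V) (n : int) (u : sub_lmodule hU.1) : sub_lmodule hU.1 :=
  sub_mk hU.1 (hU.2 v n _ (sub_valP u)).

Lemma sub_weak_module : weak_module sub_mode.
Proof.
split.
- split=> [n b a u v|a n c u v]; apply: sub_val_inj; rewrite sub_val_linear /=.
    exact: bl.1.
  exact: bl.2.
- move=> v b; have [N hN] := weak_truncated (vmod_weak hW) v (sub_val b).
  by exists N => n Nn; apply: sub_val_inj; rewrite sub_val0; exact: hN.
- move=> n w; apply: sub_val_inj => /=.
  have [_ _ h _ _] := vmod_weak hW; rewrite h.
  by case: eqP => // _; rewrite sub_val0.
- move=> u a b m n s; apply: sub_val_inj.
  rewrite sub_valB !sub_val_fsum.
  under eq_fsbigr do rewrite sub_valZ /=.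
  under [in RHS]eq_fsbigr do rewrite sub_valZ /=.
  under [X in _ = _ - X]eq_fsbigr do rewrite sub_valZ /=.
  exact: weak_jacobi (vmod_weak hW) u a (sub_val b) m n s.
- move=> v n w; apply: sub_val_inj => /=.
  exact: weak_translation (vmod_weak hW) _ _ _.
Qed.

Definition sub_vmod : vmod_data V := {|
  vmod_sort := sub_lmodule hU.1;
  mgr := fun s => [set u | mgr s (sub_val u)];
  mY := sub_mode |}.

Lemma sub_direct_sum : direct_sum (fun s => [set u : sub_lmodule hU.1 | mgr s (sub_val u)]).
Proof.
split=> [s|w].
  split=> [|a u v us vs] /=; first exact: gr0 ds s.
  exact: grL ds _ _ _ _ us vs.
pose c s := sub_mk hU.1 (submodule_comp s (sub_valP w)).
have c0 s : s \notin gsupp (@mgr R V W) (sub_val w) -> c s = 0.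
  by move=> sw; apply: sub_val_inj; rewrite sub_val0 /= (gsuppP ds sw).
exists c; split.
  split; [by move=> s; exact: comp_gr ds _ _|exact: seq_supp c0|].
  apply: sub_val_inj; rewrite sub_val_fsum (fsumE (gsupp_uniq (@mgr R V W) (sub_val w))).
    exact: comp_sum ds _.
  by move=> s /c0 ->; exact: sub_val0.
move=> c' [c'g c'f c'w]; apply/funext => s; apply: sub_val_inj => /=.
rewrite c'w sub_val_fsum; have [l [ul hl]] := supp_seq c'f.
rewrite (fsumE ul); last by move=> i /hl ->; exact: sub_val0.
rewrite (comp_bigsum ds); have [sl|sl] := boolP (s \in l).
  rewrite (bigD1_seq s) //= (comp_id ds (c'g s)) big1 ?addr0 // => t ts.
  by apply: (comp_neq ds (c'g t)); rewrite eq_sym.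
rewrite (hl _ sl) sub_val0 big1_seq // => t /andP[_ tl].
by apply: (comp_neq ds (c'g t)); apply: contraNneq sl => ->.
Qed.

Lemma sub_vmod_is_vmodule : is_vmodule sub_vmod.
Proof.
split; [exact: sub_weak_module|exact: sub_direct_sum| | |].
- move=> s; have [||n [e [he hs]]] := @finite_dim_basis _ _ (U `&` @mgr R V W s).
  + split; first by split; [case: hU.1|exact: gr0 ds s].
    move=> a u v [Uu us] [Uv vs]; split; last exact: grL ds _ _ _ _ us vs.
    by case: hU.1 => _; exact.
  + have [n [e he]] := vmod_fd hW s; exists n, e => w [_ /he]; exact.
  exists n, (fun i => sub_mk hU.1 (he i).1) => w /= ws.
  have [c wE] := hs _ (conj (sub_valP w) ws).
  exists c; apply: sub_val_inj; rewrite sub_val_sum wE; apply: eq_bigr => i _.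
  by rewrite sub_valZ.
- have [N hN] := vmod_bounded hW; exists N => s sN w /= ws.
  by apply: sub_val_inj; rewrite sub_val0; exact: hN ws sN.
move=> s w ws; apply: sub_val_inj.
rewrite sub_valZ.
have ws' : mgr s (sub_val w) by exact: ws.
exact: (vmod_L0 hW ws').
Qed.

Lemma sub_irreducible : irreducible_submodule (@mY R V W) U -> irreducible_module sub_vmod.
Proof.
move=> [_ Un0 Uirr]; split.
- by split=> //; split.
- move=> h; apply: Un0 => w Uw; have /= := h (sub_mk hU.1 Uw) I.
  by move=> /(congr1 (@sub_val _ _ _ _)); rewrite sub_val0.
move=> U' [[U'0 U'L] U'm] _.
have subU' : submodule (@mY R V W) [set w | exists2 u, U' u & sub_val u = w].
  split; first split.
  - by exists 0 => //; exact: sub_val0.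
  - move=> a _ _ [u Uu <-] [v Uv <-]; exists (a *: u + v); first exact: U'L.
    exact: sub_val_linear.
  - by move=> v n _ [u Uu <-]; exists (sub_mode v n u) => //; exact: U'm.
have [|h|h] := Uirr _ subU'.
- by move=> _ [u _ <-]; exact: sub_valP.
- left=> u Uu; apply: sub_val_inj; rewrite sub_val0.
  by apply: h; exists u.
right; apply/seteqP; split=> // u _.
have := sub_valP u; move/(congr1 (@^~ (sub_val u))): h => /= <-.
by move=> [u' U'u' /sub_val_inj <-].
Qed.

End OneSubmodule.
End Submodules.

(** * The weak module of families indexed by the weight classes *)

Section LowWeights.
Context (R : realType) (V : voa R) (W : vmod_data V) (hW : is_vmodule W).
Local Notation comp := (component (@mgr R V W)).
Local Notation ds := (vmod_ds hW).
Local Notation bl := (weak_bilinear (vmod_weak hW)).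
Local Notation hV := (voa_module_axioms V).

(* [d] is the smallest weight in its class modulo Z. *)
Definition low (d : R) : Prop :=
  (exists2 w : W, mgr d w & w != 0) /\
  forall (k : nat) (w : W), mgr (d - k.+1%:R) w -> w = 0.

Lemma low_below s (w : W) : mgr s w -> w != 0 -> exists d (k : nat), low d /\ s = d + k%:R.
Proof.
move=> ws w0; have [N hN] := vmod_bounded hW.
pose P k := `[< exists2 w : W, mgr (s - k%:R) w & w != 0 >].
have exP : exists k, P k by exists 0%N; apply/asboolP; exists w; rewrite ?subr0.
have [m hm] : exists m : nat, s - N < m%:R.
  by exists (Num.bound `|s - N|); apply: le_lt_trans (ler_norm _) _; apply: archi_boundP.
have ubP k : P k -> (k <= m)%N.
  move=> /asboolP[u us u0]; rewrite leqNgt; apply/negP => mk.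
  move: u0; rewrite (hN _ _ us) ?eqxx //.
  have : m%:R < k%:R :> R by rewrite ltr_nat.
  by move=> h; lra.
case: (ex_maxnP exP ubP) => k /asboolP Pk kmax.
exists (s - k%:R), k; split; last by rewrite subrK.
split=> // j u uj; apply/eqP/negPn/negP => u0.
have : P (k + j.+1)%N by apply/asboolP; exists u => //; rewrite natrD opprD addrA.
by move=> /kmax; lia.
Qed.

Lemma low_integral d d' (k k' : nat) : low d -> low d' -> d + k%:R = d' + k'%:R -> d = d'.
Proof.
wlog kk' : d d' k k' / (k' <= k)%N.
  move=> wl hd hd' e; case/orP: (leq_total k' k) => h; first exact: wl e.
  by apply/esym; apply: wl h hd' hd (esym e).
move=> [[w wd w0] _] [_ low'] e.
have dE : d = d' - (k - k')%:R by rewrite natrB //; lra.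
case: (k - k')%N dE => [|j] dE; first by rewrite dE subr0.
by rewrite dE in wd; rewrite (low' _ _ wd) eqxx in w0.
Qed.

Definition degree_lt (d : R) (N : nat) (w : W) : Prop :=
  forall s, comp w s != 0 -> exists2 k : nat, (k < N)%N & s = d + k%:R.

Lemma comp_mode v n (w : W) s : comp (mY v n w) s =
  \sum_(e <- gsupp (@voa_gr R V) v)
    mY (component (@voa_gr R V) v e) n (comp w (s - (e - n - 1)%:~R)).
Proof.
rewrite {1}(comp_sum (voa_direct_sum V) v) (modes_suml bl) (comp_bigsum ds).
apply: eq_bigr => e _; set u := component _ v e.
have ue : voa_gr e u by exact: comp_gr (voa_direct_sum V) _ _.
rewrite {1}(comp_sum ds w) (modes_sumr bl) (comp_bigsum ds).
have sh a : mgr (a + (e - n - 1)%:~R) (mY u n (comp w a)).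
  rewrite (_ : a + _ = a + e%:~R - n%:~R - 1); last by rewrite !intrB; ring.
  exact: mode_shift hW _ _ _ _ _ ue (comp_gr ds w a).
set t := s - _.
have [tw|tw] := boolP (t \in gsupp (@mgr R V W) w).
  rewrite (bigD1_seq t) ?gsupp_uniq //= big1 ?addr0 => [|a at_].
    by rewrite (comp_hom ds (sh t)) /t subrK eqxx.
  apply: (comp_neq ds (sh a)); apply: contraNneq at_ => sE.
  by rewrite /t sE addrK.
rewrite (gsuppP ds tw) (modes0r bl) big1_seq // => a /andP[_ aw].
apply: (comp_neq ds (sh a)); apply: contraNneq tw => sE.
by rewrite /t sE addrK.
Qed.

(** Minimality of d makes j a natural number: a component of negative degree would have a weight of
    the same class below d. *)
Lemma degree_mode d N v n (w : W) s : low d -> degree_lt d N w ->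
  comp (mY v n w) s != 0 -> exists e (k j : nat),
    [/\ e \in gsupp (@voa_gr R V) v, (k < N)%N, s = d + j%:R & j%:Z = k%:Z + e - n - 1].
Proof.
move=> [_ lowd] wN; rewrite comp_mode => h.
have [e ev en0] : exists2 e, e \in gsupp (@voa_gr R V) v &
    mY (component (@voa_gr R V) v e) n (comp w (s - (e - n - 1)%:~R)) != 0.
  apply: contrapT => hn; move/eqP: h; apply; rewrite big1_seq // => e /andP[_ ev].
  by apply: contrapT => /eqP ne; apply: hn; exists e.
have [k kN sE] : exists2 k : nat, (k < N)%N & s - (e - n - 1)%:~R = d + k%:R.
  by apply: wN; apply: contraNneq en0 => ->; rewrite (modes0r bl).
have ue := comp_gr (voa_direct_sum V) v e.
have := mode_shift hW n ue (comp_gr ds w (s - (e - n - 1)%:~R)).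
have -> : s - (e - n - 1)%:~R + e%:~R - n%:~R - 1 = d + (k%:Z + e - n - 1)%:~R.
  by rewrite sE !intrB !intrD /=; ring.
have sE' : s = d + (k%:Z + e - n - 1)%:~R.
  by move/eqP: sE; rewrite subr_eq => /eqP ->; rewrite !intrB !intrD /=; ring.
case jE : (k%:Z + e - n - 1) => [j|j] hj.
  by exists e, k, j; split; rewrite // sE' jE.
move: hj; rewrite NegzE mulrNz => /lowd e0.
by rewrite e0 eqxx in en0.
Qed.

Lemma degree_bound v : exists E : nat, forall e, e \in gsupp (@voa_gr R V) v -> e <= E%:Z.
Proof.
elim: (gsupp _ _) => [|e l [E hE]]; first by exists 0%N.
exists (E + `|e|)%N => e'; rewrite inE => /predU1P[->|/hE]; lia.
Qed.

Lemma degree_ext0 (w : W) : (forall s, comp w s = 0) -> w = 0.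
Proof. by move=> h; apply: (comp_ext ds) => s; rewrite h (comp0 ds). Qed.

(* The vectors are families indexed by the minimal weights d of the classes of
   weights modulo Z, of uniformly bounded degree above d: the direct product
   over the classes, cut down so as to be N-gradable. *)
Definition bounded_family : set (R -> W) :=
  [set phi | (forall d, ~ low d -> phi d = 0) /\
     exists N : nat, forall d, degree_lt d N (phi d)].

Lemma bounded_family_subspace : subspace bounded_family.
Proof.
split.
  by split=> //; exists 0%N => d s; rewrite (comp0 ds) eqxx.
move=> a f g [f0 [N fN]] [g0 [N' gN']]; split.
  by move=> d dl; rewrite !fctE f0 // g0 // scaler0 addr0.
exists (maxn N N') => d s; rewrite !fctE (comp_linear ds) => h.
have [/eqP e|/fN[k kN sE]] := boolP (comp (f d) s == 0); last first.
  by exists k => //; rewrite (leq_trans kN) ?leq_maxl.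
move: h; rewrite e scaler0 add0r => /gN'[k kN sE].
by exists k => //; rewrite (leq_trans kN) ?leq_maxr.
Qed.
Local Notation W' := (sub_lmodule bounded_family_subspace).

Lemma bounded_family_mode v n (phi : W') : bounded_family (fun d => mY v n (sub_val phi d)).
Proof.
have [phi0 [N phiN]] := sub_valP phi.
split=> [d /phi0 ->|]; first by rewrite (modes0r bl).
have [E hE] := degree_bound v; exists (N + E + `|n|).+1%N => d s h.
have [dl|dl] := pselect (low d); last first.
  by rewrite phi0 // (modes0r bl) (comp0 ds) eqxx in h.
have [e [k [j [/hE ev kN sE jE]]]] := degree_mode dl (phiN d) h.
by exists j => //; lia.
Qed.

Definition family_mode v n (phi : W') : W' :=
  sub_mk bounded_family_subspace (bounded_family_mode v n phi).

(** The bound N + E is the same for all d; this is the purpose of the uniform degree in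
    [bounded_family]. *)
Lemma family_truncated : lower_truncated family_mode.
Proof.
move=> v phi; have [phi0 [N phiN]] := sub_valP phi.
have [E hE] := degree_bound v; exists (N + E)%N%:Z => n nN.
apply: sub_val_inj; rewrite sub_val0; apply/funext => d /=.
have [dl|dl] := pselect (low d); last by rewrite phi0 // (modes0r bl).
apply: degree_ext0 => s; apply/eqP/negPn/negP => h.
have [e [k [j [/hE ev kN sE jE]]]] := degree_mode dl (phiN d) h.
by lia.
Qed.

(** Evaluation at d can shrink an infinite support to a finite one, and then the left side would be
    0 by convention; hence the hypothesis. *)
Lemma sub_val_eval (I : choiceType) (F : I -> W') d : finite_set [set i | F i != 0] ->
  sub_val (\sum_(i \in [set: I]) F i) d = \sum_(i \in [set: I]) sub_val (F i) d.
Proof.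
move=> /supp_seq[s [us F0]]; rewrite !(fsumE us) // => [|i /F0 ->]; last first.
  by rewrite sub_val0.
rewrite sub_val_sum; elim: s {us F0} => [|i s IH]; first by rewrite !big_nil.
by rewrite !big_cons fctE IH.
Qed.

Lemma supp_nat (U : nmodType) (F : nat -> U) (n : nat) :
  (forall i, (n <= i)%N -> F i = 0) -> finite_set [set i | F i != 0].
Proof.
move=> F0; apply: (seq_supp (s := iota 0 n)) => i.
by rewrite mem_iota /= add0n -leqNgt => /F0.
Qed.

Lemma family_weak_module : weak_module family_mode.
Proof.
split.
- split=> [n b a u v|a n c u v]; apply: sub_val_inj; rewrite sub_val_linear; apply/funext => d.
    exact: bl.1.
  exact: bl.2.
- exact: family_truncated.
- move=> n w; apply: sub_val_inj; apply/funext => d /=.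
  have [_ _ h _ _] := vmod_weak hW; rewrite h.
  by case: eqP => // _; rewrite sub_val0.
- move=> u a phi m n s; apply: sub_val_inj; apply/funext => d.
  have [L1 hL1] := weak_truncated hV u a.
  have [L2 hL2] := family_truncated a phi.
  have [L3 hL3] := family_truncated u phi.
  have mode0 v k : family_mode v k 0 = 0.
    by apply: sub_val_inj; rewrite sub_val0; apply/funext => d'; exact: modes0r bl _ _.
  rewrite sub_valB; transitivity (sub_val (\sum_(l \in [set: nat])
       ((-1) ^+ l * gbinom R n l) *: family_mode u (m + n - l%:Z) (family_mode a (s + l%:R) phi)) d
    - sub_val (\sum_(l \in [set: nat]) ((-1) ^ (l%:Z + n) * gbinom R n l) *:
         family_mode a (n%:~R + s - l%:R) (family_mode u (m + l%:Z) phi)) d); last by [].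
  (* Jacobi holds at each d separately, but the sums in W' must be finite uniformly in d before they
     are evaluated: the three side goals get this from L3, L2 and L1. *)
  rewrite !sub_val_eval.
  + have jac := weak_jacobi (vmod_weak hW) u a (sub_val phi d) m n s.
    have zE (c : R[i]) (x : W') : sub_val (c *: x) d = c *: sub_val x d by rewrite sub_valZ.
    under eq_fsbigr do rewrite zE /=.
    under [in RHS]eq_fsbigr do rewrite zE /=.
    under [X in _ = _ - X]eq_fsbigr do rewrite zE /=.
    exact: jac.
  + apply: (@supp_nat _ _ `|L3 - m|%N) => l hl; rewrite hL3 ?mode0 ?scaler0 //; lia.
  + apply: (@supp_nat _ _ `|L2 - s|%N) => l hl; rewrite hL2 ?mode0 ?scaler0 //.
    by rewrite natz; lia.
  apply: (@supp_nat _ _ `|L1 - n|%N) => l hl; rewrite hL1; last lia.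
  rewrite (_ : family_mode 0 _ phi = 0) ?scaler0 //.
  by apply: sub_val_inj; rewrite sub_val0; apply/funext => d'; exact: modes0l bl _ _.
move=> v n phi; apply: sub_val_inj; apply/funext => d.
exact: weak_translation (vmod_weak hW) _ _ _.
Qed.

End LowWeights.

Section FiniteClasses.
Context (R : realType) (V : voa R) (W : vmod_data V) (hW : is_vmodule W).
Local Notation comp := (component (@mgr R V W)).
Local Notation ds := (vmod_ds hW).
Local Notation bl := (weak_bilinear (vmod_weak hW)).
Local Notation W' := (sub_lmodule (bounded_family_subspace hW)).
Local Notation low := (@low R V W).
Local Notation Y' := (family_mode (hW := hW)).

(** A family has degree n when its value at each d has weight d + n. Negative degrees vanish by
    minimality of d, and the uniform bound makes decompositions finite. *)
Lemma family_N_gradable : N_gradable (V := V) Y'.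
Proof.
pose gr (n : nat) : set W' := [set phi | forall d, mgr (d + n%:R) (sub_val phi d)].
exists gr; split; first split=> [n|phi].
- split=> [d|a u v un vn d]; first exact: gr0 ds _.
  by rewrite sub_val_linear; exact: grL ds _ _ _ _ (un d) (vn d).
- have [phi0 [N phiN]] := sub_valP phi.
  have cP n : bounded_family (fun d => comp (sub_val phi d) (d + n%:R)).
    split=> [d /phi0 ->|]; first by rewrite (comp0 ds).
    exists n.+1 => d s; rewrite (comp_hom ds (comp_gr ds _ _)).
    by case: (eqVneq s (d + n%:R)) => [-> _|_]; [exists n|rewrite eqxx].
  pose c n : W' := sub_mk (bounded_family_subspace hW) (cP n).
  have c0 n : (N <= n)%N -> c n = 0.
    move=> Nn; apply: sub_val_inj; rewrite sub_val0; apply/funext => d /=.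
    apply/eqP/negPn/negP => /phiN[k kN /addrI/eqP].
    by rewrite eqr_nat => /eqP kn; move: kN; rewrite -kn ltnNge Nn.
  exists c; split.
    split; [by move=> n d; exact: comp_gr ds _ _|exact: supp_nat c0|].
    apply: sub_val_inj; apply/funext => d.
    rewrite sub_val_eval; last exact: supp_nat c0.
    rewrite (@fsum_nat _ N); last by move=> i /c0 ->; rewrite sub_val0.
    apply: (comp_ext ds) => s; rewrite (comp_bigsum ds).
    under eq_bigr do rewrite (comp_hom ds (comp_gr ds _ _)).
    have [/eqP e|/phiN[k kN sE]] := boolP (comp (sub_val phi d) s == 0).
      by rewrite e big1 // => i _; case: eqP => // <-.
    rewrite (bigD1 (Ordinal kN)) //= sE eqxx big1 ?addr0 // => i ik.
    case: eqP => // /addrI/eqP; rewrite eqr_nat => /eqP ki.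
    by case/eqP: ik; apply: val_inj; rewrite /= ki.
  move=> c' [c'g c'f c'w]; apply/funext => n; apply: sub_val_inj; apply/funext => d /=.
  rewrite c'w sub_val_eval //; have [l [ul hl]] := supp_seq c'f.
  rewrite (fsumE ul); last by move=> i /hl ->; rewrite sub_val0.
  rewrite (comp_bigsum ds).
  have cn i : i != n -> comp (sub_val (c' i) d) (d + n%:R) = 0.
    move=> i_n; apply: (comp_neq ds (c'g i d)); apply: contraNneq i_n => /addrI/eqP.
    by rewrite eqr_nat => /eqP ->.
  have [nl|nl] := boolP (n \in l).
    by rewrite (bigD1_seq n) //= (comp_id ds (c'g n d)) big1 ?addr0.
  rewrite (hl _ nl) sub_val0 big1_seq // => i /andP[_ il].
  by apply: cn; apply: contraNneq nl => <-.
move=> e m n v phi ve phin.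
have sh d : mgr (d + (n%:Z + e - m - 1)%:~R) (sub_val (Y' v m phi) d).
  rewrite (_ : d + _ = d + n%:R + e%:~R - m%:~R - 1).
    exact: mode_shift hW _ _ _ _ _ ve (phin d).
  by rewrite !intrB intrD /=; ring.
case kE : (n%:Z + e - m - 1) => [k|k]; first by move=> d; have := sh d; rewrite kE.
apply: sub_val_inj; rewrite sub_val0; apply/funext => d.
have [[_ dl]|dl] := pselect (low d).
  by apply: (dl k); have := sh d; rewrite kE NegzE mulrNz.
have [phi0 _] := sub_valP phi.
by rewrite /= phi0 // (modes0r bl).
Qed.

Section Irreducibles.
Hypothesis hrat : forall (M : lmodType R[i]) (Y : V -> int -> M -> M),
  weak_module Y -> N_gradable Y -> completely_reducible Y.

(** The families of U that vanish at d form a submodule, hence are 0 or all of U, and phi0 excludes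
    the latter. *)
Lemma irreducible_eval_inj (U : set W') d : irreducible_submodule Y' U ->
  (exists2 phi, U phi & sub_val phi d != 0) ->
  forall phi, U phi -> sub_val phi d = 0 -> phi = 0.
Proof.
move=> [[[U0 UL] Um] Un0 Uirr] [phi0 Uphi0 phi0d] phi Uphi phid.
pose K : set W' := [set psi | U psi /\ sub_val psi d = 0].
have sK : submodule Y' K.
  split; first split.
  - by split=> //; rewrite sub_val0.
  - move=> a u v [Uu ud] [Uv vd]; split; first exact: UL.
    by rewrite sub_val_linear !fctE ud vd scaler0 addr0.
  - by move=> v n w [Uw wd]; split; [exact: Um|rewrite /= wd (modes0r bl)].
have [|h|h] := Uirr K sK; first by move=> ? [].
  exact: (h _ (conj Uphi phid)).
by move: Uphi0; rewrite -h => -[_ e]; rewrite e eqxx in phi0d.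
Qed.

(* A product of factors L_0 - (d + k) kills the component of phi at d, hence phi,
   because evaluation at d is injective on U; so the weights of phi at d' lie in d + N. *)
Lemma irreducible_one_class (U : set W') d d' phi : irreducible_submodule Y' U ->
  low d -> low d' -> U phi -> sub_val phi d != 0 -> sub_val phi d' != 0 -> d = d'.
Proof.
move=> Uirr ld ld' Uphi phid phid'.
have [[[U0 UL] Um] _ _] := Uirr.
have [_ [N phiN]] := sub_valP phi.
pose D k (psi : W') : W' := Y' (conformal V) (0 + 1) psi - (d + k%:R)%:C%C *: psi.
pose P n := iteri n D phi.
have PU n : U (P n).
  elim: n => [//|n IH]; rewrite /P /= -/(P n) /D addrC -scaleNr.
  by apply: UL => //; exact: Um.
have Pc n b s : comp (sub_val (P n) b) s =
    (\prod_(k < n) (s - (d + k%:R)))%:C%C *: comp (sub_val phi b) s.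
  elim: n => [|n IH]; first by rewrite big_ord0 scale1r.
  rewrite (_ : P n.+1 = D n (P n)) // /D sub_valB sub_valZ.
  rewrite -[(_ - _) b]/(mY (conformal V) (0 + 1) (sub_val (P n) b) - (d + n%:R)%:C%C *: sub_val (P n) b).
  rewrite (compD ds) (compN ds) (compZ ds).
  rewrite -[mY _ _ _]/(Ln 0 (sub_val (P n) b)) (comp_L0 hW) IH -scalerBl -rmorphB /=.
  by rewrite scalerA -rmorphM /= big_ord_recr /= mulrC.
have PN : P N = 0.
  apply: (irreducible_eval_inj Uirr (d := d)); [by exists phi|exact: PU|].
  apply: (degree_ext0 hW) => s; rewrite Pc.
  have [/eqP ->|/phiN[k kN sE]] := boolP (comp (sub_val phi d) s == 0).
    by rewrite scaler0.
  by rewrite (bigD1 (Ordinal kN)) //= sE subrr mul0r scale0r.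
have [s hs] : exists s, comp (sub_val phi d') s != 0.
  apply: contrapT => h; move/eqP: phid'; apply.
  apply: (degree_ext0 hW) => s; apply: contrapT => /eqP hs; apply: h; by exists s.
have [k' _ sE] := phiN _ _ hs.
have := Pc N d' s; rewrite PN sub_val0 (comp0 ds) => /esym/eqP.
rewrite scaler_eq0 (negPf hs) orbF eq_complex /= eqxx andbT => /eqP pr0.
have [k _ /eqP] : exists2 k : 'I_N, true & s - (d + k%:R) == 0.
  apply: contrapT => h; move/eqP: pr0; apply/negP; apply/prodf_neq0 => k _.
  by apply/negP => hk; apply: h; exists k.
move=> /eqP; rewrite subr_eq0 => /eqP sE2.
by apply: (low_integral (k := k) (k' := k') ld ld'); rewrite -sE2 sE.
Qed.

(** For the second half: evaluation at d commutes with the modes, so it maps a summand that is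
    nonzero at d onto an irreducible submodule of W, and the degree bound places its weights in d +
    N. *)
Lemma low_submodules : finite_set [set d | low d] /\
  forall d, low d -> exists U : set W,
    irreducible_submodule (@mY R V W) U /\ forall u, U u -> exists N, degree_lt d N u.
Proof.
have /choice[x0 hx0] : forall d, exists w : W, mgr d w /\ (low d -> w != 0) /\ (~ low d -> w = 0).
  move=> d; have [ld|ld] := pselect (low d).
    by have [[w wd w0] _] := ld; exists w.
  by exists 0; split; [exact: gr0 ds d|].
have bx : bounded_family x0.
  split=> [d|]; first by case: (hx0 d) => _ [_]; exact.
  exists 1%N => d s; have [wd _] := hx0 d; rewrite (comp_hom ds wd).
  by case: (eqVneq s d) => [-> _|_]; [exists 0%N; rewrite ?addr0|rewrite eqxx].
pose x := sub_mk (bounded_family_subspace hW) bx.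
have [I [U [dU Uirr]]] := hrat (family_weak_module hW) family_N_gradable.
have [c [[cU cf xE] _]] := dU.2 x.
have [l [ul hl]] := supp_seq cf.
have hex d : low d -> exists2 i, i \in l & sub_val (c i) d != 0.
  move=> ld; apply: contrapT => hn.
  have := (hx0 d).2.1 ld; have -> : x0 d = sub_val x d by [].
  rewrite xE sub_val_eval // (fsumE ul); last by move=> i /hl ->; rewrite sub_val0.
  rewrite big1_seq ?eqxx // => i /andP[_ il].
  by apply: contrapT => /eqP h; apply: hn; exists i.
split.
  apply: (@sub_finite_set _ _ (\bigcup_(i in [set` l]) [set d | low d /\ sub_val (c i) d != 0])).
    by move=> d ld; have [i il h] := hex d ld; exists i.
  apply: bigcup_finite; first exact: finite_seq.
  move=> i _.
  have [[d [ld hd]]|h] := pselect (exists d, low d /\ sub_val (c i) d != 0).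
    apply: (@sub_finite_set _ _ [set d]) => // d' [ld' hd'].
    by apply/esym; exact: (irreducible_one_class (Uirr i) ld ld' (cU i) hd hd').
  rewrite (_ : [set _ | _] = set0) //; apply/seteqP; split=> // d hd.
  by apply: h; exists d.
move=> d ld; have [i _ hd] := hex d ld.
exists [set w | exists2 phi, U i phi & sub_val phi d = w].
have [[[U0 UL] Um] _ Ui] := Uirr i.
split; last by move=> _ [phi _ <-]; have [_ [N h]] := sub_valP phi; exists N.
split.
- split; first split.
  + by exists 0 => //; rewrite sub_val0.
  + move=> a _ _ [u Uu <-] [v Uv <-]; exists (a *: u + v); first exact: UL.
    by rewrite sub_val_linear.
  + by move=> v n _ [u Uu <-]; exists (Y' v n u) => //; exact: Um.
- by move=> h; move/eqP: hd; apply; apply: h; exists (c i).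
move=> U2 [[U20 U2L] U2m] U2sub.
pose K : set W' := [set psi | U i psi /\ U2 (sub_val psi d)].
have sK : submodule Y' K.
  split; first split.
  - by split=> //; rewrite sub_val0.
  - move=> a u v [Uu ud] [Uv vd]; split; first exact: UL.
    by rewrite sub_val_linear !fctE; exact: U2L.
  - by move=> v n w [Uw wd]; split; [exact: Um|exact: U2m].
have [|h|h] := Ui K sK; first by move=> ? [].
  left=> w U2w; have [phi Uphi phiw] := U2sub _ U2w.
  rewrite -phiw in U2w.
  by rewrite -phiw (h _ (conj Uphi U2w)) sub_val0.
right; apply/seteqP; split=> // w [phi + <-]; rewrite -h; by case.
Qed.

(** The lowest weight is d + k for the least k such that U has a vector of weight d + k; only its
    class modulo Z matters for [Z_]. *)
Lemma low_lowest_weight d : low d -> exists (M : vmodule V) (D : R) (k : nat),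
  [/\ irreducible_module M, lowest_weight M D & D = d + k%:R].
Proof.
move=> ld; have [_ /(_ d ld)[U [Uirr Udeg]]] := low_submodules.
have sU : submodule (@mY R V W) U by case: Uirr.
pose M := Vmodule (sub_vmod_is_vmodule hW sU).
pose P k := `[< exists2 w : W, U w & mgr (d + k%:R) w /\ w != 0 >].
have [u Uu u0] : exists2 u, U u & u != 0.
  have [_ hn _] := Uirr; apply: contrapT => h; apply: hn => w Uw /=.
  by apply: contrapT => /eqP w0; apply: h; exists w.
have exP : exists k, P k.
  have [s hs] : exists s, comp u s != 0.
    apply: contrapT => h; move/eqP: u0; apply.
    apply: (degree_ext0 hW) => s; apply: contrapT => /eqP hs; apply: h; by exists s.
  have [N hN] := Udeg _ Uu; have [k _ sE] := hN _ hs.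
  exists k; apply/asboolP; exists (comp u s); first exact: (submodule_comp hW sU s Uu).
  by split=> //; rewrite -sE; exact: comp_gr ds _ _.
case: (ex_minnP exP) => k /asboolP[w Uw [wk w0]] kmin.
exists M, (d + k%:R), k; split=> //; first exact (sub_irreducible sU Uirr).
split.
  move=> /(_ (sub_mk sU.1 Uw) wk) /= h; move/eqP: w0; apply.
  by have := congr1 (@sub_val _ _ _ _) h; rewrite sub_val0.
move=> s sk v /= vs; apply: sub_val_inj; rewrite sub_val0; apply/eqP/negPn/negP => v0.
have Uv : U (sub_val v) by exact: sub_valP.
have [N hN] := Udeg _ Uv; have [|j _ sE] := hN s; first by rewrite (comp_id ds vs).
have : P j by apply/asboolP; exists (sub_val v) => //; rewrite -sE.
by move=> /kmin kj; move: sk; rewrite sE ltrD2l ltr_nat ltnNge kj.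
Qed.

End Irreducibles.
End FiniteClasses.

(** * Fourier coefficients *)

Section RealOscillatory.
Context (R : realType).
Implicit Types (F G : R -> R) (s t : R).
Local Notation mu := (@lebesgue_measure R).

Lemma smooth_derive F : smooth F -> smooth (derive1 F).
Proof. by move=> sF n x; rewrite /derive1n -iterSr; exact: sF n.+1 x. Qed.

Lemma smooth_derivable F x : smooth F -> derivable F x 1.
Proof. by move=> /(_ 0%N). Qed.

Lemma smooth_continuous F : smooth F -> continuous F.
Proof.
by move=> sF x; exact/differentiable_continuous/derivable1_diffP/smooth_derivable.
Qed.

Lemma derivable_LRcontinuous F (a b : R) : (forall x, derivable F x 1) ->
  derivable_oo_LRcontinuous F a b.
Proof.
move=> dF; have cF x : F @ x --> F x.
  exact/differentiable_continuous/derivable1_diffP.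
split=> //.
  exact: cvg_at_right_filter (cF a).
exact: cvg_at_left_filter (cF b).
Qed.

Lemma continuous_integrable F (a b : R) : continuous F ->
  mu.-integrable `[a, b] (EFin \o F).
Proof.
move=> cF; apply: continuous_compact_integrable; first exact: segment_compact.
exact: continuous_subspaceT.
Qed.

Lemma is_derive_sin_scaled s x : is_derive x (1 : R) (fun t => sin (s * t)) (s * cos (s * x)).
Proof.
have h : is_derive x (1 : R) (fun t : R => s * t) s.
  by rewrite -[X in is_derive _ _ _ X]mulr1; exact: is_deriveZ.
have := @is_derive1_comp _ (@sin R) (fun t => s * t) x _ _ (is_derive_sin (s * x)) h.
by rewrite mulrC.
Qed.

Lemma is_derive_cos_scaled s x : is_derive x (1 : R) (fun t => cos (s * t)) (- (s * sin (s * x))).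
Proof.
have h : is_derive x (1 : R) (fun t : R => s * t) s.
  by rewrite -[X in is_derive _ _ _ X]mulr1; exact: is_deriveZ.
have := @is_derive1_comp _ (@cos R) (fun t => s * t) x _ _ (is_derive_cos (s * x)) h.
by rewrite mulNr mulrC.
Qed.

Lemma continuous_sin_scaled s : continuous (fun t => sin (s * t)).
Proof.
move=> x; apply/differentiable_continuous/derivable1_diffP.
by have [] := is_derive_sin_scaled s x.
Qed.

Lemma continuous_cos_scaled s : continuous (fun t => cos (s * t)).
Proof.
move=> x; apply/differentiable_continuous/derivable1_diffP.
by have [] := is_derive_cos_scaled s x.
Qed.

Lemma continuous_mul F G : continuous F -> continuous G -> continuous (fun t => F t * G t).
Proof. by move=> cF cG x; apply: cvgM; [exact: cF|exact: cG]. Qed.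

Lemma continuous_add F G : continuous F -> continuous G -> continuous (fun t => F t + G t).
Proof. by move=> cF cG x; apply: cvgD; [exact: cF|exact: cG]. Qed.

Lemma continuous_opp F : continuous F -> continuous (fun t => - F t).
Proof. by move=> cF x; apply: cvgN; exact: cF. Qed.

Lemma continuous_mul_integrable F G (a b : R) : continuous F -> continuous G ->
  mu.-integrable `[a, b] (EFin \o (fun t => F t * G t)).
Proof. by move=> cF cG; apply: continuous_integrable; exact: continuous_mul. Qed.

(** Vanishing near both ends, and not merely at them, is inherited by derivatives, so every
    integration by parts is free of boundary terms. *)
Definition flat_ends F : Prop := smooth F /\
  exists2 e : R, 0 < e & forall t, `| `|t| - pi| < e -> F t = 0.

Lemma flat_ends_pi F : flat_ends F -> F pi = 0 /\ F (- pi) = 0.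
Proof.
move=> [_ [e e0 h]]; split; apply: h.
  by rewrite (ger0_norm (pi_ge0 R)) subrr normr0.
by rewrite normrN (ger0_norm (pi_ge0 R)) subrr normr0.
Qed.

Lemma flat_ends_derive F : flat_ends F -> flat_ends (derive1 F).
Proof.
move=> [sF [e e0 h]]; split; first exact: smooth_derive.
exists e => // t te.
have -> : (derive1 F) t = derive1 (cst 0 : R -> R) t.
  rewrite !derive1E; apply: near_eq_derive.
  apply/nbhs_ballP; exists (e - `| `|t| - pi|); first by rewrite /= subr_gt0.
  move=> u; rewrite -ball_normE /ball_ /= => hu; apply: h.
  have h1 := ler_distD (`|t|) (`|u|) (pi : R).
  have h2 := ler_dist_dist u t; rewrite distrC in hu; lra.
by rewrite derive1_cst.
Qed.

Lemma by_parts_cos F s : flat_ends F ->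
  \int[mu]_(t in `[- pi, pi]) (F t * (s * cos (s * t)))
  = - \int[mu]_(t in `[- pi, pi]) ((derive1 F) t * sin (s * t)).
Proof.
move=> fF; have [Fpi FNpi] := flat_ends_pi fF; have [sF _] := fF.
have pp : (- pi : R) < pi by have := pi_gt0 R; lra.
rewrite (@Rintegration_by_parts _ F (fun t => sin (s * t)) (derive1 F)) //.
- by rewrite Fpi FNpi !mul0r subrr sub0r.
- exact/continuous_subspaceT/smooth_continuous/smooth_derive.
- by apply: derivable_LRcontinuous => x; exact: smooth_derivable.
- apply/continuous_subspaceT => x; apply: continuous_mul => //.
    by move=> y; exact: cvg_cst.
  exact: continuous_cos_scaled.
- by apply: derivable_LRcontinuous => x; have [] := is_derive_sin_scaled s x.
- by move=> x _; rewrite derive1E; have [_ ->] := is_derive_sin_scaled s x.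
Qed.

Lemma by_parts_sin F s : flat_ends F ->
  \int[mu]_(t in `[- pi, pi]) (F t * (- (s * sin (s * t))))
  = - \int[mu]_(t in `[- pi, pi]) ((derive1 F) t * cos (s * t)).
Proof.
move=> fF; have [Fpi FNpi] := flat_ends_pi fF; have [sF _] := fF.
have pp : (- pi : R) < pi by have := pi_gt0 R; lra.
rewrite (@Rintegration_by_parts _ F (fun t => cos (s * t)) (derive1 F)) //.
- by rewrite Fpi FNpi !mul0r subrr sub0r.
- exact/continuous_subspaceT/smooth_continuous/smooth_derive.
- by apply: derivable_LRcontinuous => x; exact: smooth_derivable.
- apply/continuous_subspaceT => x; apply: continuous_opp; apply: continuous_mul => //.
    by move=> y; exact: cvg_cst.
  exact: continuous_sin_scaled.
- by apply: derivable_LRcontinuous => x; have [] := is_derive_cos_scaled s x.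
- by move=> x _; rewrite derive1E; have [_ ->] := is_derive_cos_scaled s x.
Qed.

End RealOscillatory.

Section FourierDecay.
Context (R : realType).
Implicit Types (F G : R -> R) (s t : R) (g h : R -> R[i]).
Local Notation mu := (@lebesgue_measure R).
Local Notation ci := (@cintegral R (- pi) pi).

(** Each integration by parts trades a factor s for a derivative and exchanges cos and sin, hence
    the joint statement. Multiplying by s rather than dividing keeps s = 0 in the argument. *)
Lemma integral_trig_decay F n : flat_ends F -> exists2 C, 0 <= C & forall s,
  `|s| ^+ n * `|\int[mu]_(t in `[- pi, pi]) (F t * cos (s * t))| <= C /\
  `|s| ^+ n * `|\int[mu]_(t in `[- pi, pi]) (F t * sin (s * t))| <= C.
Proof.
elim: n F => [|n IH] F fF.
  have cF := smooth_continuous fF.1.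
  exists (\int[mu]_(t in `[- pi, pi]) `|F t|); first exact: Rintegral_ge0.
  have cnF : continuous (fun t => `|F t|).
    by move=> x; apply: cvg_norm; exact: cF.
  move=> s; rewrite expr0 !mul1r.
  have bnd (T : R -> R) : continuous T -> (forall t, `|T t| <= 1) ->
      `|\int[mu]_(t in `[- pi, pi]) (F t * T t)| <= \int[mu]_(t in `[- pi, pi]) `|F t|.
    move=> cT T1; have cFT := continuous_mul cF cT.
    apply: le_trans (le_normr_Rintegral _ _) _ => //; first exact: continuous_integrable.
    apply: le_Rintegral => //.
    - apply: (@continuous_integrable _ (fun t => `|F t * T t|)).
      by move=> x; apply: cvg_norm; exact: cFT.
    - exact: continuous_integrable.
    by move=> x _; rewrite normrM ler_piMr.
  split; apply: bnd.
  - exact: continuous_cos_scaled.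
  - by move=> t; exact: cos_max.
  - exact: continuous_sin_scaled.
  - by move=> t; exact: sin_max.
have [C C0 hC] := IH _ (flat_ends_derive fF); exists C => // s.
have cF := smooth_continuous fF.1.
have [h1 h2] := hC s; split.
  apply: le_trans h2; rewrite exprSr -mulrA ler_wpM2l ?exprn_ge0 //.
  rewrite -normrM -RintegralZl //; last first.
    apply: continuous_integrable; apply: continuous_mul => //; exact: continuous_cos_scaled.
  under eq_Rintegral do rewrite mulrCA.
  by rewrite by_parts_cos // normrN.
apply: le_trans h1; rewrite exprSr -mulrA ler_wpM2l ?exprn_ge0 //.
rewrite -normrM -RintegralZl //; last first.
  apply: continuous_integrable; apply: continuous_mul => //; exact: continuous_sin_scaled.
under eq_Rintegral do rewrite mulrCA.
have := by_parts_sin s fF.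
rewrite (_ : \int[mu]_(t in _) (F t * _) = -1 * \int[mu]_(t in `[- pi, pi]) (F t * (s * sin (s * t)))).
  by rewrite mulN1r => /oppr_inj ->.
rewrite -RintegralZl //; first by apply: eq_Rintegral => t _; rewrite mulrN mulN1r.
apply: continuous_integrable; apply: continuous_mul => //.
apply: continuous_mul; last exact: continuous_sin_scaled.
by move=> y; exact: cvg_cst.
Qed.

Definition ccontinuous g : Prop :=
  continuous (fun t => complex.Re (g t)) /\ continuous (fun t => complex.Im (g t)).

Lemma ReM (x y : R[i]) : complex.Re (x * y)
  = complex.Re x * complex.Re y - complex.Im x * complex.Im y.
Proof. by case: x y => a b [c d]. Qed.
Lemma ImM (x y : R[i]) : complex.Im (x * y)
  = complex.Re x * complex.Im y + complex.Im x * complex.Re y.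
Proof. by case: x y => a b [c d]. Qed.
Lemma ReD (x y : R[i]) : complex.Re (x + y) = complex.Re x + complex.Re y.
Proof. by case: x y => a b [c d]. Qed.
Lemma ImD (x y : R[i]) : complex.Im (x + y) = complex.Im x + complex.Im y.
Proof. by case: x y => a b [c d]. Qed.

Lemma ccontinuousM g h : ccontinuous g -> ccontinuous h -> ccontinuous (fun t => g t * h t).
Proof.
move=> [g1 g2] [h1 h2]; split.
  rewrite (_ : (fun t => _) = fun t => complex.Re (g t) * complex.Re (h t)
     + - (complex.Im (g t) * complex.Im (h t))); last by apply/funext => t; rewrite ReM.
  by apply: continuous_add; [|apply: continuous_opp]; exact: continuous_mul.
rewrite (_ : (fun t => _) = fun t => complex.Re (g t) * complex.Im (h t)
     + complex.Im (g t) * complex.Re (h t)); last by apply/funext => t; rewrite ImM.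
by apply: continuous_add; exact: continuous_mul.
Qed.

Lemma ccontinuousD g h : ccontinuous g -> ccontinuous h -> ccontinuous (fun t => g t + h t).
Proof.
move=> [g1 g2] [h1 h2]; split.
  rewrite (_ : (fun t => _) = fun t => complex.Re (g t) + complex.Re (h t)).
    exact: continuous_add.
  by apply/funext => t; rewrite ReD.
rewrite (_ : (fun t => _) = fun t => complex.Im (g t) + complex.Im (h t)).
  exact: continuous_add.
by apply/funext => t; rewrite ImD.
Qed.

Lemma ccontinuous_cst (c : R[i]) : ccontinuous (fun _ => c).
Proof. by split=> x; exact: cvg_cst. Qed.

Lemma ccontinuousJ g : ccontinuous g -> ccontinuous (fun t => (g t)^*).
Proof.
move=> [g1 g2]; split.
  by rewrite (_ : (fun t => _) = fun t => complex.Re (g t)) //; apply/funext => t; case: (g t).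
rewrite (_ : (fun t => _) = fun t => - complex.Im (g t)); first exact: continuous_opp.
by apply/funext => t; case: (g t).
Qed.

Lemma ccontinuous_expi (r : R) : ccontinuous (fun t => expi (r * t)).
Proof. by split; [exact: continuous_cos_scaled|exact: continuous_sin_scaled]. Qed.

Lemma ccontinuous_sum (I : Type) (l : seq I) (g : I -> R -> R[i]) :
  (forall i, ccontinuous (g i)) -> ccontinuous (fun t => \sum_(i <- l) g i t).
Proof.
move=> h; elim: l => [|i l IH].
  rewrite (_ : (fun t => _) = fun=> 0); first exact: ccontinuous_cst.
  by apply/funext => t; rewrite big_nil.
rewrite (_ : (fun t => _) = fun t => g i t + \sum_(j <- l) g j t).
  exact: ccontinuousD.
by apply/funext => t; rewrite big_cons.
Qed.

Lemma cintegral_ext g h : (forall t, - pi <= t <= pi -> g t = h t) -> ci g = ci h.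
Proof.
move=> gh; rewrite /cintegral; congr (_ +i* _)%C; apply: eq_Rintegral => t;
  by rewrite inE /= in_itv /= => /gh ->.
Qed.

Lemma cintegralD g h : ccontinuous g -> ccontinuous h ->
  ci (fun t => g t + h t) = ci g + ci h.
Proof.
move=> [g1 g2] [h1 h2]; rewrite /cintegral; apply/eqP; rewrite eq_complex /=.
under eq_Rintegral do rewrite ReD.
rewrite RintegralD //; try (by apply: continuous_integrable).
rewrite eqxx /=.
under eq_Rintegral do rewrite ImD.
by rewrite RintegralD //; exact: continuous_integrable.
Qed.

Lemma cintegralZ (c : R[i]) g : ccontinuous g -> ci (fun t => c * g t) = c * ci g.
Proof.
move=> [g1 g2]; rewrite /cintegral; apply/eqP; rewrite eq_complex ReM ImM /=.
have cst_ (a : R) : continuous (fun _ : R => a) by move=> y; exact: cvg_cst.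
under eq_Rintegral do rewrite ReM.
rewrite RintegralB //; try exact: continuous_mul_integrable.
rewrite !RintegralZl //; try (by apply: continuous_integrable).
rewrite eqxx /=.
under eq_Rintegral do rewrite ImM.
rewrite RintegralD //; try exact: continuous_mul_integrable.
by rewrite !RintegralZl //; try (by apply: continuous_integrable).
Qed.

Lemma cintegralJ g : ccontinuous g -> ci (fun t => (g t)^*) = (ci g)^*.
Proof.
move=> [g1 g2]; rewrite /cintegral conjE /=; congr (_ +i* _)%C.
  by apply: eq_Rintegral => t _; case: (g t).
rewrite -mulN1r -RintegralZl //; last exact: continuous_integrable.
by apply: eq_Rintegral => t _; rewrite mulN1r; case: (g t).
Qed.

Lemma cintegral_sum (I : Type) (l : seq I) (c : I -> R[i]) (g : I -> R -> R[i]) :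
  (forall i, ccontinuous (g i)) ->
  ci (fun t => \sum_(i <- l) c i * g i t) = \sum_(i <- l) c i * ci (g i).
Proof.
move=> h; have h' i : ccontinuous (fun t => c i * g i t).
  by apply: ccontinuousM => //; exact: ccontinuous_cst.
elim: l => [|i l IH].
  rewrite big_nil (_ : (fun t => _) = fun t => 0 * (0 : R[i])).
    by rewrite cintegralZ ?mul0r //; exact: ccontinuous_cst.
  by apply/funext => t; rewrite big_nil mul0r.
rewrite big_cons -IH -cintegralZ // -cintegralD //; last exact: ccontinuous_sum.
by congr ci; apply/funext => t; rewrite big_cons.
Qed.

Lemma expiD (a b : R) : expi (a + b) = expi a * expi b.
Proof. by rewrite /expi cosD sinD; simpc; rewrite addrC [cos a * sin b + _]addrC. Qed.

Lemma expi0 : expi 0 = 1 :> R[i].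
Proof. by rewrite /expi cos0 sin0. Qed.

Lemma expiN (a : R) : expi (- a) = (expi a)^*.
Proof. by rewrite /expi cosN sinN. Qed.

Lemma expi_neq0 (a : R) : expi a != 0.
Proof.
apply/eqP => e; have := expiD a (- a).
by rewrite subrr expi0 e mul0r => /eqP; rewrite oner_eq0.
Qed.

Lemma fourierE (f : R[i] -> R[i]) s h : ccontinuous h ->
  (forall t, - pi <= t <= pi -> f (expi t) = h t) ->
  fourier f s = ((2 * pi)^-1)%:C%C * ci (fun t => h t * expi (- s * t)).
Proof.
move=> ch fh; rewrite /fourier; congr (_ * _); apply: cintegral_ext => t /fh ->.
by rewrite mulNr.
Qed.

Section CircleFunction.
Context (f : R[i] -> R[i]) (cf : Cc_circle f).

(** [Cc_circle] gives vanishing for |t| <= pi only; the period 2 pi of [expi] carries it past the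
    endpoints. *)
Lemma circle_flat : flat_ends (fun t => complex.Re (f (expi t))) /\
  flat_ends (fun t => complex.Im (f (expi t))).
Proof.
have [s1 s2 [e e0 h]] := cf.
suff [d d0 hd] : exists2 d : R, 0 < d & forall t, `| `|t| - pi| < d -> f (expi t) = 0.
  by split; split=> //; exists d => // t /hd ->.
have pi0 := pi_gt0 R.
exists (Num.min e pi); first by rewrite lt_min e0.
move=> t; rewrite lt_min ltr_norml => /andP[/andP[l1 l2]]; rewrite ltr_norml => /andP[l3 l4].
have [tp|tp] := leP `|t| pi; first by apply: h => //; lra.
have per u : expi (u + pi *+ 2) = expi u by rewrite /expi cosD2pi sinD2pi.
have [t0|t0] := leP 0 t.
  rewrite ger0_norm // in l1 l2 l3 l4 tp.
  rewrite -(subrK (pi *+ 2) t) per; apply: h; rewrite mulr2n.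
    by rewrite ler0_norm; lra.
  by rewrite ler0_norm; lra.
rewrite ltr0_norm // in l1 l2 l3 l4 tp.
rewrite -per; apply: h; rewrite mulr2n.
  by rewrite ger0_norm; lra.
by rewrite ger0_norm; lra.
Qed.

Lemma circle_ccontinuous : ccontinuous (fun t => f (expi t)).
Proof.
by have [[s1 _] [s2 _]] := circle_flat; split; exact: smooth_continuous.
Qed.

Lemma fourier_decay n : exists2 C, 0 <= C & forall s,
  cabs (fourier f s) * (1 + `|s|) ^+ n <= C.
Proof.
have [fF fG] := circle_flat.
set F := (fun t => complex.Re _) in fF; set G := (fun t => complex.Im _) in fG.
have pi0 := pi_gt0 R.
have cF := smooth_continuous fF.1; have cG := smooth_continuous fG.1.
have key m : exists2 C, 0 <= C & forall s, cabs (fourier f s) * `|s| ^+ m <= C.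
  have [C C0 hC] := integral_trig_decay m fF.
  have [D D0 hD] := integral_trig_decay m fG.
  have p2 : 0 <= (2 * pi)^-1 :> R by rewrite invr_ge0 mulr_ge0 ?ltW.
  exists ((2 * pi)^-1 * (C + D + (D + C))); first by rewrite mulr_ge0 // !addr_ge0.
  move=> s; rewrite (fourierE _ circle_ccontinuous) // cabsM cabsR // -mulrA ler_wpM2l //.
  have [h1 h2] := hC s; have [h3 h4] := hD s.
  pose Fc := \int[mu]_(t in `[- pi, pi]) (F t * cos (s * t)).
  pose Fs := \int[mu]_(t in `[- pi, pi]) (F t * sin (s * t)).
  pose Gc := \int[mu]_(t in `[- pi, pi]) (G t * cos (s * t)).
  pose Gs := \int[mu]_(t in `[- pi, pi]) (G t * sin (s * t)).
  have -> : ci (fun t => f (expi t) * expi (- s * t)) = ((Fc + Gs) +i* (Gc - Fs))%C.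
    rewrite /cintegral /Fc /Fs /Gc /Gs.
    rewrite -RintegralD -?RintegralB //; try (apply: continuous_mul_integrable => //;
      first [exact: continuous_cos_scaled|exact: continuous_sin_scaled]).
    congr (_ +i* _)%C; apply: eq_Rintegral => t _.
      by rewrite ReM /expi /= mulNr cosN sinN mulrN opprK.
    by rewrite ImM /expi /= mulNr cosN sinN mulrN addrC.
  apply: le_trans (ler_wpM2r (exprn_ge0 _ (normr_ge0 _)) (cabs_Re_Im _)) _ => /=.
  rewrite mulrDl; apply: lerD; rewrite mulrC.
    apply: le_trans (ler_wpM2l (exprn_ge0 _ (normr_ge0 _)) (ler_normD _ _)) _.
    by rewrite mulrDr lerD.
  apply: le_trans (ler_wpM2l (exprn_ge0 _ (normr_ge0 _)) (ler_normB _ _)) _.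
  by rewrite mulrDr lerD.
(* (1 + |s|)^n is at most 2^n if |s| <= 1 and at most 2^n |s|^n otherwise, so the rates 0 and n
   suffice. *)
have [C C0 hC] := key 0%N; have [D D0 hD] := key n.
exists (2 ^+ n * (C + D)); first by rewrite mulr_ge0 ?exprn_ge0 ?addr_ge0.
move=> s; have c0 := cabs_ge0 (fourier f s).
have [s1|s1] := leP `|s| 1.
  apply: (@le_trans _ _ (cabs (fourier f s) * 2 ^+ n)).
    by rewrite ler_wpM2l // lerXn2r ?nnegrE ?addr_ge0 //; lra.
  rewrite mulrC ler_wpM2l ?exprn_ge0 //; have := hC s; rewrite expr0 mulr1; lra.
apply: (@le_trans _ _ (cabs (fourier f s) * (2 ^+ n * `|s| ^+ n))).
  rewrite ler_wpM2l // -exprMn lerXn2r ?nnegrE ?addr_ge0 ?mulr_ge0 //; lra.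
rewrite mulrCA ler_wpM2l ?exprn_ge0 //; have := hD s; lra.
Qed.

End CircleFunction.
End FourierDecay.

(** * Sums over classes modulo Z *)

Section CosetSums.
Context (R : realType).
Implicit Types (s t : R) (F D : seq R).

(** Induction with the telescoping bound 2 - 1/(m+1); a step has slack 1/(x (1 + x)^2) with x = m +
    1. *)
Lemma sum_inv_sqr_nat (l : seq nat) : uniq l ->
  \sum_(n <- l) ((1 + n%:R) ^+ 2)^-1 <= 2 :> R.
Proof.
move=> ul; have [N hN] : exists N, forall n, n \in l -> (n < N.+1)%N.
  by exists (\max_(n <- l) n) => n nl; rewrite ltnS; exact: leq_bigmax_seq.
have key m : \sum_(n < m.+1) ((1 + n%:R) ^+ 2)^-1 <= 2 - (m.+1%:R)^-1 :> R.
  elim: m => [|m IH].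
    by rewrite big_ord1 addr0 expr1n invr1; lra.
  rewrite big_ord_recr /=; apply: le_trans (lerD IH (lexx _)) _.
  have m0 : 0 < m.+1%:R :> R by rewrite ltr0n.
  rewrite (_ : m.+2%:R = 1 + m.+1%:R :> R); last by rewrite -[in RHS]natr1 -natr1; ring.
  move: m0; set x := m.+1%:R => x0.
  rewrite -subr_ge0 (_ : _ - _ = (x * (1 + x) ^+ 2)^-1).
    by rewrite invr_ge0 mulr_ge0 ?sqr_ge0 // ltW.
  by field; rewrite !gt_eqF //; lra.
apply: (@le_trans _ _ (\sum_(n < N.+1) ((1 + n%:R) ^+ 2)^-1)); last first.
  by apply: le_trans (key _) _; rewrite gerBl invr_ge0.
rewrite -(big_mkord xpredT (fun n => ((1 + n%:R) ^+ 2)^-1)).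
pose r := [seq n <- index_iota 0 N.+1 | n \in l].
have lr : perm_eq l r.
  apply: uniq_perm => //; first by rewrite filter_uniq ?iota_uniq.
  by move=> n; rewrite mem_filter mem_index_iota; apply/idP/andP => [nl|[]//]; rewrite nl hN.
by rewrite (perm_big _ lr) big_filter [leRHS](bigID (mem l)) /= lerDl sumr_ge0 //.
Qed.

(** Points of one class modulo Z with equal integer parts coincide, so integer parts map F
    injectively into nat and only enlarge the terms. *)
Lemma sum_inv_sqr_ge0 (d : R) F : uniq F ->
  (forall s, s \in F -> 0 <= s /\ exists z : int, s = d + z%:~R) ->
  \sum_(s <- F) ((1 + s) ^+ 2)^-1 <= 2.
Proof.
move=> uF hF.
pose fl (s : R) := Num.truncn s.
have fli s : s \in F -> (fl s)%:R <= s < (fl s).+1%:R.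
  by move=> /hF[s0 _]; exact: truncn_itv.
have inj : {in F &, injective fl}.
  move=> s s' sF s'F e; have := fli s sF; have := fli s' s'F; rewrite -e -natr1.
  have [_ [z sE]] := hF s sF; have [_ [z' s'E]] := hF s' s'F.
  move=> /andP[h1 h2] /andP[h3 h4].
  have : `|(z - z')%:~R| < 1 :> R by rewrite intrB ltr_norml; apply/andP; split; lra.
  rewrite -intr_norm -[1](mulr1z 1) ltr_int => h.
  have zz' : z = z' by lia.
  by rewrite sE s'E zz'.
apply: le_trans (sum_inv_sqr_nat (l := map fl F) _); last by rewrite map_inj_in_uniq.
rewrite big_map big_seq [leRHS]big_seq; apply: ler_sum => s sF.
have /andP[h1 _] := fli s sF.
have f0 : 0 <= (fl s)%:R :> R by [].
rewrite lef_pV2 ?posrE ?exprn_gt0 ?ltr_pwDl //; last by have [] := hF s sF.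
rewrite ler_pXn2r ?nnegrE ?addr_ge0 //; first by rewrite lerD2l.
by have [] := hF s sF.
Qed.

Lemma sum_inv_sqr_coset (d : R) F : uniq F ->
  (forall s, s \in F -> exists z : int, s = d + z%:~R) ->
  \sum_(s <- F) ((1 + `|s|) ^+ 2)^-1 <= 4.
Proof.
move=> uF hF; rewrite (bigID (fun s => 0 <= s)) /= (_ : 4 = 2 + 2 :> R); last by ring.
apply: lerD; rewrite -big_filter.
  rewrite big_seq (eq_bigr (fun s => ((1 + s) ^+ 2)^-1)) -?big_seq.
    apply: (@sum_inv_sqr_ge0 d); first exact: filter_uniq.
    by move=> s; rewrite mem_filter => /andP[s0 /hF].
  by move=> s; rewrite mem_filter => /andP[s0 _]; rewrite ger0_norm.
rewrite big_seq (eq_bigr (fun s => ((1 + - s) ^+ 2)^-1)) -?big_seq.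
  rewrite -(big_map (fun s : R => - s) xpredT (fun s => ((1 + s) ^+ 2)^-1)).
  apply: (@sum_inv_sqr_ge0 (- d)).
    by rewrite map_inj_uniq ?filter_uniq //; exact: oppr_inj.
  move=> s /mapP[s']; rewrite mem_filter -ltNge => /andP[s0 /hF[z zE]] ->.
  split; first by rewrite oppr_ge0 ltW.
  by exists (- z); rewrite zE opprD intrN.
by move=> s; rewrite mem_filter -ltNge => /andP[s0 _]; rewrite ltr0_norm.
Qed.

Lemma sum_inv_sqr_cosets D : exists2 K : R, 0 <= K & forall F, uniq F ->
  (forall s, s \in F -> exists2 d, d \in D & exists z : int, s = d + z%:~R) ->
  \sum_(s <- F) ((1 + `|s|) ^+ 2)^-1 <= K.
Proof.
elim: D => [|d D [K K0 IH]].
  exists 0 => // F _; case: F => [|s F] h; first by rewrite big_nil.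
  by have [|d] := h s; rewrite ?mem_head.
exists (4 + K); first by rewrite addr_ge0.
move=> F uF hF; pose P s := `[< exists z : int, s = d + z%:~R >].
rewrite (bigID P) /=; apply: lerD; rewrite -big_filter.
  apply: (@sum_inv_sqr_coset d); first exact: filter_uniq.
  by move=> s; rewrite mem_filter => /andP[/asboolP].
apply: IH; first exact: filter_uniq.
move=> s; rewrite mem_filter => /andP[/asboolP nP /hF[d']].
rewrite inE => /predU1P[->//|d'D] h; by exists d'.
Qed.

Lemma fourier_summable (f : R[i] -> R[i]) D (q : R) : Cc_circle f ->
  exists2 C : R, 0 <= C & forall F, uniq F ->
  (forall s, s \in F -> exists2 d, d \in D & exists z : int, s = d + z%:~R) ->
  \sum_(s <- F) (1 + `|s|) `^ q * cabs (fourier f s) <= C.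
Proof.
move=> cf; have [K K0 hK] := sum_inv_sqr_cosets D.
pose n := Num.bound `|q|.
have qn : q <= n%:R by apply: le_trans (ler_norm q) (ltW _); apply: archi_boundP.
(* n absorbs the weight of exponent q; the two further powers make the sum converge. *)
have [C C0 hC] := fourier_decay cf (n + 2).
exists (C * K); first exact: mulr_ge0.
move=> F uF hF; apply: le_trans (ler_wpM2l C0 (hK F uF hF)).
rewrite mulr_sumr; apply: ler_sum => s _.
have s1 : 1 <= 1 + `|s| by rewrite lerDl.
have s0 : 0 < 1 + `|s| by apply: lt_le_trans s1.
rewrite ler_pdivlMr ?exprn_gt0 //; apply: le_trans _ (hC s).
rewrite (exprD _ n 2) [leRHS]mulrA ler_wpM2r ?sqr_ge0 // mulrC ler_wpM2l ?cabs_ge0 //.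
by rewrite -(powR_mulrn _ (ltW s0)) ler_powR.
Qed.

End CosetSums.

Section CircleArgument.
Context (R : realType).

(** With d half the difference, cos(2d) = 1 forces sin d = 0, and |d| < pi leaves d = 0. *)
Lemma expi_inj (t u : R) : - pi < t <= pi -> - pi < u <= pi -> expi t = expi u -> t = u.
Proof.
move=> /andP[t1 t2] /andP[u1 u2] e; have pi0 := pi_gt0 R.
have : expi (t - u) = 1 by rewrite expiD e -expiD subrr expi0.
pose d := (t - u) / 2; have dE : t - u = d *+ 2 by rewrite /d mulr2n; lra.
rewrite dE => /(congr1 (@complex.Re R)); rewrite /= cos_mulr2n.
rewrite cos2sin2 => h.
have sd : sin d = 0.
  by apply/eqP; rewrite -sqrf_eq0; apply/eqP; move: h; rewrite mulr2n; lra.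
have d1 : - pi < d < pi by rewrite /d; apply/andP; split; lra.
case/andP: d1 => d1 d2.
case: (ltgtP d 0) => d0; last by move: dE; rewrite d0 mul0rn => /eqP; rewrite subr_eq0 => /eqP.
  have : 0 < sin (- d) by apply: sin_gt0_pi; apply/andP; split; lra.
  by rewrite sinN sd oppr0 ltxx.
have : 0 < sin d by apply: sin_gt0_pi; apply/andP; split; lra.
by rewrite sd ltxx.
Qed.

Lemma circle_arg_expi (t : R) : - pi < t <= pi -> circle_arg (expi t) = t.
Proof.
move=> tp; have /andP[t1 t2] := tp.
have Pt : [set u : R | (- pi < u) /\ (u <= pi) /\ expi u = expi t] t by [].
have [u1 [u2 u3]] := xgetI 0 Pt.
by apply: expi_inj u3; rewrite // /circle_arg u1 u2.
Qed.

(** At t = -pi the argument of [expi t] is pi, but f vanishes there. The discontinuous [e_] is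
    thereby replaced by a continuous function of t. *)
Lemma twist_expi (f : R[i] -> R[i]) (r t : R) : Cc_circle f -> - pi <= t <= pi ->
  (e_ r (expi t) * f (expi t))^* = (expi (r * t) * f (expi t))^*.
Proof.
move=> [_ _ [e e0 he]] /andP[t1 t2].
have pi0 := pi_gt0 R.
have [tp|tp] := ltP (- pi) t; first by rewrite /e_ circle_arg_expi // tp.
have tE : t = - pi by apply/eqP; rewrite eq_le tp.
suff -> : f (expi t) = 0 by rewrite !mulr0.
by apply: he; rewrite tE normrN ger0_norm ?pi_ge0 // gerBl ltW.
Qed.

Lemma twist_continuous (f : R[i] -> R[i]) (r : R) : Cc_circle f ->
  ccontinuous (fun t => (expi (r * t) * f (expi t))^*).
Proof.
move=> cf; apply: ccontinuousJ; apply: ccontinuousM; first exact: ccontinuous_expi.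
exact: circle_ccontinuous.
Qed.

Lemma fourier_twist (f : R[i] -> R[i]) (r u : R) : Cc_circle f ->
  fourier (fun z => (e_ r z * f z)^*) u = (fourier f (- (r + u)))^*.
Proof.
move=> cf; rewrite (@fourierE _ _ _ (fun t => (expi (r * t) * f (expi t))^*)).
- rewrite (fourierE _ (circle_ccontinuous cf)) // rmorphM /= conjR; congr (_ * _).
  rewrite -cintegralJ.
    apply: cintegral_ext => t _.
    rewrite !rmorphM /= -!expiN mulrAC -expiD mulrC; congr (_ * expi _); ring.
  by apply: ccontinuousM; [exact: circle_ccontinuous|exact: ccontinuous_expi].
- exact: twist_continuous.
- by move=> t; exact: twist_expi.
Qed.

End CircleArgument.

Section SmearedForm.
Context (R : realType) (V : unitary_voa R) (Wj Wk : unitary_module V).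

(** The factor e^(it) of the integral cancels one power in x^(-s-1). Only agreement of g with a
    continuous h on [-pi, pi] is asked, so that twisted functions are covered. *)
Lemma smeared_formE (T : R -> Wj -> Wk) (g : R[i] -> R[i]) (h : R -> R[i]) wj wk F :
  uniq F -> (forall s, s \notin F -> umod_ip Wk (T s wj) wk = 0) ->
  ccontinuous h -> (forall t, - pi <= t <= pi -> g (expi t) = h t) ->
  smeared_form T g wj wk = \sum_(s <- F) umod_ip Wk (T s wj) wk * fourier g s.
Proof.
move=> uF hF ch gh; rewrite /smeared_form.
have ch' s : ccontinuous (fun t => h t * expi (- s * t)).
  by apply: ccontinuousM => //; exact: ccontinuous_expi.
under [RHS]eq_bigr do rewrite (fourierE _ ch gh) mulrA.
rewrite -cintegral_sum //; apply: cintegral_ext => t /gh ->.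
rewrite (fsumE uF); last by move=> s /hF ->; rewrite mul0r.
rewrite !mulr_suml; apply: eq_bigr => s _.
rewrite (_ : expi (- ((s + 1) * t)) = expi (- s * t) * expi (- t)).
  rewrite (_ : expi (- t) = (expi t)^-1); first by move: (_%:C%C) => c; field; exact: expi_neq0.
  by apply: (mulfI (expi_neq0 t)); rewrite -expiD subrr expi0 divff // expi_neq0.
by rewrite -expiD; congr expi; ring.
Qed.

End SmearedForm.

(** * Smeared modes *)

Section GradedModes.
Context (R : realType) (V : unitary_voa R) (Wj Wk : unitary_module V).
Local Notation normj := (hnorm (umod_ip Wj)).
Local Notation normk := (hnorm (umod_ip Wk)).
Local Notation dsj := (vmod_ds (umodP Wj)).
Local Notation dsk := (vmod_ds (umodP Wk)).
Implicit Types (T : R -> Wj -> Wk) (s a b p r t M C D : R).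

Definition graded_modes D T : Prop :=
  (forall s, linear (T s)) /\
  (forall a s (w : Wj), mgr a w -> mgr (a + D - s - 1) (T s w)).

(** The energy bound on homogeneous vectors, where the r-norm is explicit and no completion is
    involved. *)
Definition hom_bound T M r t : Prop := forall s a (w : Wj), mgr a w ->
  normk (T s w) <= M * (1 + `|s|) `^ t * ((1 + a) `^ r * normj w).

Lemma sesquilinear_ext (Phi Psi : Wj -> Wk -> R[i]) :
  sesquilinear_form Phi -> sesquilinear_form Psi ->
  (forall a b w w', mgr a w -> mgr b w' -> Phi w w' = Psi w w') -> Phi = Psi.
Proof.
move=> [l1 l2] [l1' l2'] h; apply/funext => w; apply/funext => w'.
have sl (F : Wj -> Wk -> R[i]) v : sesquilinear_form F ->
    F w v = \sum_(a <- gsupp (@mgr R V Wj) w) F (component (@mgr R V Wj) w a) v.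
  move=> [f1 _]; rewrite {1}(comp_sum dsj w); elim: (gsupp _ _) => [|a l IH].
    rewrite !big_nil; have := f1 (-1) 0 0 v.
    by rewrite scaler0 add0r mulN1r addNr.
  by rewrite !big_cons -IH; have := f1 1 (component (@mgr R V Wj) w a)
    (\sum_(j <- l) component (@mgr R V Wj) w j) v; rewrite scale1r mul1r.
have sr (F : Wj -> Wk -> R[i]) v : sesquilinear_form F ->
    F v w' = \sum_(b <- gsupp (@mgr R V Wk) w') F v (component (@mgr R V Wk) w' b).
  move=> [_ f2]; rewrite {1}(comp_sum dsk w'); elim: (gsupp _ _) => [|b l IH].
    rewrite !big_nil; have := f2 (-1) 0 0 v.
    by rewrite scaler0 add0r rmorphN1 mulN1r addNr.
  by rewrite !big_cons -IH; have := f2 1 (component (@mgr R V Wk) w' b)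
    (\sum_(j <- l) component (@mgr R V Wk) w' j) v; rewrite scale1r rmorph1 mul1r.
rewrite (sl Phi) // (sl Psi) //; apply: eq_bigr => a _.
rewrite (sr Phi) // (sr Psi) //; apply: eq_bigr => b _.
exact: h (comp_gr dsj _ _) (comp_gr dsk _ _).
Qed.

Section OneFamily.
Context (D : R) (T : R -> Wj -> Wk) (gT : graded_modes D T).

Lemma graded0 s : T s 0 = 0.
Proof. by have := gT.1 s (-1) 0 0; rewrite scaler0 add0r => h; rewrite h scaleN1r addNr. Qed.

Lemma graded_sum s (I : Type) (l : seq I) (F : I -> Wj) :
  T s (\sum_(i <- l) F i) = \sum_(i <- l) T s (F i).
Proof.
elim: l => [|i l IH]; first by rewrite !big_nil graded0.
by rewrite !big_cons -IH; have := gT.1 s 1 (F i) (\sum_(j <- l) F j); rewrite !scale1r.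
Qed.

Lemma graded_ip a b s w w' : mgr a w -> mgr b w' -> s != a - b + D - 1 ->
  umod_ip Wk (T s w) w' = 0.
Proof.
move=> wa w'b ns; apply: ip_orth (gT.2 a s w wa) w'b _.
by apply: contraNneq ns => <-; apply/eqP; ring.
Qed.

Lemma graded_supp (w : Wj) (w' : Wk) : exists F : seq R, uniq F /\
  forall s, s \notin F -> umod_ip Wk (T s w) w' = 0.
Proof.
exists (undup [seq a - b + D - 1 | a <- gsupp (@mgr R V Wj) w, b <- gsupp (@mgr R V Wk) w']).
split; first exact: undup_uniq.
move=> s; rewrite mem_undup => sF; rewrite (comp_sum dsj w) graded_sum ip_suml.
rewrite big1_seq // => a /andP[_ aw]; rewrite (comp_sum dsk w') ip_sumr.
rewrite big1_seq // => b /andP[_ bw].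
apply: graded_ip (comp_gr dsj w a) (comp_gr dsk w' b) _.
by apply: contraNneq sF => ->; apply/allpairsP; exists (a, b).
Qed.

(** Only weight b - D + s + 1 is sent into W(b), so a Riesz vector in that finite-dimensional space
    serves for each component of w'. *)
Lemma graded_adjoint s (w' : Wk) : exists v, forall w, umod_ip Wk (T s w) w' = umod_ip Wj w v.
Proof.
rewrite (comp_sum dsk w'); elim: (gsupp _ _) => [|b l [v hv]].
  by exists 0 => w; rewrite big_nil !ip0r.
pose u := component (@mgr R V Wk) w' b; have ub : mgr b u := comp_gr dsk w' b.
have [|v' v'g hv'] := @riesz_gr _ _ Wj (b - D + s + 1) (fun w => umod_ip Wk (T s w) u).
  by move=> c x y; rewrite gT.1 ipDl ipZl.
exists (v' + v) => w; rewrite big_cons -/u !ipDr hv; congr (_ + _).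
rewrite (comp_sum dsj w) graded_sum !ip_suml; apply: eq_bigr => a _.
have wa := comp_gr dsj w a.
have [e|ne] := eqVneq a (b - D + s + 1); first by apply: hv'; rewrite -e.
rewrite (ip_orth wa v'g ne) (graded_ip wa ub) //.
by apply: contraNneq ne => ->; apply/eqP; ring.
Qed.

Section Smear.
Context (g : R[i] -> R[i]) (h : R -> R[i]).
Hypotheses (ch : ccontinuous h) (gh : forall t, - pi <= t <= pi -> g (expi t) = h t).

Lemma smeared_form_hom a b w w' : mgr a w -> mgr b w' ->
  smeared_form T g w w' = umod_ip Wk (T (a - b + D - 1) w) w' * fourier g (a - b + D - 1).
Proof.
move=> wa w'b.
rewrite (@smeared_formE _ _ _ _ T g h _ _ [:: a - b + D - 1]) ?big_seq1 //.
by move=> s; rewrite inE; exact: graded_ip.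
Qed.

Lemma smeared_form_sesquilinear : sesquilinear_form (smeared_form T g).
Proof.
split=> c u v w.
  have [F [uF hF]] := graded_supp u w; have [G [uG hG]] := graded_supp v w.
  pose E := undup (F ++ G).
  have uE : uniq E by exact: undup_uniq.
  have E0 s : s \notin E -> umod_ip Wk (T s u) w = 0 /\ umod_ip Wk (T s v) w = 0.
    by rewrite mem_undup mem_cat negb_or => /andP[/hF -> /hG ->].
  rewrite !(smeared_formE uE _ ch gh); try (by move=> s /E0[]).
    rewrite mulr_sumr -big_split; apply: eq_bigr => s _ /=.
    by rewrite gT.1 ipDl ipZl mulrDl -mulrA.
  by move=> s /E0[e1 e2]; rewrite gT.1 ipDl ipZl e1 e2 mulr0 addr0.
have [F [uF hF]] := graded_supp w u; have [G [uG hG]] := graded_supp w v.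
pose E := undup (F ++ G).
have uE : uniq E by exact: undup_uniq.
have E0 s : s \notin E -> umod_ip Wk (T s w) u = 0 /\ umod_ip Wk (T s w) v = 0.
  by rewrite mem_undup mem_cat negb_or => /andP[/hF -> /hG ->].
rewrite !(smeared_formE uE _ ch gh); try (by move=> s /E0[]).
  rewrite mulr_sumr -big_split; apply: eq_bigr => s _ /=.
  by rewrite ipDr ipZr mulrDl -mulrA.
by move=> s /E0[e1 e2]; rewrite ipDr ipZr e1 e2 mulr0 addr0.
Qed.

End Smear.

(** Since |a - b| <= 1 + |s| + |D|, the quotient of 1 + a and 1 + b is at most X in both directions;
    the sign of p selects one. This is the origin of |p| in the norm of f. *)
Lemma weight_ratio s a b p : 0 <= a -> 0 <= b -> s = a - b + D - 1 ->
  (1 + b) `^ p <= ((2 + `|D|) * (1 + `|s|)) `^ `|p| * (1 + a) `^ p.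
Proof.
move=> a0 b0 sE; set X := (2 + `|D|) * (1 + `|s|).
have X0 : 0 < X by rewrite mulr_gt0 // ltr_pwDl.
have key x y : 0 <= x -> 0 <= y -> `|x - y| <= 1 + `|s| + `|D| -> 1 + y <= X * (1 + x).
  move=> x0 y0; rewrite ler_norml => /andP[h1 _].
  have h2 : 1 + `|s| + `|D| + 1 <= X.
    have : 0 <= `|D| * `|s| by rewrite mulr_ge0.
    by have := normr_ge0 s; rewrite /X; lra.
  have h3 : 1 <= X by have := normr_ge0 s; have := normr_ge0 D; lra.
  have : 0 <= (X - 1) * x by rewrite mulr_ge0 // subr_ge0.
  lra.
have ab : `|a - b| <= 1 + `|s| + `|D|.
  rewrite (_ : a - b = 1 + s - D); last by rewrite sE; ring.
  apply: le_trans (ler_normB _ _) _; rewrite lerD2r.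
  by apply: le_trans (ler_normD _ _) _; rewrite normr1.
have pos x : 0 <= x -> 0 < 1 + x by move=> x0; rewrite ltr_pwDl.
have [p0|p0] := leP 0 p.
  rewrite ger0_norm // -powRM ?addr_ge0 ?(ltW X0) //.
  apply: ge0_ler_powR => //; last exact: key.
    by rewrite nnegrE ltW // pos.
  by rewrite nnegrE mulr_ge0 ?addr_ge0 ?(ltW X0).
rewrite ltr0_norm //.
have := ltW p0; rewrite -oppr_ge0 => q0.
have e x : (1 + x) `^ p = ((1 + x) `^ (- p))^-1 by rewrite -powRN opprK.
have pa : 0 < (1 + a) `^ (- p) by rewrite powR_gt0 // pos.
have pb : 0 < (1 + b) `^ (- p) by rewrite powR_gt0 // pos.
rewrite !e -[_^-1]mul1r ler_pdivrMr // [_ / _ * _]mulrAC ler_pdivlMr // mul1r.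
rewrite -powRM ?addr_ge0 ?(ltW X0) //.
apply: ge0_ler_powR => //; last by apply: key => //; rewrite distrC.
  by rewrite nnegrE ltW // pos.
by rewrite nnegrE mulr_ge0 ?addr_ge0 ?(ltW X0).
Qed.

(** With one weight fixed, the exponent is injective in the other, so rows and columns sum over
    distinct exponents. S is left open: Z_V gives the estimate of (a), a finite list of cosets gives
    a finite constant for each f. *)
Lemma smeared_schur (f : R[i] -> R[i]) (S : set R) M r t p C : Cc_circle f ->
  0 <= M -> 0 <= C -> hom_bound T M r t ->
  (forall s a w, mgr a w -> T s w != 0 -> S s) ->
  (forall F, uniq F -> (forall s, s \in F -> S s) ->
     \sum_(s <- F) (1 + `|s|) `^ (`|p| + t) * cabs (fourier f s) <= C) ->
  schur_bounded (smeared_form T f) p (p + r) (M * (2 + `|D|) `^ `|p| * C).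
Proof.
move=> cf M0 C0 hT hS hC; set K := _ `^ `|p|.
have K0 : 0 <= K by exact: powR_ge0.
pose g s := (1 + `|s|) `^ (`|p| + t) * cabs (fourier f s).
have g0 s : 0 <= g s by rewrite mulr_ge0 ?powR_ge0 ?cabs_ge0.
pose s0 a b := a - b + D - 1.
(* Entries with exponent outside S are set to 0: the modes vanish there, and C only controls sums
   over S. *)
pose ga a b := if `[< S (s0 a b) >] then M * K * g (s0 a b) else 0.
have MK0 : 0 <= M * K by rewrite mulr_ge0.
have gsum (e : R -> R) F : injective e -> uniq F ->
    \sum_(x <- F) (if `[< S (e x) >] then M * K * g (e x) else 0) <= M * K * C.
  move=> ie uF; rewrite -big_mkcond -big_filter -mulr_sumr ler_wpM2l //.
  rewrite -(big_map e xpredT g); apply: hC.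
    by rewrite map_inj_uniq // filter_uniq.
  by move=> s /mapP[x]; rewrite mem_filter => /andP[/asboolP Sx _] ->.
exists ga; split.
- by move=> a b; rewrite /ga; case: ifP => // _; rewrite mulr_ge0.
- move=> b F uF; apply: (gsum (s0^~ b)) => // x y; rewrite /s0; lra.
- move=> a F uF; apply: (gsum (s0 a)) => // x y; rewrite /s0; lra.
move=> a b w w' wa w'b.
rewrite (smeared_form_hom (circle_ccontinuous cf) _ wa w'b) // -/(s0 a b) cabsM.
have rhs0 : 0 <= ga a b * ((1 + a) `^ (p + r) * normj w) * ((1 + b) `^ (- p) * normk w').
  rewrite !mulr_ge0 ?powR_ge0 ?hnorm_ge0 // /ga.
  by case: ifP => // _; rewrite mulr_ge0.
have [e|n0] := eqVneq (T (s0 a b) w) 0; first by rewrite e ip0l cabs0 mul0r.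
have [e|w0] := eqVneq w 0; first by rewrite e graded0 eqxx in n0.
have [e|w'0] := eqVneq w' 0; first by rewrite {1}e ip0r cabs0 mul0r.
have a0 := weight_ge0 wa w0; have b0 := weight_ge0 w'b w'0.
rewrite /ga asboolT; last exact: hS wa n0.
have pb : 0 < (1 + b) `^ p by rewrite powR_gt0 // ltr_pwDl.
rewrite powRN; set s := s0 a b in n0 *.
apply: (@le_trans _ _ (M * (1 + `|s|) `^ t * ((1 + a) `^ r * normj w) * normk w' * cabs (fourier f s))).
  rewrite ler_wpM2r ?cabs_ge0 //; apply: le_trans (cauchy_schwarz _ _ _) _.
  by rewrite ler_wpM2r ?hnorm_ge0 // hT.
have hr := weight_ratio p a0 b0 (erefl s).
rewrite powRM in hr; last first.
  by rewrite addr_ge0. by rewrite addr_ge0.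
rewrite -/K in hr.
rewrite /g (powRD (x := 1 + `|s|)); last by apply/implyP => _; rewrite gt_eqF // ltr_pwDl.
rewrite (powRD (x := 1 + a)); last by apply/implyP => _; rewrite gt_eqF // ltr_pwDl.
set A := M * _ * _ * _ * _.
set B := (X in _ <= X).
(* The factor relating B to A is at least 1 by [weight_ratio]. *)
have -> : B = A * ((K * (1 + `|s|) `^ `|p| * (1 + a) `^ p) / (1 + b) `^ p).
  by rewrite /A /B; ring.
rewrite ler_peMr //; last by rewrite ler_pdivlMr // mul1r.
by rewrite /A !mulr_ge0 ?powR_ge0 ?hnorm_ge0 ?cabs_ge0.
Qed.

Lemma smeared_tame (f : R[i] -> R[i]) (l : seq R) M r t : Cc_circle f ->
  0 <= M -> 0 <= r -> hom_bound T M r t ->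
  (forall s a w, mgr a w -> T s w != 0 -> exists2 d, d \in l & exists z : int, s = d + z%:~R) ->
  tame (smeared_form T f).
Proof.
move=> cf M0 r0 hT hS; split.
  by apply: (smeared_form_sesquilinear (circle_ccontinuous cf)) => t' _.
exists r => // p; have [C C0 hC] := fourier_summable l (`|p| + t) cf.
exists (M * (2 + `|D|) `^ `|p| * C); first by rewrite !mulr_ge0 ?powR_ge0.
by apply: (smeared_schur cf M0 C0 hT hS).
Qed.

End OneFamily.

End GradedModes.

(** * Powers of L_1 and the adjoint formula *)

Section AlternatingConvolution.
Context (K : fieldType) (K0 : forall n, n.+1%:R != 0 :> K).

Lemma fact_neq0 n : n`!%:R != 0 :> K.
Proof. by rewrite -(prednK (fact_gt0 n)). Qed.

(* The coefficients are those of exp(-X) exp(X) = 1. *)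
Lemma alternating_convolution N (x : nat -> K) : (0 < N)%N ->
  (forall n, (N <= n)%N -> x n = 0) ->
  \sum_(m < N) \sum_(l < N) ((-1) ^+ m / m`!%:R / l`!%:R) * x (m + l)%N = x 0%N.
Proof.
move=> N0 xN.
have inner (m : nat) : (m < N)%N ->
    \sum_(l < N) ((-1) ^+ m / m`!%:R / l`!%:R) * x (m + l)%N
    = \sum_(n < N | (m <= n)%N) ((-1) ^+ m / m`!%:R / (n - m)`!%:R) * x n.
  move=> mN; rewrite -(big_mkord xpredT (fun l => (_ / l`!%:R) * x (m + l)%N)).
  rewrite -(big_mkord (fun n => m <= n)%N (fun n => (_ / (n - m)`!%:R) * x n)).
  rewrite (@big_cat_nat _ _ _ (N - m)) ?leq_subr //= [X in _ + X]big_nat_cond.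
  rewrite [X in _ + X]big1 ?addr0; last first.
    by move=> l /andP[/andP[h _] _]; rewrite xN ?mulr0 // -leq_subLR.
  rewrite [RHS](@big_cat_nat _ _ _ m) ?(ltnW mN) //= [X in _ = X + _]big_nat_cond.
  rewrite [X in _ = X + _]big1 ?add0r; last first.
    by move=> n /andP[/andP[_ h] h']; rewrite leqNgt h in h'.
  rewrite -[index_iota m N]/(index_iota (0 + m) N) big_addn big_nat_cond [RHS]big_nat_cond.
  apply: eq_big => [l|l _]; first by rewrite leq_addl !andbT.
  by rewrite addnK addnC.
rewrite (eq_bigr _ (fun (m : 'I_N) _ => inner m (ltn_ord m))).
rewrite (exchange_big_dep xpredT) //=.
have sumn (n : 'I_N) : \sum_(m < N | (m <= n)%N) ((-1) ^+ m / m`!%:R / (n - m)`!%:R) * x n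
    = (n == 0 :> nat)%:R * x n.
  rewrite -mulr_suml; congr (_ * _).
  apply: (mulfI (fact_neq0 n)); rewrite mulr_sumr.
  transitivity (\sum_(m < n.+1) (1 : K) ^+ (n - m) * (-1) ^+ m *+ 'C(n, m)); last first.
    rewrite -exprDn subrr expr0n; case: (n : nat) => [|k]; first by rewrite fact0 mulr1.
    by rewrite mulr0.
  rewrite (big_ord_widen N (fun m => 1 ^+ (n - m) * (-1) ^+ m *+ 'C(n, m))) ?ltn_ord //.
  apply: eq_bigr => m mn; rewrite expr1n mul1r.
  have e : n`!%:R = 'C(n, m)%:R * (m`!%:R * (n - m)`!%:R) :> K.
    by rewrite -!natrM bin_fact.
  rewrite e -mulr_natr; field; by rewrite !fact_neq0.
rewrite (eq_bigr _ (fun n _ => sumn n)) (bigD1 (Ordinal N0)) //= mul1r.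
by rewrite big1 ?addr0 // => n n0; case: eqP => [e|_]; rewrite ?mul0r //; case/eqP: n0; exact: val_inj.
Qed.

End AlternatingConvolution.

Section RaisingFamily.
Context (R : realType) (V : unitary_voa R) (Wi Wj Wk : unitary_module V).
Context (Y : Wi -> R -> Wj -> Wk) (hY : intertwining Y).
Local Notation normj := (hnorm (umod_ip Wj)).
Local Notation normk := (hnorm (umod_ip Wk)).
Local Notation blY := (inter_bl hY).

Lemma inter_graded d (w : Wi) : mgr d w -> graded_modes d (Y w).
Proof.
move=> wd; split=> [s|a s v va]; first exact: blY.2.
exact: (inter_shift (umodP Wi) (umodP Wj) (umodP Wk) hY s wd va).
Qed.

Definition poly_bounded (T : R -> Wj -> Wk) : Prop := exists M r t,
  [/\ 0 <= M, 0 <= r, 0 <= t & hom_bound T M r t].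

(** Each of the three terms of [inter_L1] is at most a constant times Q P, with P the bound for w:
    L_1 costs at most the weight ([L1_bound]), the shift to s + 1 costs 2^t. The summands of c
    correspond to these terms. *)
Lemma poly_bounded_L1 d (w : Wi) : mgr d w -> poly_bounded (Y w) -> poly_bounded (Y (Ln 1 w)).
Proof.
move=> wd [M [r [t [M0 r0 t0 h]]]].
pose c := (2 + `|d|) + 1 + (2 + 2 * `|d|) * 2 `^ t.
have c0 : 0 <= c by rewrite !addr_ge0 // mulr_ge0 ?powR_ge0 // addr_ge0 ?mulr_ge0.
exists (M * c), (r + 1), (t + 1); split; rewrite ?mulr_ge0 ?addr_ge0 //.
move=> s a v va.
have [->|v0] := eqVneq v 0.
  by rewrite (modes0r blY) hnorm0 mulr_ge0 ?mulr_ge0 ?powR_ge0 ?hnorm_ge0.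
have a0 := weight_ge0 va v0.
have a1 : 0 < 1 + a by rewrite ltr_pwDl.
have s1 : 0 < 1 + `|s| by rewrite ltr_pwDl.
have nv := hnorm_ge0 (umod_ip Wj) v.
pose P := M * (1 + `|s|) `^ t * ((1 + a) `^ r * normj v).
have P0 : 0 <= P by rewrite !mulr_ge0 ?powR_ge0.
pose Q := (1 + `|s|) * (1 + a).
have Q0 : 0 <= Q by rewrite mulr_ge0 // ltW.
have sQ : 1 + `|s| <= Q by rewrite ler_peMr ?lerDl // ltW.
have -> : M * c * (1 + `|s|) `^ (t + 1) * ((1 + a) `^ (r + 1) * normj v) = c * (Q * P).
  rewrite !powRD ?powRr1 ?(ltW a1) ?(ltW s1) //; last 2 first.
    by apply/implyP => _; rewrite gt_eqF.
    by apply/implyP => _; rewrite gt_eqF.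
  by rewrite /Q /P; ring.
rewrite (inter_L1 (umodP Wi) hY s v wd).
set y := Y w s v; have yP : normk y <= P by exact: h.
have ygr : mgr (a + d - s - 1) y by exact: (inter_graded wd).2.
have t1 : normk (Ln 1 y) <= (2 + `|d|) * (Q * P).
  have [->|y0] := eqVneq y 0.
    by rewrite (Ln0 (umodP Wk)) hnorm0 mulr_ge0 ?addr_ge0 // mulr_ge0.
  apply: le_trans (L1_bound ygr) _; rewrite mulrA; apply: ler_pM => //.
  - exact: weight_ge0 ygr y0.
  - exact: hnorm_ge0.
  have : 0 <= `|s| * a by rewrite mulr_ge0.
  have : 0 <= `|d| * Q by rewrite mulr_ge0.
  have := ler_norm d; have := ler_norm (- s); rewrite normrN.
  have : `|d| <= `|d| * Q.
    by rewrite ler_peMr // (le_trans _ sQ) // lerDl.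
  rewrite /Q; lra.
have t2 : normk (Y w s (Ln 1 v)) <= 1 * (Q * P).
  rewrite mul1r; have L1v := L1_gr (umodP Wj) va.
  have [->|L0] := eqVneq (Ln 1 v) 0.
    by rewrite (modes0r blY) hnorm0 mulr_ge0.
  have a2 := weight_ge0 L1v L0.
  apply: le_trans (h s _ _ L1v) _.
  rewrite (_ : Q * P = M * (1 + `|s|) `^ t * ((1 + a) `^ r * (Q * normj v))); last by rewrite /P; ring.
  rewrite ler_wpM2l ?mulr_ge0 ?powR_ge0 //.
  apply: ler_pM; rewrite ?powR_ge0 ?hnorm_ge0 //.
    by apply: ge0_ler_powR; rewrite ?nnegrE //; lra.
  apply: le_trans (L1_bound va) _; rewrite ler_wpM2r //.
  have : 0 <= `|s| * a by rewrite mulr_ge0.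
  by have := normr_ge0 s; rewrite /Q; lra.
have t3 : normk ((s + 2 - 2 * d)%:C%C *: Y w (s + 1) v) <= (2 + 2 * `|d|) * 2 `^ t * (Q * P).
  rewrite hnormZ cabs_real.
  rewrite (_ : _ * (Q * P) = ((2 + 2 * `|d|) * Q) * (2 `^ t * P)); last by ring.
  apply: ler_pM; rewrite ?hnorm_ge0 //.
    have : `|s + 2 - 2 * d| <= `|s| + 2 + 2 * `|d|.
      apply: le_trans (ler_normB _ _) _; apply: lerD.
        by apply: le_trans (ler_normD _ _) _; rewrite [`|2|]ger0_norm.
      by rewrite normrM ger0_norm.
    move=> h1; apply: le_trans h1 _.
    have : 2 * `|d| <= 2 * `|d| * Q by rewrite ler_peMr ?mulr_ge0 // (le_trans _ sQ) // lerDl.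
    have := normr_ge0 s; lra.
  apply: le_trans (h (s + 1) a v va) _.
  rewrite /P !mulrA ler_wpM2r // ler_wpM2r ?powR_ge0 // [2 `^ t * M]mulrC -mulrA ler_wpM2l //.
  rewrite -powRM ?(ltW s1) //; apply: ge0_ler_powR; rewrite ?nnegrE ?addr_ge0 ?mulr_ge0 //.
  by have := ler_normD s 1; rewrite normr1; have := normr_ge0 s; lra.
rewrite (_ : c * (Q * P) = (2 + `|d|) * (Q * P) + 1 * (Q * P)
    + (2 + 2 * `|d|) * 2 `^ t * (Q * P)); last by rewrite /c; ring.
apply: le_trans (hnorm_triangle _ _ _) _; apply: lerD t3.
by apply: le_trans (hnorm_triangle _ _ _) _; rewrite hnorm_opp; exact: lerD.
Qed.

Lemma poly_bounded_shift (T : R -> Wj -> Wk) (n : nat) :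
  poly_bounded T -> poly_bounded (fun s => T (s - n%:R)).
Proof.
move=> [M [r [t [M0 r0 t0 h]]]]; exists (M * (1 + n%:R) `^ t), r, t; split=> //.
  by rewrite mulr_ge0 ?powR_ge0.
move=> s a v va; apply: le_trans (h _ _ _ va) _.
have [->|v0] := eqVneq v 0; first by rewrite hnorm0 !mulr0.
rewrite ler_wpM2r ?mulr_ge0 ?powR_ge0 ?hnorm_ge0 // -mulrA ler_wpM2l //.
rewrite -powRM ?addr_ge0 //; apply: ge0_ler_powR; rewrite ?nnegrE ?addr_ge0 ?mulr_ge0 ?addr_ge0 //.
have h1 := ler_normB s n%:R; rewrite [`|n%:R|]ger0_norm // in h1.
by have := mulr_ge0 (ler0n R n) (normr_ge0 s); lra.
Qed.

(** L_1 lowers the weight by 1 and weights are nonnegative. N > 0 gives the alternating sum its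
    index 0. *)
Lemma iter_L1_nilpotent d (w : Wi) : mgr d w -> exists2 N, (0 < N)%N &
  forall n, (N <= n)%N -> iter n (Ln 1) w = 0.
Proof.
move=> wd; have [N hN] := nat_bound d; exists N.+1 => // n Nn.
apply/eqP/negPn/negP => n0.
have := weight_ge0 (iter_L1_gr (umodP Wi) n wd) n0.
have : N%:R <= n%:R :> R by rewrite ler_nat ltnW.
by lra.
Qed.

Lemma poly_bounded_iter d (w : Wi) n : mgr d w -> poly_bounded (Y w) ->
  poly_bounded (Y (iter n (Ln 1) w)).
Proof.
move=> wd h; elim: n => [//|n IH].
exact: poly_bounded_L1 (iter_L1_gr (umodP Wi) n wd) IH.
Qed.

Lemma energy_bound_hom (T : R -> Wj -> Wk) (Hj : completion (umod_ip Wj)) M r t :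
  energy_bound Hj T M r t -> hom_bound T M r t.
Proof. by move=> h s a w wa; have := h s w; rewrite (energy_norm_hom _ _ wa). Qed.

End RaisingFamily.

Section Conjugation.
Context (R : realType) (V : unitary_voa R) (W : unitary_module V).

Lemma conj_vec_in (w : W) : in_gdual (W := W) (fun w' : W => umod_ip W w' w).
Proof.
apply/asboolP; split=> [a u v|]; first by rewrite ipDl ipZl.
apply: (@sub_finite_set _ _ [set` gsupp (@mgr R V W) w]); last exact: finite_seq.
move=> s [w' w's] /=; apply: contraNT => sw.
by rewrite (ip_compr _ w's) (gsuppP (vmod_ds (umodP W)) sw) ip0r.
Qed.

Lemma conj_vecE (w w' : W) : gdual_fun (conj_vec w) w' = umod_ip W w' w.
Proof.
rewrite /conj_vec; have := insubdK (0 : gdual W) (conj_vec_in w).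
by move=> /(congr1 (fun phi : W -> R[i] => phi w')).
Qed.

Lemma conj_vecK : cancel (@conj_vec R V W) (@conj_vec_inv R V W).
Proof.
move=> w; have Pw : [set u | conj_vec u = conj_vec w] w by [].
have e := xgetI 0 Pw; apply: (@ip_inj _ _ (umod_ip W)) => w'.
by rewrite -!conj_vecE; congr (gdual_fun _ w'); exact: e.
Qed.

End Conjugation.

Section AdjointModes.
Context (R : realType) (V : unitary_voa R) (Wi Wj Wk : unitary_module V).
Context (Y : Wi -> R -> Wj -> Wk) (hY : intertwining Y) (wi : Wi) (D : R) (hwi : mgr D wi).
Context (N : nat) (hN : forall n, (N <= n)%N -> iter n (Ln 1) wi = 0).
Local Notation blY := (inter_bl hY).

(* The shift by [n] makes all these families change the weight by the same amount. *)
Definition raised_modes n s : Wj -> Wk := Y (iter n (Ln 1) wi) (s - n%:R).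

Lemma raised_graded n : graded_modes D (raised_modes n).
Proof.
have [h1 h2] := inter_graded hY (iter_L1_gr (umodP Wi) n hwi).
split=> [s|a s w wa]; first exact: h1.
by have := h2 a (s - n%:R) w wa; rewrite (_ : a + _ - _ - 1 = a + D - s - 1) //; ring.
Qed.

Lemma raised_modes0 n s w : (N <= n)%N -> raised_modes n s w = 0.
Proof. by move=> /hN e; rewrite /raised_modes e (modes0l blY). Qed.

(** The phase belongs to L_1^m wi, of weight D - m; l counts the further powers of L_1. *)
Definition adjoint_coef m l : R[i] := expi (- (pi * (D - m%:R))) / l`!%:R.

Definition adjoint_source m s (w : Wj) : Wk :=
  \sum_(l < N) adjoint_coef m l *: raised_modes (m + l) s w.

Lemma adjoint_source_graded m : graded_modes D (adjoint_source m).
Proof.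
split=> [s a u v|a s w wa].
  rewrite /adjoint_source scaler_sumr -big_split /=; apply: eq_bigr => l _.
  by rewrite (raised_graded (m + l)).1 scalerDr !scalerA mulrC.
apply: (gr_sum (vmod_ds (umodP Wk))) => l; apply: (grZ (vmod_ds (umodP Wk))).
exact: (raised_graded (m + l)).2.
Qed.

Local Notation adj m := (adjoint_intertwining Y (conj_vec (iter m (Ln 1) wi))).

(** With d = D - m the index 2d - l - 2 - u is s - (m + l) for an s free of l, so all l are
    collected at one index of [raised_modes]. *)
Lemma adjoint_modeE m u wk wj :
  umod_ip Wj wj (adj m u wk)
  = umod_ip Wk (adjoint_source m (2 * D - m%:R - 2 - u) wj) wk.
Proof.
set s := 2 * D - m%:R - 2 - u; rewrite /adjoint_intertwining conj_vecK.
have it0 l : iter l (Ln 1) 0 = 0 :> Wi.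
  by elim: l => [//|l /= ->]; exact: Ln0 (umodP Wi) 1.
have mg := iter_L1_gr (umodP Wi) m hwi.
set T := (fun w : Wj => _).
have -> : T = adjoint_source m s.
  apply/funext => w; rewrite /T (fsum_single (i0 := D - m%:R)); last first.
    move=> d dD; rewrite fsbig1 // => l _.
    by rewrite (comp_neq (vmod_ds (umodP Wi)) mg dD) it0 (modes0l blY) scaler0.
  rewrite (comp_id (vmod_ds (umodP Wi)) mg) (@fsum_nat _ N); last first.
    move=> l Nl; rewrite -iterD hN ?(modes0l blY) ?scaler0 //.
    by rewrite (leq_trans Nl) // leq_addr.
  apply: eq_bigr => l _; rewrite /adjoint_coef /raised_modes -iterD addnC.
  by congr (_ *: Y _ _ w); rewrite /s mulr2n natrD; ring.
have [v hv] := graded_adjoint (adjoint_source_graded m) s wk.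
have Pv : [set v | forall wj, umod_ip Wk (adjoint_source m s wj) wk = umod_ip Wj wj v] v by [].
have e := xgetI 0 Pv; rewrite /formal_adjoint; symmetry; exact: e.
Qed.

Lemma adjoint_graded m : graded_modes (D - m%:R) (adj m).
Proof.
split=> [u c x y|b u wk wkb].
  apply: (@ip_inj _ _ (umod_ip Wj)) => w.
  by rewrite ipDr ipZr !adjoint_modeE ipDr ipZr.
apply: (comp_eq_gr (vmod_ds (umodP Wj))) => a ab.
set v := adj m u wk; pose x := component (@mgr R V Wj) v a.
have xa : mgr a x := comp_gr (vmod_ds (umodP Wj)) v a.
apply: (@ip_eq0 _ _ (umod_ip Wj)); rewrite -/x -(ip_compr v xa) /v adjoint_modeE.
apply: (graded_ip (adjoint_source_graded m) xa wkb).
by apply: contraNneq ab => e; apply/eqP; lra.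
Qed.

Section SmearedAdjoint.
Context (f : R[i] -> R[i]) (cf : Cc_circle f).
Hypothesis htame : forall n, tame (smeared_form (raised_modes n) f).

Definition twisted m : R[i] -> R[i] := fun z => (e_ (m%:R + 2%:R - 2%:R * D) z * f z)^*.

(** On homogeneous vectors one exponent survives on each side. The twist m + 2 - 2D turns the
    coefficient at u into that of f at a - b + D - 1, the exponent common to all [raised_modes]. *)
Lemma smeared_adjointE m :
  smeared_form (adj m) (twisted m) = fun wk wj =>
  (\sum_(l < N) adjoint_coef m l * smeared_form (raised_modes (m + l)) f wj wk)^*.
Proof.
have tw t : - pi <= t <= pi -> twisted m (expi t)
    = (expi ((m%:R + 2%:R - 2%:R * D) * t) * f (expi t))^* by exact: twist_expi.
apply: sesquilinear_ext.
- exact: (smeared_form_sesquilinear (adjoint_graded m) (twist_continuous _ cf) tw).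
- exact: (tame_swap (tame_sum (adjoint_coef m) (fun l => htame (m + l)))).1.
move=> b a wk wj wkb wja.
rewrite (smeared_form_hom (adjoint_graded m) (twist_continuous _ cf) tw wkb wja).
rewrite fourier_twist // ipC adjoint_modeE -rmorphM; congr (_^*).
set u := b - a + (D - m%:R) - 1.
have -> : - (m%:R + 2%:R - 2%:R * D + u) = a - b + D - 1 by rewrite /u; ring.
have -> : 2 * D - m%:R - 2 - u = a - b + D - 1 by rewrite /u; ring.
rewrite /adjoint_source ip_suml mulr_suml; apply: eq_bigr => l _.
rewrite ipZl -mulrA.
by rewrite (smeared_form_hom (raised_graded (m + l)) (circle_ccontinuous cf) (fun _ _ => erefl) wja wkb).
Qed.

Lemma smeared_adjoint_tame m : tame (smeared_form (adj m) (twisted m)).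
Proof.
rewrite smeared_adjointE.
exact: (tame_swap (tame_sum (adjoint_coef m) (fun l => htame (m + l)))).
Qed.

Lemma smeared_form0 (T : R -> Wj -> Wk) g wj wk : (forall s, T s wj = 0) ->
  smeared_form T g wj wk = 0.
Proof.
move=> T0; rewrite /smeared_form (_ : (fun t => _) = fun _ => 0 * (0 : R[i])).
  by rewrite cintegralZ ?mul0r //; exact: ccontinuous_cst.
apply/funext => t; rewrite fsbig1 ?mul0r // => s _.
by rewrite T0 ip0l mul0r.
Qed.

Lemma smeared_adjoint0 m wk wj : (N <= m)%N -> smeared_form (adj m) (twisted m) wk wj = 0.
Proof.
move=> Nm; rewrite smeared_adjointE big1 ?rmorph0 // => l _.
rewrite smeared_form0 ?mulr0 // => s.
by rewrite raised_modes0 // (leq_trans Nm) // leq_addr.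
Qed.

Lemma expi_nat_pi (m : nat) : expi (pi *+ m) = (-1) ^+ m :> R[i].
Proof.
elim: m => [|m IH]; first by rewrite mulr0n expi0.
rewrite mulrS expiD IH exprS; congr (_ * _).
by rewrite /expi cospi sinpi; apply/eqP; rewrite eq_complex /= oppr0 !eqxx.
Qed.

(** The prefactor e^(-i pi D) times the conjugate phase e^(i pi (D - m)) is (-1)^m, so
    [alternating_convolution] applies. *)
Lemma smeared_adjoint_sum wk wj : (0 < N)%N ->
  \sum_(m < N) (expi (- (pi * D)) / m`!%:R) * smeared_form (adj m) (twisted m) wk wj
  = (smeared_form (raised_modes 0) f wj wk)^*.
Proof.
move=> N0; pose x n := (smeared_form (raised_modes n) f wj wk)^*.
have xN n : (N <= n)%N -> x n = 0.
  by move=> Nn; rewrite /x smeared_form0 ?rmorph0 // => s; exact: raised_modes0.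
rewrite -/(x 0%N) -(alternating_convolution _ N0 xN); last first.
  by move=> n; rewrite pnatr_eq0.
apply: eq_bigr => m _; rewrite smeared_adjointE rmorph_sum mulr_sumr.
apply: eq_bigr => l _; rewrite rmorphM -/(x (m + l)%N) mulrA; congr (_ * _).
rewrite /adjoint_coef rmorphM fmorphV rmorph_nat /= -expiN opprK.
rewrite mulrAC mulrA -expiD (_ : - (pi * D) + _ = - (pi *+ m)); last first.
  by rewrite -[pi *+ m]mulr_natr; ring.
rewrite expiN expi_nat_pi rmorphXn rmorphN1.
by rewrite mulrAC.
Qed.

End SmearedAdjoint.
End AdjointModes.

Section Smeared.
Context (R : realType) (V : unitary_voa R).

Lemma smeared_form_op (Wj Wk : unitary_module V) (Hj : completion (umod_ip Wj))
    (Hk : completion (umod_ip Wk)) (T : R -> Wj -> Wk) (f : R[i] -> R[i]) x :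
  smeared Hj Hk T f x = form_op (smeared_form T f) Hk x.
Proof. by []. Qed.

Lemma form_op0 (Wj Wk : unitary_module V) (Hj : completion (umod_ip Wj))
    (Hk : completion (umod_ip Wk)) (Phi : Wj -> Wk -> R[i]) (x : Hj) :
  (forall w w', Phi w w' = 0) -> Hinf x -> form_op Phi Hk x = 0.
Proof.
move=> Phi0 hx; have -> : Phi = fun _ _ => 0.
  by apply/funext => w; apply/funext => w'.
have t0 := tame0 Wj Wk; apply: (form_act_uniq (form_opP t0 Hk hx)) => w.
rewrite ip0l (_ : form_vec _ Hj w = 0) ?ip0r //.
by apply: form_vec_uniq => // w'; rewrite ip0r.
Qed.

Lemma Hinf_linear (W : unitary_module V) (H : completion (umod_ip W)) c (x y : H) :
  Hinf x -> Hinf y -> Hinf (c *: x + y).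
Proof.
move=> hx hy p p0; have [x' /energy_powP hx'] := hx p p0.
have [y' /energy_powP hy'] := hy p p0.
exists (c *: x' + y'); apply/energy_powP => a.
by rewrite !hproj_linear hx' hy' scalerDr !scalerA mulrC.
Qed.

Lemma Hinf0 (W : unitary_module V) (H : completion (umod_ip W)) : Hinf (0 : H).
Proof. by rewrite -(hemb0 H); exact: Hinf_hemb. Qed.

Lemma Hinf_sum (W : unitary_module V) (H : completion (umod_ip W)) (I : Type)
    (l : seq I) (c : I -> R[i]) (x : I -> H) :
  (forall i, Hinf (x i)) -> Hinf (\sum_(i <- l) c i *: x i).
Proof.
move=> hx; elim: l => [|i l IH]; first by rewrite big_nil; exact: Hinf0.
by rewrite big_cons; exact: Hinf_linear.
Qed.

Section Rational.
Hypothesis hrat : forall (W : lmodType R[i]) (Y : V -> int -> W -> W),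
  weak_module Y -> N_gradable Y -> completely_reducible Y.

Lemma weight_classes (W : unitary_module V) : exists l : seq R,
  forall a (w : W), mgr a w -> w != 0 -> exists2 d, d \in l & exists k : nat, a = d + k%:R.
Proof.
have [/finite_set_seqP[l _ hl] _] := low_submodules (umodP W) hrat.
exists l => a w wa w0; have [d [k [ld ak]]] := low_below (umodP W) wa w0.
by exists d; [exact: hl|exists k].
Qed.

Lemma weight_irreducible (W : unitary_module V) a (w : W) : mgr a w -> w != 0 ->
  exists (M : vmodule V) (D : R) (n : int),
    [/\ irreducible_module M, lowest_weight M D & a = D + n%:~R].
Proof.
move=> wa w0; have [d [k [ld ak]]] := low_below (umodP W) wa w0.
have [M [D [k' [irr lw DE]]]] := low_lowest_weight (umodP W) hrat ld.
exists M, D, (k%:Z - k'%:Z); split=> //.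
by rewrite ak DE intrB; ring.
Qed.

(** The list is chosen before T, so one list serves the modes of all L_1^n wi. *)
Lemma mode_cosets (Wj Wk : unitary_module V) (D : R) : exists l : seq R,
  forall T : R -> Wj -> Wk, graded_modes D T -> forall s a (w : Wj), mgr a w -> T s w != 0 ->
  exists2 d, d \in l & exists z : int, s = d + z%:~R.
Proof.
have [lj hj] := weight_classes Wj; have [lk hk] := weight_classes Wk.
exists [seq d - d' + D - 1 | d <- lj, d' <- lk] => T gT s a w wa Tw0.
have w0 : w != 0 by apply: contraNneq Tw0 => ->; rewrite (graded0 gT).
have [d dj [k aE]] := hj _ _ wa w0.
have [d' dk [k' bE]] := hk _ _ (gT.2 a s w wa) Tw0.
exists (d - d' + D - 1); first by apply/allpairsP; exists (d, d').
exists (k%:Z - k'%:Z); rewrite intrB /=.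
by rewrite aE in bE; lra.
Qed.

(** The three vectors are nonzero, so their weights are congruent modulo Z to lowest weights of
    irreducible modules, and s + 1 is the weight of wi plus that of w minus that of the image. *)
Lemma mode_Z (Wi Wj Wk : unitary_module V) (Y : Wi -> R -> Wj -> Wk) :
  intertwining Y -> forall D (wi : Wi) s a (w : Wj), mgr D wi -> mgr a w ->
  Y wi s w != 0 -> Z_ V s.
Proof.
move=> hY D wi s a w wiD wa Yw0.
have wi0 : wi != 0 by apply: contraNneq Yw0 => ->; rewrite (modes0l (inter_bl hY)).
have w0 : w != 0 by apply: contraNneq Yw0 => ->; rewrite (modes0r (inter_bl hY)).
have [Mi [di [ni [iri lwi DE]]]] := weight_irreducible wiD wi0.
have [Mj [dj [nj [irj lwj aE]]]] := weight_irreducible wa w0.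
have [Mk [dk [nk [irk lwk bE]]]] := weight_irreducible ((inter_graded hY wiD).2 a s w wa) Yw0.
exists (ni + nj - nk - 1), (di + dj - dk); split.
  by exists Mi, Mj, Mk, di, dj, dk.
by rewrite !intrB intrD; rewrite aE DE in bE; lra.
Qed.

End Rational.
End Smeared.

Lemma circle_norm_sum (R : realType) (V : voa R) (f : R[i] -> R[i]) (q : R) (F : seq R) :
  uniq F -> (forall s, s \in F -> Z_ V s) ->
  ((\sum_(s <- F) (1 + `|s|) `^ q * cabs (fourier f s))%:E <= circle_norm V q f)%E.
Proof.
move=> uF FZ; apply: esum_ge; exists [set` F].
  by split; [exact: finite_seq|move=> s /=; exact: FZ].
by rewrite -fsbig_seq // sumEFin.
Qed.

Theorem proposition3p9 (R : realType) (V : unitary_voa R)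
    (hCFT : CFT_type V) (hC2 : C2_cofinite V)
    (hrat : forall (W : lmodType R[i]) (Y : V -> int -> W -> W),
        weak_module Y -> N_gradable Y -> completely_reducible Y)
    (Wi Wj Wk : unitary_module V)
    (Hj : completion (umod_ip Wj)) (Hk : completion (umod_ip Wk))
    (Ya : Wi -> R -> Wj -> Wk) (hYa : intertwining Ya)
    (wi : Wi) (Dwi : R) (hwi : mgr Dwi wi)
    (M r t : R) (hM : 0 <= M) (hr : 0 <= r) (ht : 0 <= t)
    (hbound : energy_bound Hj (Ya wi) M r t) :
  (* (a) *)
  ((forall f : R[i] -> R[i], Cc_circle f ->
      forall xi : Hj, Hinf xi -> Hinf (smeared Hj Hk (Ya wi) f xi)) /\
   (forall p : R, exists2 Mp : R, 0 <= Mp &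
      forall f : R[i] -> R[i], Cc_circle f ->
      forall xi : Hj, Hinf xi ->
        ((energy_norm p (smeared Hj Hk (Ya wi) f xi))%:E
         <= Mp%:E * circle_norm V (`|p| + t) f * (energy_norm (p + r) xi)%:E)%E)) /\
  (* (b) *)
  (forall f : R[i] -> R[i], Cc_circle f ->
     exists2 B : Hk -> Hj,
       is_formal_adjoint (smeared Hj Hk (Ya wi) f) B &
       (forall eta : Hk, Hinf eta ->
          B eta =
          \sum_(m \in [set: nat])
            (expi (- (pi * Dwi)) / m`!%:R) *:
            smeared Hk Hj
              (adjoint_intertwining Ya (conj_vec (iter m (Ln 1) wi)))
              (fun z => (e_ (m%:R + 2%:R - 2%:R * Dwi) z * f z)^* ) eta) /\
       (Ln 1 wi = 0 ->
        forall eta : Hk, Hinf eta ->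
          B eta =
          expi (- (pi * Dwi)) *:
            smeared Hk Hj
              (adjoint_intertwining Ya (conj_vec wi))
              (fun z => (e_ (2%:R - 2%:R * Dwi) z * f z)^* ) eta)).
Proof.
have [N N0 hN] := iter_L1_nilpotent hwi.
have hb : hom_bound (Ya wi) M r t := energy_bound_hom hbound.
have gYa : graded_modes Dwi (Ya wi) := inter_graded hYa hwi.
have [l hl] := mode_cosets hrat Wj Wk Dwi.
have pb n : poly_bounded (raised_modes Ya wi n).
  apply: poly_bounded_shift; apply: (poly_bounded_iter hYa n hwi).
  by exists M, r, t.
have htame f : Cc_circle f -> forall n, tame (smeared_form (raised_modes Ya wi n) f).
  move=> cf n; have [M' [r' [t' [M'0 r'0 t'0 hb']]]] := pb n.
  have g := raised_graded hYa hwi n.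
  exact: (smeared_tame g cf M'0 r'0 hb' (hl _ g)).
have raised0 : raised_modes Ya wi 0 = Ya wi.
  by apply/funext => s; rewrite /raised_modes /= subr0.
have htame0 f : Cc_circle f -> tame (smeared_form (Ya wi) f).
  by move=> cf; have := htame f cf 0%N; rewrite raised0.
split; first split.
- by move=> f cf xi hxi; rewrite smeared_form_op; apply: form_op_Hinf => //; exact: htame0.
- move=> p; set K := M * (2 + `|Dwi|) `^ `|p|.
  have K0 : 0 <= K by rewrite mulr_ge0 ?powR_ge0.
  (* K + 1 and not K: if K were 0, an infinite norm would make the right side 0. *)
  exists (K + 1); first by rewrite addr_ge0.
  move=> f cf xi hxi; rewrite smeared_form_op; have tf := htame0 f cf.
  set E := energy_norm (p + r) xi; have E0 : 0 <= E := energy_norm_ge0 _ _.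
  have bound C (S : set R) : 0 <= C ->
      (forall s a w, mgr a w -> Ya wi s w != 0 -> S s) ->
      (forall F, uniq F -> (forall s, s \in F -> S s) ->
         \sum_(s <- F) (1 + `|s|) `^ (`|p| + t) * cabs (fourier f s) <= C) ->
      energy_norm p (form_op (smeared_form (Ya wi) f) Hk xi) <= K * C * E.
    move=> C0 hS hC; apply: form_op_bound => //; first by rewrite mulr_ge0.
    exact: (smeared_schur gYa cf hM C0 hb hS hC).
  have norm0 : (0 <= circle_norm V (`|p| + t) f)%E.
    apply: esum_ge0 => s _; rewrite lee_fin; apply: mulr_ge0; first exact: powR_ge0.
    exact: (cabs_ge0 (fourier f s)).
  have [fin|/negP] := boolP (circle_norm V (`|p| + t) f \is a fin_num).
    have C0 := fine_ge0 norm0.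
    rewrite -(fineK fin) -!EFinM lee_fin.
    apply: le_trans (bound _ (Z_ V) C0 _ _) _.
    + by move=> s a w wa; exact: (mode_Z hrat hYa hwi wa).
    + by move=> F uF FZ; rewrite -lee_fin (fineK fin); exact: circle_norm_sum.
    by rewrite ler_wpM2r // ler_wpM2r // lerDl.
  (* When |f|_{V,|p|+t} is infinite the bound is not void, since 0 * +oo = 0. *)
  rewrite ge0_fin_numE // ltey => /negP; rewrite negbK => /eqP ->.
  have [C C0 hC] := fourier_summable l (`|p| + t) cf.
  have hE := bound C _ C0 (hl _ gYa) hC.
  rewrite gt0_muley ?lte_fin ?ltr_wpDl //.
  have [E1|E1] := eqVneq E 0.
    by rewrite E1 mule0 lee_fin; rewrite E1 mulr0 in hE.
  by rewrite gt0_mulye ?leey // lte_fin lt_def E1.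
move=> f cf.
have tf := htame0 f cf.
have tame_adj m := smeared_adjoint_tame hYa hwi hN cf (htame f cf) m.
pose term m (eta : Hk) : Hj := (expi (- (pi * Dwi)) / m`!%:R) *:
  smeared Hk Hj (adjoint_intertwining Ya (conj_vec (iter m (Ln 1) wi)))
    (fun z => (e_ (m%:R + 2%:R - 2%:R * Dwi) z * f z)^* ) eta.
have term0 eta m : Hinf eta -> (N <= m)%N -> term m eta = 0.
  move=> heta Nm; rewrite /term smeared_form_op form_op0 ?scaler0 // => wk wj.
  exact: (smeared_adjoint0 hYa hwi hN cf (htame f cf)).
(* B is the formula itself, so the content is that it is a formal adjoint; on H^oo the terms with m
   >= N vanish. *)
exists (fun eta => \sum_(m \in [set: nat]) term m eta); last split=> //.
  have fin eta : Hinf eta ->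
      \sum_(m \in [set: nat]) term m eta = \sum_(m < N) term m eta.
    by move=> heta; apply: fsum_nat => m; exact: term0.
  split=> [eta heta|xi eta hxi heta]; rewrite fin //.
    by apply: Hinf_sum => m; rewrite smeared_form_op; apply: form_op_Hinf.
  apply: (form_adjoint tf (fun m : 'I_N => tame_adj m)) => // wk wj.
  have := smeared_adjoint_sum hYa hwi hN cf (htame f cf) wk wj N0.
  by rewrite raised0.
move=> L0 eta heta; rewrite (fsum_single (i0 := 0%N)); last first.
  move=> m m0; rewrite /term smeared_form_op form_op0 ?scaler0 // => wk wj.
  (* Here 1 takes the place of N, since L_1 wi = 0 kills all higher powers. *)
  apply: (@smeared_adjoint0 _ _ _ _ _ _ hYa wi Dwi hwi 1%N _ f cf (htame f cf)).
    case=> // n _; rewrite iterSr L0.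
    by elim: n => [//|n /= ->]; exact: Ln0 (umodP Wi) 1.
  by rewrite lt0n.
by rewrite /term fact0 divr1 add0r.
Qed.
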